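(* Let $n\ge2$ and let $\mathbf{X}\sim WVAG^n(a,\boldsymbol{\alpha},\boldsymbol{\mu},\Sigma)$ be a weak variance alpha-gamma process. (i) If $\boldsymbol{\mu}=\mathbf{0}$, then $\mathbf{X}\sim SD^n$, i.e. $\mathbf{X}$ is self-decomposable. (ii) If $|\Sigma|\neq0$ and $\boldsymbol{\mu}\neq\mathbf{0}$, then $\mathbf{X}\not\sim SD^n$, i.e. $\mathbf{X}$ is not self-decomposable.
   Context: Vectors are row vectors; $\langle\mathbf{x},\mathbf{y}\rangle=\mathbf{x}\mathbf{y}'$, $\|\mathbf{x}\|_M^2=\mathbf{x}M\mathbf{x}'$, $\|\cdot\|$ is the Euclidean norm, $|\Sigma|$ the determinant, $\mathbf{e}_k$ the $k$th canonical basis vector, $\boldsymbol{\delta}_{\mathbf{y}}$ the Dirac measure. A covariance matrix is a real symmetric nonnegative definite matrix. For $\mathbf{t}\in[0,\infty)^n$: $\mathbf{t}\diamond\boldsymbol{\mu}=(t_1\mu_1,\dots,t_n\mu_n)$, $\mathbf{t}\diamond\Sigma=(\min\{t_k,t_l\}\Sigma_{kl})_{k,l}$. Alpha-gamma subordinator: let $n\ge2$, $a>0$, $\boldsymbol{\alpha}=(\alpha_1,\dots,\alpha_n)\in(0,\infty)^n$ with $a\alpha_k<1$ for all $k$, and $\beta_k=(1-a\alpha_k)/\alpha_k$. Let $G_0,\dots,G_n$ be independent gamma subordinators, $G_0$ with $G_0(t)\sim\mathrm{Gamma}(\text{shape }at,\text{rate }1)$ and $G_k(t)\sim\mathrm{Gamma}(\text{shape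 }\beta_kt,\text{rate }1/\alpha_k)$, $1\le k\le n$. Then $\mathbf{T}\sim AG^n_S(a,\boldsymbol{\alpha})$ is the subordinator equal in law to $G_0\boldsymbol{\alpha}+(G_1,\dots,G_n)$. Weak subordination: for Brownian motion $\mathbf{B}$ in $\mathbb{R}^n$ with drift $\boldsymbol{\mu}\in\mathbb{R}^n$ and (arbitrary) covariance matrix $\Sigma$, and a driftless subordinator $\mathbf{T}$ with Lévy measure $\mathcal{T}$, $\mathbf{B}\odot\mathbf{T}$ is the Lévy process with characteristic exponent $\Psi(\boldsymbol{\theta})=\int_{[0,\infty)^n\setminus\{\mathbf{0}\}}\big(\exp\{\mathrm{i}\langle\boldsymbol{\theta},\mathbf{t}\diamond\boldsymbol{\mu}\rangle-\frac12\|\boldsymbol{\theta}\|^2_{\mathbf{t}\diamond\Sigma}\}-1\big)\,\mathcal{T}(\mathrm{d}\mathbf{t})$, where $\mathbb{E}\exp\{\mathrm{i}\langle\boldsymbol{\theta},\mathbf{X}(t)\rangle\}=\exp\{t\Psi(\boldsymbol{\theta})\}$. $\mathbf{X}\sim WVAG^n(a,\boldsymbol{\alpha},\boldsymbol{\mu},\Sigma)$ means $\mathbf{X}$ is equal in law to $\mathbf{B}\odot\mathbf{T}$ with $\mathbf{B}$ Brownian motion with drift $\boldsymbol{\mu}$ and covariance $\Sigma$, and $\mathbf{T}\sim AG^n_S(a,\boldsymbol{\alpha})$. Equivalently, $\mathbf{X}$ has exponent $\Psi(\boldsymbol{\theta})=-\int\ln\{(\|\mathbf{u}\|^2-\mathrm{i}\langle\mathbf{u}\diamond\boldsymbol{\mu},\boldsymbol{\theta}\rangle+\frac12\|\boldsymbol{\theta}\|^2_{\mathbf{u}\diamond\Sigma})/\|\mathbf{u}\|^2\}\,\mathcal{U}(\mathrm{d}\mathbf{u})$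 with $\mathcal{U}=a\boldsymbol{\delta}_{\boldsymbol{\alpha}/\|\boldsymbol{\alpha}\|^2}+\sum_{k=1}^n\beta_k\boldsymbol{\delta}_{\mathbf{e}_k/\alpha_k}$ and $\ln$ the principal branch. A random vector $X$ is self-decomposable if for every $0<b<1$ there is a random vector $Z_b$, independent of $X$, such that $X$ and $bX+Z_b$ have the same law; a Lévy process $\mathbf{X}$ is self-decomposable ($\mathbf{X}\sim SD^n$) if $\mathbf{X}(1)$ is. *)

(* Defs.v *)
From mathcomp Require Import all_boot all_order all_algebra.
From mathcomp Require Import all_classical all_reals all_analysis.
From mathcomp Require Import complex.

Set Implicit Arguments.
Unset Strict Implicit.
Unset Printing Implicit Defensive.

Import Order.TTheory GRing.Theory Num.Theory.
Import numFieldNormedType.Exports.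

Local Open Scope classical_set_scope.
Local Open Scope ring_scope.
Local Open Scope complex_scope.

Notation borel V := (g_sigma_algebraType (@open V)).

Section random_elements.
Context {R : realType} {V : normedModType R}.

Definition random_element {d : measure_display} {T : measurableType d}
    (X : T -> V) : Prop :=
  measurable_fun [set: T] (X : T -> borel V).

Definition same_law {d d' : measure_display}
    {T : measurableType d} {T' : measurableType d'}
    (P : probability T R) (X : T -> V) (P' : probability T' R) (Y : T' -> V) :
    Prop :=
  forall A : set (borel V), measurable A -> P (X @^-1` A) = P' (Y @^-1` A).

(* Equality of the finite-dimensional distributions; time is [0, +oo[ and the
   values of a process at negative times are never looked at. *)
Definition same_law_process {d d' : measure_display}
    {T : measurableType d} {T' : measurableType d'}
    (P : probability T R) (X : R -> T -> V)
    (P' : probability T' R) (Y : R -> T' -> V) : Prop :=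
  forall (m : nat) (t : 'I_m -> R) (A : 'I_m -> set (borel V)),
    (forall i, 0 <= t i) -> (forall i, measurable (A i)) ->
    P [set w | forall i, A i (X (t i) w)] =
    P' [set w | forall i, A i (Y (t i) w)].

Definition independent_pair {d : measure_display} {T : measurableType d}
    (P : probability T R) (X Z : T -> V) : Prop :=
  forall A B : set (borel V), measurable A -> measurable B ->
    P (X @^-1` A `&` Z @^-1` B) = (P (X @^-1` A) * P (Z @^-1` B))%E.

Context {d : measure_display} {T : measurableType d}.

Definition independent_systems (P : probability T R) (I : finType)
    (F : I -> set (set T)) : Prop :=
  forall (J : {set I}) (A : I -> set T), (forall i, i \in J -> F i (A i)) ->
    P (\bigcap_(i in [set` J]) A i) = (\prod_(i in J) P (A i))%E.

Definition sigma_of (X : T -> V) : set (set T) :=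
  preimage_set_system [set: T] X (measurable : set (set (borel V))).

Definition sigma_of_process (X : R -> T -> V) : set (set T) :=
  <<s \bigcup_(t in [set t | 0 <= t]) sigma_of (X t) >>.

Record levy_process (P : probability T R) (X : R -> T -> V) : Prop := {
  levy_random : forall t : R, 0 <= t -> random_element (X t);
  levy_zero : {ae P, forall w, X 0 w = 0};
  levy_independent : forall (m : nat) (s : nat -> R),
    0 <= s 0%N -> (forall i, s i <= s i.+1) ->
    independent_systems P
      (fun i : 'I_m => sigma_of (fun w => X (s i.+1) w - X (s i) w));
  levy_stationary : forall s t : R, 0 <= s -> 0 <= t ->
    same_law P (fun w => X (s + t) w - X s w) P (X t);
  levy_stochastic_continuity : forall t e : R, 0 <= t -> 0 < e ->
    P [set w | e < `|X s w - X t w|]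
      @[s --> within [set s | 0 <= s] (nbhs t)] --> 0%E;
  levy_cadlag : {ae P, forall w,
    (forall t : R, 0 <= t -> X s w @[s --> t^'+] --> X t w) /\
    (forall t : R, 0 < t -> cvg (X s w @[s --> t^'-]))}
}.

(* For each b, the pair (X', Z_b) of independent vectors with X' distributed as
   X lives on a probability space of its own: the one carrying X may be too
   small to carry a vector Z_b independent of X. *)
Definition self_decomposable (P : probability T R) (X : T -> V) : Prop :=
  forall b : R, 0 < b -> b < 1 ->
  exists (d' : measure_display) (T' : measurableType d')
    (P' : probability T' R) (X' Z : T' -> V),
    [/\ random_element X', random_element Z, same_law P X P' X',
        independent_pair P' X' Z &
        same_law P X P' (fun w => b *: X' w + Z w)].

Definition self_decomposable_process (P : probability T R) (X : R -> T -> V) :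
  Prop := self_decomposable P (X 1).

End random_elements.

Section gamma.
Context {R : realType}.

Definition Gamma_fun (s : R) : R :=
  \int[lebesgue_measure]_(x in `]0, +oo[) (x `^ (s - 1) * expR (- x)).

Definition gamma_pdf (shape rate : R) : R -> R :=
  (fun x => rate `^ shape / Gamma_fun shape * x `^ (shape - 1)
            * expR (- (rate * x))) \_ `]0, +oo[.

Context {d : measure_display} {T : measurableType d}.

Definition gamma_distributed (P : probability T R) (Y : T -> R)
    (shape rate : R) : Prop :=
  forall A : set (borel R), measurable A ->
    P (Y @^-1` A) =
    (\int[lebesgue_measure]_(x in A) (gamma_pdf shape rate x)%:E)%E.

Record gamma_subordinator (P : probability T R) (G : R -> T -> R)
    (shape rate : R) : Prop := {
  gamma_levy : levy_process P G;
  gamma_nondecreasing : {ae P, forall w,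
    forall s t : R, 0 <= s -> s <= t -> G s w <= G t w};
  gamma_marginal : forall t : R, 0 < t ->
    gamma_distributed P (G t) (shape * t) rate
}.

End gamma.

Section vectors.
Context {R : realType} {n : nat}.
Implicit Types (x y t mu : 'rV[R]_n) (M S : 'M[R]_n).

Definition dot x y : R := (x *m y^T) 0 0.

Definition sqnorm_mx M x : R := (x *m M *m x^T) 0 0.

Definition covariance_matrix S : Prop :=
  S^T = S /\ forall x, 0 <= sqnorm_mx S x.

Definition diamond_vec t mu : 'rV[R]_n := \row_k (t 0 k * mu 0 k).

Definition diamond_mx t S : 'M[R]_n :=
  \matrix_(k, l) (Num.min (t 0 k) (t 0 l) * S k l).

(* [0, +oo[^n without the origin *)
Definition orthant : set (borel 'rV[R]_n) :=
  [set t : 'rV[R]_n | (forall k, 0 <= t 0 k) /\ t != 0].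

End vectors.

Section complex_functions.
Context {R : realType}.

Definition cexp (z : R[i]) : R[i] :=
  (expR (complex.Re z) * cos (complex.Im z)) +i* (expR (complex.Re z) * sin (complex.Im z)).

Definition cintegral {d : measure_display} {T : measurableType d}
    (m : {measure set T -> \bar R}) (D : set T) (f : T -> R[i]) : R[i] :=
  (\int[m]_(x in D) complex.Re (f x)) +i* (\int[m]_(x in D) complex.Im (f x)).

Definition char_fun {d : measure_display} {T : measurableType d} {n : nat}
    (P : probability T R) (X : T -> 'rV[R]_n) (theta : 'rV[R]_n) : R[i] :=
  cintegral P [set: T] (fun w => cexp ('i * (dot theta (X w))%:C)).

End complex_functions.

Section weak_subordination.
Context {R : realType} {n : nat} {d : measure_display} {T : measurableType d}.
Implicit Type P : probability T R.

Definition subordinator P (S : R -> T -> 'rV[R]_n) : Prop :=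
  levy_process P S /\
  {ae P, forall w, forall s t : R, 0 <= s -> s <= t ->
    forall k, S s w 0 k <= S t w 0 k}.

(* The subordinator S has Laplace exponent
     - ln E exp(- <lambda, S 1>) = \int (1 - exp(- <lambda, s>)) nu(ds);
   that it is driftless is the absence of a linear term in lambda. In the
   integrability condition `|s| is the sup norm, equivalent to the Euclidean
   norm. *)
Definition driftless_with_levy_measure P (S : R -> T -> 'rV[R]_n)
    (nu : {measure set (borel 'rV[R]_n) -> \bar R}) : Prop :=
  [/\ nu (~` orthant) = 0%E,
      (\int[nu]_(s in orthant) (Num.min 1 `|s : 'rV[R]_n|)%:E < +oo)%E &
      forall (lambda : 'rV[R]_n) (t : R), (forall k, 0 <= lambda 0 k) ->
        0 <= t ->
        \int[P]_w expR (- dot lambda (S t w)) =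
        expR (- (t * \int[nu]_(s in orthant) (1 - expR (- dot lambda s))))].

Definition weak_exponent (mu : 'rV[R]_n) (Sigma : 'M[R]_n)
    (nu : {measure set (borel 'rV[R]_n) -> \bar R}) (theta : 'rV[R]_n) : R[i] :=
  cintegral nu orthant (fun t =>
    cexp ('i * (dot theta (diamond_vec t mu))%:C
          - (2^-1 * sqnorm_mx (diamond_mx t Sigma) theta)%:C) - 1).

(* X is, in law, the weak subordination of a Brownian motion with drift mu and
   covariance Sigma by a driftless subordinator with Levy measure nu; it
   depends on these two processes through (mu, Sigma) and nu only. *)
Definition weakly_subordinated P (X : R -> T -> 'rV[R]_n) (mu : 'rV[R]_n)
    (Sigma : 'M[R]_n) (nu : {measure set (borel 'rV[R]_n) -> \bar R}) : Prop :=
  levy_process P X /\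
  forall (t : R) (theta : 'rV[R]_n), 0 <= t ->
    char_fun P (X t) theta = cexp (t%:C * weak_exponent mu Sigma nu theta).

(* The process G (lift ord0 k) is the (k+1)st gamma subordinator. *)
Definition AG_subordinator P (S : R -> T -> 'rV[R]_n) (a : R)
    (alpha : 'rV[R]_n) : Prop :=
  subordinator P S /\
  exists (d' : measure_display) (T' : measurableType d')
    (P' : probability T' R) (G : 'I_n.+1 -> R -> T' -> R),
    [/\ gamma_subordinator P' (G ord0) a 1,
        forall k, gamma_subordinator P' (G (lift ord0 k))
          ((1 - a * alpha 0 k) / alpha 0 k) (alpha 0 k)^-1,
        independent_systems P' (fun k => sigma_of_process (G k)) &
        same_law_process P S P' (fun t w =>
          G ord0 t w *: alpha + \row_k G (lift ord0 k) t w)].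

End weak_subordination.

Definition WVAG {R : realType} {n : nat} {d : measure_display}
    {T : measurableType d} (P : probability T R) (X : R -> T -> 'rV[R]_n)
    (a : R) (alpha mu : 'rV[R]_n) (Sigma : 'M[R]_n) : Prop :=
  exists (d' : measure_display) (T' : measurableType d')
    (P' : probability T' R) (S : R -> T' -> 'rV[R]_n)
    (nu : {measure set (borel 'rV[R]_n) -> \bar R}),
    [/\ AG_subordinator P' S a alpha, driftless_with_levy_measure P' S nu &
        weakly_subordinated P X mu Sigma nu].

(* Main.v *)
From HB Require Import structures.
Require Import Defs.
From mathcomp Require Import all_boot all_order all_algebra.
From mathcomp Require Import all_classical all_reals all_analysis.
From mathcomp Require Import measurable_realfun.
From mathcomp Require Import complex ring lra.

Set Implicit Arguments.
Unset Strict Implicit.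
Unset Printing Implicit Defensive.

Import Order.TTheory GRing.Theory Num.Theory.
Import numFieldNormedType.Exports.

Local Open Scope classical_set_scope.
Local Open Scope ring_scope.

(** The Levy measure of the subordinator T is forced by its Laplace exponent,
    which the independent gamma marginals compute: it is the sum over
    j = 0, .., n of c_j times the image of e^-r / r dr under r |-> r d_j, with
    d_0 = alpha, c_0 = a and, for k >= 1, d_k = alpha_k e_k and c_k = beta_k
    ([AG_laplace], [levy_measure_rays]). So the exponent of X is a sum of n + 1
    terms, each a fixed function of a nonnegative quadratic form q_j(theta) and a
    linear form l_j(theta) ([weak_exponentE]). The terms j >= 1 depend on a
    single coordinate of theta; the term j = 0 couples all of them.

    Without drift all l_j vanish and X(1) has characteristic function
    prod_j (1 + q_j)^-c_j. Self-decomposability holds as soon as each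
    ((1 + b^2 q_j) / (1 + q_j))^c_j is a characteristic function, and it is that
    of a compound Poisson law: Frullani's integral writes
    ln ((1 + b^2 q) / (1 + q)) as a positive multiple of E e^(- v q) - 1 for a
    random v > 0 with an explicit density, and e^(- v q) is the characteristic
    function of a centred Gaussian vector ([symmetric_char_gamma_ratio]).

    With a drift, suppose that X(1) is self-decomposable. Then
    exp (Psi(theta) - Psi(b theta)) is the characteristic function of Z_b. When b
    tends to 1, the difference of this function and 1, divided by 1 - b, converges
    to the radial derivative of Psi. Restrict it to the plane
    theta = x e_i + y e_j with mu_i <> 0. An operator that multiplies every wave
    e^(i <theta, Z>) by a nonnegative weight f(Z) preserves the inequality
    |E f(Z) e^(i <theta, Z>)| <= E f(Z) between a characteristic function and its
    value at 0. The operator [probe] used here is of this kind, and its second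
    differences, one in x and one in y, annihilate the constant and all the terms
    j >= 1. What is left is an inequality for the term j = 0 alone
    ([self_decomposable_dominated]): the sum of its imaginary part over a square of
    side M, combined over translates by L, is at most the same combination for
    its real part around the origin. But, since Sigma is invertible, the real
    part decays like 1 / |theta|^2, while the imaginary part is of exact order
    1 / |theta| in a cone around the x axis. With L a large multiple of M this
    gives M^4 / L on the left and O (M^2 ln(M)^2 + M^4 / L^2) on the right, which
    is false for large M ([no_dominance]). *)

(** * Functionals determined by a family of test functions *)

Lemma bernoulli_ineq (R : realDomainType) (x : R) k :
  -1 <= x -> 1 + k%:R * x <= (1 + x) ^+ k.
Proof.
move=> x1; elim: k => [|k IH]; first by rewrite mul0r addr0 expr0.
have x2 : 0 <= 1 + x by rewrite -lerBlDl sub0r.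
rewrite exprS; apply: le_trans (ler_wpM2l x2 IH).
have := sqr_ge0 x; have k0 : 0 <= k%:R :> R by [].
rewrite -natr1 => xx; have := mulr_ge0 k0 xx; lra.
Qed.

(** Iterated powers turn a continuous quantity into an indicator: y ^ k is large
    or small compared with 2 ^ - k according to the side of 1/2 on which y lies.
    This gives indicators of superlevel sets as bounded limits of polynomials. *)
Lemma cvg_threshold (R : realType) (y : R) : 0 <= y -> y <= 1 ->
  (1 - (1 - y ^+ k) ^+ (2 ^ k)) ^+ k @[k --> \oo] --> (((2^-1 < y)%R)%:R : R).
Proof.
move=> y0 y1.
have yk0 k : 0 <= y ^+ k by rewrite exprn_ge0.
have yk1 k : y ^+ k <= 1 by rewrite exprn_ile1.
have w0 k : 0 <= (1 - y ^+ k) ^+ (2 ^ k) by rewrite exprn_ge0// subr_ge0.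
have w1 k : (1 - y ^+ k) ^+ (2 ^ k) <= 1 by rewrite exprn_ile1// ?subr_ge0// gerBl.
case: ltP => y2.
(* (1 - y^k) ^ (2^k) <= s ^ (-2k) with s = sqrt (2 y) > 1, which beats the factor
k lost in the outer power. *)
- pose r := 2 * y; have r1 : 1 < r by rewrite /r; lra.
  pose s := Num.sqrt r.
  have s1 : 1 < s by rewrite -sqrtr1 ltr_sqrt// (lt_trans ltr01).
  have ss : s ^+ 2 = r by rewrite sqr_sqrtr// ltW// (lt_trans ltr01).
  have wk k : (1 - y ^+ k) ^+ (2 ^ k) * (s ^+ k) ^+ 2 <= 1.
    rewrite -exprM mulnC exprM ss /r exprMn.
    have h : 1 + (2 ^ k)%:R * y ^+ k <= (1 + y ^+ k) ^+ (2 ^ k).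
      by apply: bernoulli_ineq; rewrite (le_trans _ (yk0 k)).
    have h' : 2 ^+ k * y ^+ k <= (1 + y ^+ k) ^+ (2 ^ k).
      by apply: le_trans h; rewrite natrX; lra.
    apply: le_trans (ler_wpM2l (w0 k) h') _.
    rewrite -exprMn exprn_ile1//.
      by apply: mulr_ge0; rewrite ?subr_ge0// addr_ge0.
    by have := mulr_ge0 (yk0 k) (yk0 k); lra.
  have lb k : 1 - ((s - 1) ^+ 2)^-1 * k.+1%:R^-1 <=
      (1 - (1 - y ^+ k.+1) ^+ (2 ^ k.+1)) ^+ k.+1.
    set w := (1 - y ^+ k.+1) ^+ _.
    have b1 : 1 + k.+1%:R * (- w) <= (1 - w) ^+ k.+1.
      by apply: bernoulli_ineq; rewrite lerN2; exact: w1.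
    apply: le_trans b1; rewrite mulrN lerD2l lerN2.
    have b2 : k.+1%:R * (s - 1) <= s ^+ k.+1.
      have : -1 <= s - 1 by lra.
      move=> /(bernoulli_ineq k.+1); rewrite (addrC 1 (s - 1)) subrK; lra.
    have s0 : 0 < s - 1 by lra.
    have k0 : 0 < k.+1%:R :> R by rewrite ltr0n.
    have b3 : (k.+1%:R * (s - 1)) ^+ 2 <= (s ^+ k.+1) ^+ 2.
      by rewrite ler_sqr ?nnegrE// ?mulr_ge0 ?exprn_ge0 ?ltW//; lra.
    have b4 : w * (k.+1%:R * (s - 1)) ^+ 2 <= 1.
      by apply: le_trans (wk k.+1); apply: ler_wpM2l => //; exact: w0.
    rewrite -invfM -[leRHS]mul1r ler_pdivlMr; last by rewrite mulr_gt0// exprn_gt0.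
    by apply: le_trans b4; rewrite exprMn; lra.
  rewrite -(cvg_shiftn 1) /=.
  apply: (@squeeze_cvgr _ _ _ _ (fun k => 1 - ((s - 1) ^+ 2)^-1 * k.+1%:R^-1) (fun=> 1)).
  + apply: nearW => k; rewrite addn1 lb /=.
    by rewrite exprn_ile1 ?subr_ge0// ?gerBl.
  + rewrite -[X in _ --> X]subr0 -[X in _ --> _ - X](mulr0 ((s - 1) ^+ 2)^-1).
    apply: cvgB; first exact: cvg_cst.
    apply: cvgM; first exact: cvg_cst.
    exact: cvg_harmonic.
  + exact: cvg_cst.
- rewrite -(cvg_shiftn 1) /=.
  apply: (@squeeze_cvgr _ _ _ _ (fun=> 0) (fun k => (3 / 4) ^+ (k + 1))).
  + apply: nearW => k; rewrite addn1.
    set w := (1 - y ^+ k.+1) ^+ _.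
    (* Here y^k <= 2^-k, so that (1 - y^k) ^ (2^k) stays away from 0. *)
    have w4 : 4^-1 <= w.
      have yk : 2^-1 <= (1 - y ^+ k.+1) ^+ (2 ^ k).
        have : -1 <= - y ^+ k.+1 by rewrite lerN2.
        move=> /(bernoulli_ineq (2 ^ k)) h; apply: le_trans h.
        have : y ^+ k.+1 <= 2^-1 ^+ k.+1 by apply: lerXn2r => //; rewrite ?nnegrE // invr_ge0.
        have p0 : 0 < (2 ^ k)%:R :> R by rewrite ltr0n expn_gt0.
        have e2 : (2 ^ k)%:R * 2^-1 ^+ k.+1 = 2^-1 :> R.
          by rewrite natrX exprS mulrCA -exprMn divff// expr1n mulr1.
        by move=> /(ler_wpM2l (ltW p0)); rewrite e2; lra.
      rewrite /w expnSr exprM expr2.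
      by apply: le_trans (ler_pM _ _ yk yk) => //; lra.
    have w1' : w <= 1 by exact: w1.
    rewrite exprn_ge0 ?subr_ge0//=.
    by apply: lerXn2r; rewrite ?nnegrE; lra.
  + exact: cvg_cst.
  + rewrite (cvg_shiftn 1 (fun k => (3 / 4 : R) ^+ k)).
    by apply: cvg_expr; rewrite ger0_norm; lra.
Qed.

Section functionals.
Context {R : realType} {d : measure_display} {T : measurableType d}.
Implicit Types (f g u phi : T -> R) (L : (T -> R) -> R).

Definition bounded_measurable f :=
  measurable_fun setT f /\ exists C, forall x, `|f x| <= C.

(** The three properties of an integral that determine it on bounded
    measurable functions once it is known on enough test functions. *)
Record integral_like L : Prop := {
  integral_likeD : forall f g, bounded_measurable f -> bounded_measurable g ->
    L (fun x => f x + g x) = L f + L g;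
  integral_likeZ : forall c f, bounded_measurable f ->
    L (fun x => c * f x) = c * L f;
  integral_like_lim : forall (f_ : nat -> T -> R) f C,
    (forall n, measurable_fun setT (f_ n)) -> (forall n x, `|f_ n x| <= C) ->
    (forall x, f_ n x @[n --> \oo] --> f x) ->
    L (f_ n) @[n --> \oo] --> L f
}.

Lemma bounded_measurable_cst c : bounded_measurable (fun=> c).
Proof. by split; [exact: measurable_cst|exists `|c|]. Qed.

Lemma bounded_measurableD f g : bounded_measurable f -> bounded_measurable g ->
  bounded_measurable (fun x => f x + g x).
Proof.
move=> [mf [C fC]] [mg [D gD]]; split; first exact: measurable_funD.
by exists (C + D) => x; rewrite (le_trans (ler_normD _ _))// lerD.
Qed.

Lemma bounded_measurableM f g : bounded_measurable f -> bounded_measurable g ->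
  bounded_measurable (fun x => f x * g x).
Proof.
move=> [mf [C fC]] [mg [D gD]]; split; first exact: measurable_funM.
by exists (C * D) => x; rewrite normrM ler_pM.
Qed.

Lemma bounded_measurable_indic (A : set T) : measurable A ->
  bounded_measurable (\1_A : T -> R).
Proof.
move=> mA; split; first exact: measurable_indic.
exists 1 => x; rewrite indicE; case: (_ \in _); by rewrite ?normr1 ?normr0.
Qed.

Lemma bounded_measurable_lim (f_ : nat -> T -> R) f C :
  (forall n, measurable_fun setT (f_ n)) -> (forall n x, `|f_ n x| <= C) ->
  (forall x, f_ n x @[n --> \oo] --> f x) -> bounded_measurable f.
Proof.
move=> mf bf cf; split.
  by apply: (measurable_fun_cvg (h := f_)) => // x _; exact: cf.
exists C => x; have cn : `|f_ n x| @[n --> \oo] --> `|f x|.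
  by apply: cvg_norm; exact: cf.
by apply: (cvgr_to_le cn); apply: nearW => n; exact: bf.
Qed.

Section agreement.
Variables (L1 L2 : (T -> R) -> R).
Hypotheses (iL1 : integral_like L1) (iL2 : integral_like L2).
Variable (B : set (T -> R)).
Hypothesis bB : forall e, B e -> bounded_measurable e.

(** L1 and L2 agree on phi e for every test function e in B. The test
    function is kept as a factor so that the elements of B are multipliers as
    soon as products of elements of B are linear combinations of elements of B. *)
Definition agreeing phi := bounded_measurable phi /\
  forall e, B e -> L1 (fun x => phi x * e x) = L2 (fun x => phi x * e x).

(** Multipliers form an algebra that is closed under bounded limits, so the
    sets whose indicators are multipliers form a sigma-algebra: a functional
    form of the monotone class argument. *)
Definition multiplier u := bounded_measurable u /\
  forall phi, agreeing phi -> agreeing (fun x => phi x * u x).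

Lemma agreeingD f g : agreeing f -> agreeing g ->
  agreeing (fun x => f x + g x).
Proof.
move=> [bf af] [bg ag]; split; first exact: bounded_measurableD.
move=> e Be; have be := bB Be.
under eq_fun do rewrite mulrDl.
by rewrite !integral_likeD//; try exact: bounded_measurableM; rewrite af// ag.
Qed.

Lemma agreeingZ c f : agreeing f -> agreeing (fun x => c * f x).
Proof.
move=> [bf af]; split.
  by apply: bounded_measurableM => //; exact: bounded_measurable_cst.
move=> e Be; have be := bB Be.
under eq_fun do rewrite -mulrA.
by rewrite !integral_likeZ//; try exact: bounded_measurableM; rewrite af.
Qed.

Lemma agreeing_lim (f_ : nat -> T -> R) f C :
  (forall n, agreeing (f_ n)) -> (forall n x, `|f_ n x| <= C) ->
  (forall x, f_ n x @[n --> \oo] --> f x) -> agreeing f.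
Proof.
move=> af bf cf; have mf n : measurable_fun setT (f_ n) by case: (af n) => -[].
split; first exact: (bounded_measurable_lim mf bf cf).
move=> e Be; have [me [D eD]] := bB Be.
have mfe n : measurable_fun setT (fun x => f_ n x * e x).
  exact: measurable_funM.
have bfe n x : `|f_ n x * e x| <= C * D by rewrite normrM ler_pM.
have cfe x : f_ n x * e x @[n --> \oo] --> f x * e x.
  by apply: cvgM; [exact: cf|exact: cvg_cst].
have c1 := integral_like_lim iL1 mfe bfe cfe.
have c2 := integral_like_lim iL2 mfe bfe cfe.
apply: (cvg_unique _ c1) => //.
suff -> : (fun n => L1 (fun x => f_ n x * e x)) =
          (fun n => L2 (fun x => f_ n x * e x)) by [].
by apply/funext => n; case: (af n) => _; apply.
Qed.

Lemma multiplier_cst c : multiplier (fun=> c).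
Proof.
split; first exact: bounded_measurable_cst.
by move=> phi ?; under eq_fun do rewrite mulrC; exact: agreeingZ.
Qed.

Lemma multiplierD u v : multiplier u -> multiplier v ->
  multiplier (fun x => u x + v x).
Proof.
move=> [bu au] [bv av]; split; first exact: bounded_measurableD.
move=> phi aphi; under eq_fun do rewrite mulrDr.
by apply: agreeingD; [exact: au|exact: av].
Qed.

Lemma multiplierM u v : multiplier u -> multiplier v ->
  multiplier (fun x => u x * v x).
Proof.
move=> [bu au] [bv av]; split; first exact: bounded_measurableM.
by move=> phi aphi; under eq_fun do rewrite mulrA; exact/av/au.
Qed.

Lemma multiplierB u v : multiplier u -> multiplier v ->
  multiplier (fun x => u x - v x).
Proof.
move=> mu mv; under eq_fun do rewrite -mulN1r.
by apply: multiplierD => //; apply: multiplierM => //; exact: multiplier_cst.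
Qed.

Lemma multiplierX u k : multiplier u -> multiplier (fun x => u x ^+ k).
Proof.
move=> mu; elim: k => [|k IH]; first exact: multiplier_cst.
by under eq_fun do rewrite exprS; exact: multiplierM.
Qed.

Lemma multiplier_sum (I : Type) (s : seq I) (u_ : I -> T -> R) :
  (forall i, multiplier (u_ i)) -> multiplier (fun x => \sum_(i <- s) u_ i x).
Proof.
move=> mu; elim: s => [|i s IH].
  by under eq_fun do rewrite big_nil; exact: multiplier_cst.
by under eq_fun do rewrite big_cons; exact: multiplierD.
Qed.

Lemma multiplier_lim (u_ : nat -> T -> R) u C :
  (forall n, multiplier (u_ n)) -> (forall n x, `|u_ n x| <= C) ->
  (forall x, u_ n x @[n --> \oo] --> u x) -> multiplier u.
Proof.
move=> mu bu cu; split.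
  by apply: (bounded_measurable_lim _ bu cu) => n; case: (mu n) => -[].
move=> phi aphi; have [[mphi [D phiD]] _] := aphi.
apply: (@agreeing_lim (fun n x => phi x * u_ n x) _ (D * C)).
- by move=> n; case: (mu n) => _; apply.
- by move=> n x; rewrite normrM ler_pM.
- by move=> x; apply: cvgM; [exact: cvg_cst|exact: cu].
Qed.

Definition multiplier_set : set (set T) :=
  [set A | measurable A /\ multiplier (\1_A : T -> R)].

Lemma multiplier_setC A : multiplier_set A -> multiplier_set (~` A).
Proof.
move=> [mA uA]; split; first exact: measurableC.
have -> : \1_(~` A) = (fun x => 1 - \1_A x) :> (T -> R).
  by apply/funext => x; rewrite !indicE in_setC; case: (x \in A); rewrite ?subrr ?subr0.
by apply: multiplierB => //; exact: multiplier_cst.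
Qed.

Lemma multiplier_setI A A' : multiplier_set A -> multiplier_set A' ->
  multiplier_set (A `&` A').
Proof.
move=> [mA uA] [mA' uA']; split; first exact: measurableI.
have -> : \1_(A `&` A') = (fun x => \1_A x * \1_A' x) :> (T -> R).
  by apply/funext => x; rewrite !indicE in_setI; case: (x \in A); rewrite ?mul1r ?mul0r.
exact: multiplierM.
Qed.

Lemma multiplier_set_bigcap (F : (set T)^nat) :
  (forall n, multiplier_set (F n)) -> multiplier_set (\bigcap_n F n).
Proof.
move=> mF; split; first by apply: bigcapT_measurable => n; case: (mF n).
pose G n : set T := \big[setI/setT]_(i < n) F i.
have mG n : multiplier_set (G n).
  rewrite /G; elim: n => [|n IH].
    rewrite big_ord0; split; first exact: measurableT.
    by rewrite indicT; exact: multiplier_cst.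
  by rewrite big_ord_recr /=; exact: multiplier_setI.
apply: (@multiplier_lim (fun n => \1_(G n)) _ 1).
- by move=> n; case: (mG n).
- by move=> n x; rewrite indicE; case: (_ \in _); rewrite ?normr1 ?normr0.
move=> x; rewrite indicE; have [/[!inE] xF|/negP xF] := boolP (x \in _).
  have -> : (fun n => \1_(G n) x) = (fun=> 1 : R).
    apply/funext => n; rewrite indicE mem_set// /G.
    by apply: (big_ind (fun A : set T => A x)) => //= i _; exact: xF.
  exact: cvg_cst.
have [m xFm] : exists m, ~ F m x.
  apply/not_existsP => h; apply: xF; rewrite inE => m _.
  by apply: contrapT; exact: h.
apply: cvg_near_cst; near=> n.
rewrite indicE memNset//= /G => h; apply: xFm.
have nm : (m < n)%N by near: n; exact: nbhs_infty_gt.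
by move: h; rewrite (bigD1 (Ordinal nm))//= => -[].
Unshelve. all: end_near. Qed.

Lemma multiplier_sigma_algebra : sigma_algebra setT multiplier_set.
Proof.
split.
- split; first exact: measurable0.
  by rewrite indic0; exact: multiplier_cst.
- by move=> A mA; rewrite setTD; exact: multiplier_setC.
- move=> F mF; rewrite -(setCK (\bigcup_i F i)); apply: multiplier_setC.
  rewrite setC_bigcup; apply: multiplier_set_bigcap => n.
  exact: multiplier_setC.
Qed.
(** The indicator is a bounded limit of polynomials in u, by [cvg_threshold]. *)
Lemma multiplier_set_gt_half u : multiplier u ->
  (forall x, 0 <= u x <= 1) -> multiplier_set [set x | 2^-1 < u x].
Proof.
move=> mu u01; have [[mfu _] _] := mu; split.
  rewrite -[X in measurable X]setTI.
  by apply: (measurable_fun_ltr (f := fun=> 2^-1)).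
apply: (@multiplier_lim (fun k x => (1 - (1 - u x ^+ k) ^+ (2 ^ k)) ^+ k) _ 1).
- move=> k; apply: multiplierX; apply: multiplierB; first exact: multiplier_cst.
  apply: multiplierX; apply: multiplierB; first exact: multiplier_cst.
  exact: multiplierX.
- move=> k x; have /andP[u0 u1] := u01 x.
  have [p0 p1] : 0 <= u x ^+ k /\ u x ^+ k <= 1.
    by rewrite exprn_ge0// exprn_ile1.
  have [q0 q1] : 0 <= (1 - u x ^+ k) ^+ (2 ^ k) /\ (1 - u x ^+ k) ^+ (2 ^ k) <= 1.
    by rewrite exprn_ge0 ?exprn_ile1 ?subr_ge0// gerBl.
  by rewrite normrX ger0_norm ?subr_ge0// exprn_ile1 ?subr_ge0// gerBl.
- move=> x; have /andP[u0 u1] := u01 x.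
  rewrite indicE (_ : (x \in _) = (2^-1 < u x)); first exact: cvg_threshold.
  by apply/idP/idP; rewrite inE.
Qed.

End agreement.

Import HBNNSimple.

Lemma bounded_nnsfun_cvg f : bounded_measurable f -> (forall x, 0 <= f x) ->
  exists (h : nat -> {nnsfun T >-> R}),
    (forall n x, h n x <= f x) /\ (forall x, h n x @[n --> \oo] --> f x).
Proof.
move=> [mf _] f0; have mf' : measurable_fun setT (EFin \o f) by exact/measurable_EFinP.
exists (nnsfun_approx measurableT mf'); split.
- by move=> n x; rewrite -lee_fin nnsfun_approxE; apply: le_approx => // y _ /=; rewrite lee_fin.
- move=> x; have := @cvg_nnsfun_approx _ _ _ _ measurableT _ mf'.
  move=> /(_ (fun y _ => f0 y) x Logic.I) h.
  exact: (fine_cvg h).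
Qed.
End functionals.

Section determination.
Context {R : realType} {d d' : measure_display}.
Context {T : measurableType d} {V : measurableType d'}.
Variables (L1 L2 : (T -> R) -> R).
Hypotheses (iL1 : integral_like L1) (iL2 : integral_like L2).
Variables (B : set (T -> R)) (Y : T -> V).
Hypothesis bB : forall e, B e -> bounded_measurable e.
Hypothesis mY : measurable_fun setT Y.
Hypothesis Ymul : forall A, measurable A -> multiplier_set L1 L2 B (Y @^-1` A).

Import HBNNSimple.

Let multiplier_comp_ge0 (F : V -> R) : bounded_measurable F ->
  (forall v, 0 <= F v) -> multiplier L1 L2 B (F \o Y).
Proof.
move=> bF F0; have [h [hF cF]] := bounded_nnsfun_cvg bF F0.
have [_ [C FC]] := bF.
apply: (@multiplier_lim _ _ _ _ _ iL1 iL2 B bB (fun n x => h n (Y x)) _ C).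
- move=> n.
  have -> : (fun x => h n (Y x)) = (fun x => \sum_(c <- finmap.enum_fset (fset_set (range (h n))))
      c * \1_(Y @^-1` (h n @^-1` [set c])) x) :> (T -> R).
    apply/funext => x; rewrite {1}(fimfunE (h n)) fsbig_finite//=.
  apply: multiplier_sum => // c; apply: multiplierM => //.
    exact: multiplier_cst.
  by case: (Ymul (measurable_funPTI (h n) (measurable_set1 c))).
- move=> n x; rewrite ger0_norm//; apply: le_trans (FC (Y x)).
  by rewrite ger0_norm.
- by move=> x; exact: cF.
Qed.

(** A bounded measurable F is a limit of simple functions of Y, whose level
    sets have multiplier indicators. *)
Lemma multiplier_comp (F : V -> R) : bounded_measurable F ->
  multiplier L1 L2 B (F \o Y).
Proof.
move=> bF; have [_ [C FC]] := bF.
have -> : F \o Y = (fun x => ((fun v => F v + C) \o Y) x - C).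
  by apply/funext => x /=; rewrite addrK.
apply: multiplierB => //; last exact: multiplier_cst.
apply: multiplier_comp_ge0.
  by apply: bounded_measurableD => //; exact: bounded_measurable_cst.
by move=> v; have := FC v; rewrite ler_norml => /andP[]; lra.
Qed.

Lemma integral_like_determined (F : V -> R) :
  B (fun=> 1) -> agreeing L1 L2 B (fun=> 1) -> bounded_measurable F ->
  L1 (F \o Y) = L2 (F \o Y).
Proof.
move=> B1 a1 bF; have [_ /(_ _ a1)[_ /(_ _ B1)]] := multiplier_comp bF.
rewrite (_ : (fun x => _) = F \o Y)//.
by apply/funext => x; rewrite mul1r mulr1.
Qed.
End determination.

(** Indicators are stable under products, hence serve as test functions. *)
Lemma integral_like_indic {R : realType} {d : measure_display}
    {T : measurableType d} (L1 L2 : (T -> R) -> R) (F : T -> R) :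
  integral_like L1 -> integral_like L2 ->
  (forall A, measurable A -> L1 \1_A = L2 \1_A) ->
  bounded_measurable F -> L1 F = L2 F.
Proof.
move=> iL1 iL2 L12 bF.
pose B : set (T -> R) := [set \1_A | A in measurable].
have B1 : B (fun=> 1) by exists setT => //; rewrite indicT.
have bB e : B e -> bounded_measurable e.
  by move=> [A mA <-]; exact: bounded_measurable_indic.
have indicM A A' : (fun x => \1_A x * \1_A' x) = \1_(A `&` A') :> (T -> R).
  by apply/funext => x; rewrite !indicE in_setI; case: (x \in A); rewrite ?mul1r ?mul0r.
apply: (@integral_like_determined _ _ _ _ _ _ _ iL1 iL2 B id bB) => //.
- move=> A mA; split; first by rewrite preimage_id.
  rewrite preimage_id; split; first exact: bounded_measurable_indic.
  move=> phi [bphi aphi]; split.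
    by apply: bounded_measurableM => //; exact: bounded_measurable_indic.
  move=> _ [A' mA' <-]; under eq_fun do rewrite -mulrA.
  have := aphi \1_(A `&` A'); rewrite -indicM; apply.
  by rewrite indicM; exists (A `&` A') => //; exact: measurableI.
- split; first exact: bounded_measurable_cst.
  by move=> _ [A mA <-]; under eq_fun do rewrite mul1r; exact: L12.
Qed.

Lemma integral_like_Rintegral {R : realType} {d d' : measure_display}
    {T : measurableType d} {V : measurableType d'}
    (m : {measure set T -> \bar R}) (D : set T) (X : T -> V) (g : T -> R) :
  measurable D -> measurable_fun D X -> m.-integrable D (EFin \o g) ->
  integral_like (fun f : V -> R => \int[m]_(w in D) (f (X w) * g w)).
Proof.
move=> mD mX ig.
have [mg _] := integrableP _ _ _ ig; have {}mg : measurable_fun D g by exact/measurable_EFinP.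
have mfX (f : V -> R) : measurable_fun setT f -> measurable_fun D (fun w => f (X w)).
  by move=> mf; exact: (measurableT_comp mf mX).
have int (f : V -> R) : bounded_measurable f ->
    m.-integrable D (EFin \o (fun w => f (X w) * g w)).
  move=> [mf [C fC]]; apply: (@le_integrable _ _ _ _ _ mD _ (fun w => (C * g w)%:E)).
  - by apply/measurable_EFinP; apply: measurable_funM => //; exact: mfX.
  - move=> w Dw /=; rewrite lee_fin !normrM ler_wpM2r//.
    by rewrite (le_trans (fC _))// ler_norm.
  - under eq_fun do rewrite EFinM; exact: integrableZl.
split.
- move=> f h bf bh; under eq_Rintegral do rewrite mulrDl.
  by rewrite RintegralD//; exact: int.
- move=> c f bf; under eq_Rintegral do rewrite -mulrA.
  by rewrite RintegralZl//; exact: int.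
- move=> f_ f C mf bf cf.
  have mf' : measurable_fun setT f.
    by apply: (measurable_fun_cvg (h := f_)) => // x _; exact: cf.
  have bf' : bounded_measurable f by exact: (bounded_measurable_lim mf bf cf).
  rewrite /Rintegral; apply: fine_cvg; rewrite fineK; last first.
    by apply: integrable_fin_num => //; exact: int.
  apply: (@dominated_cvg _ _ _ m D mD (fun n w => (f_ n (X w) * g w)%:E) _
    (fun w => `|(C * g w)%:E|)%E).
  + by move=> n; apply/measurable_EFinP; apply: measurable_funM => //; exact: mfX.
  + by move=> w Dw; apply: cvg_EFin; [exact: nearW|apply: cvgM; [exact: cf|exact: cvg_cst]].
  + by [].
  + apply: integrable_abse; under eq_fun do rewrite EFinM; exact: integrableZl.
  + move=> n w Dw /=; rewrite lee_fin !normrM ler_wpM2r//.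
    by rewrite (le_trans (bf _ _))// ler_norm.
Qed.

(** * Borel sets of row vectors *)

Section borel_vectors.
Context {R : realType} {n : nat}.
Implicit Types (A : set (borel 'rV[R]_n)) (x y theta lambda : 'rV[R]_n).

Lemma dotE x y : dot x y = \sum_k x 0 k * y 0 k.
Proof. by rewrite /dot mxE; apply: eq_bigr => k _; rewrite mxE. Qed.

Lemma dotD theta theta' x : dot (theta + theta') x = dot theta x + dot theta' x.
Proof. by rewrite /dot mulmxDl mxE. Qed.

Lemma dotZl c theta x : dot (c *: theta) x = c * dot theta x.
Proof. by rewrite /dot -scalemxAl mxE. Qed.

Lemma dotZr c theta x : dot theta (c *: x) = c * dot theta x.
Proof. by rewrite /dot linearZ /= -scalemxAr mxE. Qed.

Lemma dotDr theta x y : dot theta (x + y) = dot theta x + dot theta y.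
Proof. by rewrite /dot linearD /= mulmxDr mxE. Qed.

Lemma dot_delta c (k : 'I_n) x : dot (c *: delta_mx 0 k) x = c * x 0 k.
Proof.
rewrite dotE (bigD1 k)//= big1 ?addr0 ?mxE ?eqxx ?mulr1//.
by move=> i ik; rewrite !mxE eqxx (negPf ik)/= mulr0 mul0r.
Qed.

Let box (p : 'rV[rat]_n * 'rV[rat]_n) : set 'rV[R]_n :=
  [set x | forall k, ratr (p.1 0 k) < x 0 k /\ x 0 k < ratr (p.2 0 k)].

(** Every open set is a countable union of boxes with rational corners. The
    union runs over all codes of boxes, those not contained in the open set
    being replaced by the empty set. *)
Lemma borel_sub_sigma_algebra (K : set (set 'rV[R]_n)) :
  sigma_algebra setT K -> (forall k c, K [set x : 'rV[R]_n | c < x 0 k]) ->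
  forall A, measurable A -> K A.
Proof.
move=> [K0 KC KU] Kray.
have KC' A : K A -> K (~` A) by move=> /KC; rewrite setTD.
have KI A A' : K A -> K A' -> K (A `&` A').
  move=> KA KA'; rewrite -(setCK (A `&` A')) setCI -bigcup2E.
  by apply: (KC'); apply: KU => -[|[|i]] /=; [exact: KC'|exact: KC'|exact: K0].
have Kray' k c : K [set x : 'rV[R]_n | x 0 k < c].
  rewrite (_ : [set x | _] = \bigcup_i ~` [set x : 'rV[R]_n | c - i.+1%:R^-1 < x 0 k]).
    by apply: KU => i; apply: KC'; exact: Kray.
  apply/seteqP; split=> [x /= xc|x [i _] /=]; last first.
    by move=> /negP; rewrite -leNgt => h; apply: le_lt_trans h _; rewrite gtrBl.
  have [i ci] : exists i : nat, i.+1%:R^-1 < c - x 0 k.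
    have cx0 : 0 < c - x 0 k by rewrite subr_gt0.
    by exists (Num.truncn (c - x 0 k)^-1); rewrite invf_plt ?posrE//; exact: truncnS_gt.
  by exists i => //=; apply/negP; rewrite -leNgt lerBrDl -lerBrDr ltW.
have Kbox p : K (box p).
  have -> : box p = \big[setI/setT]_(k < n)
     ([set x : 'rV[R]_n | ratr (p.1 0 k) < x 0 k] `&` [set x | x 0 k < ratr (p.2 0 k)]).
    apply/seteqP; split => x; last first.
      by move=> h k; move: h; rewrite (bigD1 k)//= => -[] [].
    move=> xp; apply: (big_ind (fun A : set 'rV[R]_n => A x)) => //.
    by move=> k _; have := xp k.
  apply: (big_ind K) => //; first by rewrite -setC0; exact: KC'.
  by move=> k _; apply: (KI) => //; exact: Kray'.
apply: smallest_sub => // U oU.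
rewrite (_ : U = \bigcup_i (if unpickle i is Some p then
    if `[<box p `<=` U>] then box p else set0 else set0)); last first.
  apply/seteqP; split => [x Ux|x [i _]]; last first.
    by case: unpickle => // p; case: asboolP => // pU /pU.
  have /nbhs_ballP[e e0 xeU] := open_nbhs_nbhs (conj oU Ux).
  have /choice[a ax] (k : 'I_n) : exists q : rat, x 0 k - e < ratr q /\ ratr q < x 0 k.
    have : x 0 k - e < x 0 k by rewrite gtrBl.
    by move=> /rat_in_itvoo[q]; rewrite in_itv/= => /andP[]; exists q.
  have /choice[b bx] (k : 'I_n) : exists q : rat, x 0 k < ratr q /\ ratr q < x 0 k + e.
    have : x 0 k < x 0 k + e by rewrite ltrDl.
    by move=> /rat_in_itvoo[q]; rewrite in_itv/= => /andP[]; exists q.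
  pose p := (\row_k a k, \row_k b k).
  exists (pickle p) => //; rewrite pickleK; case: asboolP => [_ k|[]].
    by rewrite !mxE; case: (ax k) (bx k) => _ ? [].
  move=> y yp; apply: xeU; split => // i k; rewrite (ord1 i).
  have := yp k; rewrite !mxE /ball/= => -[? ?]; have [? ?] := ax k; have [? ?] := bx k.
  by rewrite ltr_norml; apply/andP; split; lra.
apply: KU => i; case: unpickle => // p; case: asboolP => // _; exact: Kbox.
Qed.

Lemma measurable_coord (k : 'I_n) :
  measurable_fun setT (fun x : borel 'rV[R]_n => (x : 'rV[R]_n) 0 k).
Proof.
apply: (measurability _ (RGenOInfty.measurableE R)) => _ [_ [c ->] <-].
rewrite setTI; apply: sub_sigma_algebra.
apply: (@open_comp _ _ (fun x : 'rV[R]_n => x 0 k)); last exact: interval_open.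
by move=> x _; exact: coord_continuous.
Qed.

Context {d : measure_display} {T : measurableType d}.

Lemma measurable_rV (X : T -> 'rV[R]_n) :
  (forall k, measurable_fun setT (fun w => X w 0 k)) ->
  measurable_fun setT (X : T -> borel 'rV[R]_n).
Proof.
move=> mX _ A mA; rewrite setTI.
apply: (borel_sub_sigma_algebra (K := [set A | measurable (X @^-1` A)])) mA => /=.
- split => /=.
  + by rewrite preimage_set0; exact: measurable0.
  + by move=> B mB; rewrite setTD preimage_setC; exact: measurableC.
  + by move=> F mF; rewrite preimage_bigcup; exact: bigcup_measurable.
- move=> k c; rewrite -[X in measurable X]setTI.
  by apply: (measurable_fun_ltr (f := fun=> c)).
Qed.

Lemma measurable_rV_coord (X : T -> 'rV[R]_n) (k : 'I_n) :
  measurable_fun setT (X : T -> borel 'rV[R]_n) ->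
  measurable_fun setT (fun w => X w 0 k).
Proof. by move=> mX; exact: (measurableT_comp (measurable_coord k) mX). Qed.

Lemma measurable_dot (X : T -> 'rV[R]_n) theta :
  measurable_fun setT (X : T -> borel 'rV[R]_n) ->
  measurable_fun setT (fun w => dot theta (X w)).
Proof.
move=> mX; under eq_fun do rewrite dotE.
apply: measurable_sum => k; apply: measurable_funM => //.
exact: measurable_rV_coord.
Qed.
End borel_vectors.

(** * Uniqueness of characteristic functions and of Laplace transforms *)

Section char_fun_uniqueness.
Context {R : realType} {n : nat}.
Notation V := 'rV[R]_n.
Variables (L1 L2 : (borel V -> R) -> R).
Hypotheses (iL1 : integral_like L1) (iL2 : integral_like L2).
Hypothesis L12 : forall (theta : V) (t : R),
  L1 (fun x => cos (dot theta x + t)) = L2 (fun x => cos (dot theta x + t)).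

Lemma bounded_measurable_cos (theta : V) (t : R) :
  bounded_measurable (fun x : borel V => cos (dot theta x + t)).
Proof.
split.
  apply: (measurableT_comp (f := cos)).
    by apply: continuous_measurable_fun; exact: continuous_cos.
  by apply: measurable_funD => //; apply: (@measurable_dot _ _ _ (borel V)).
by exists 1 => x; rewrite ler_norml cos_geN1 cos_le1.
Qed.

Let B : set (borel V -> R) :=
  [set e | exists theta t, e = fun x => cos (dot theta x + t)].

Let bB e : B e -> bounded_measurable e.
Proof. by move=> [theta [t ->]]; exact: bounded_measurable_cos. Qed.

Let B1 : B (fun=> 1).
Proof.
exists 0, 0; apply/funext => x.
by rewrite /dot mul0mx mxE addr0 cos0.
Qed.

Let multiplier_B e : B e -> multiplier L1 L2 B e.
Proof.
move=> Be; split; first exact: bB.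
move=> phi [bphi aphi]; split; first exact: bounded_measurableM (bB _).
move: Be => [theta [t ->]] _ [theta' [t' ->]].
have -> : (fun x : borel V => phi x * cos (dot theta x + t) * cos (dot theta' x + t')) =
   (fun x => 2^-1 * (phi x * cos (dot (theta + theta') x + (t + t'))
      + phi x * cos (dot (theta - theta') x + (t - t')))).
  apply/funext => x; rewrite dotD -scaleN1r dotD dotZl.
  rewrite (_ : dot theta x + dot theta' x + (t + t') =
     (dot theta x + t) + (dot theta' x + t')); last by ring.
  rewrite (_ : dot theta x + -1 * dot theta' x + (t - t') =
     (dot theta x + t) - (dot theta' x + t')); last by ring.
  by rewrite (cosD (dot theta x + t)) cosB; field.
have bb (th : V) s : bounded_measurable (fun x : borel V => phi x * cos (dot th x + s)).
  by apply: bounded_measurableM => //; exact: bounded_measurable_cos.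
have bbD := bounded_measurableD (bb _ _) (bb _ _).
rewrite !integral_likeZ// !integral_likeD//.
by congr (_ * (_ + _)); apply: aphi; do 2 eexists.
Qed.

Let multiplier_ray (k : 'I_n) (c : R) :
  multiplier_set L1 L2 B [set x : V | c < x 0 k].
Proof.
(* (1 + sin z) / 2 exceeds 1/2 exactly when sin z > 0; with z = (x_k - c) / (m + 1)
and m large this means x_k > c. *)
pose u m (x : borel V) : R := 2^-1 + 2^-1 * cos (dot (m.+1%:R^-1 *: delta_mx 0 k) x + (- (m.+1%:R^-1 * c) - pi / 2)).
have uE m (x : borel V) : u m x = 2^-1 + 2^-1 * sin (m.+1%:R^-1 * ((x : V) 0 k - c)).
  rewrite /u dot_delta addrA cosBpihalf (_ : _ * _ - _ = m.+1%:R^-1 * ((x : V) 0 k - c))//.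
  by rewrite mulrBr.
have mu m : multiplier L1 L2 B (u m).
  apply: multiplierD => //; first exact: multiplier_cst.
  apply: multiplierM => //; first exact: multiplier_cst.
  by apply: multiplier_B; do 2 eexists.
have u01 m x : 0 <= u m x <= 1.
  rewrite uE; have := sin_geN1 (m.+1%:R^-1 * ((x : V) 0 k - c)).
  by have := sin_le1 (m.+1%:R^-1 * ((x : V) 0 k - c)); lra.
have mS m := multiplier_set_gt_half iL1 iL2 bB (mu m) (u01 m).
have sigma := multiplier_sigma_algebra iL1 iL2 bB.
have [_ _ KU] := sigma.
have -> : [set x : V | c < x 0 k] =
   \bigcup_N \bigcap_m [set x | 2^-1 < u (N + m)%N x].
  apply/seteqP; split => [x /= cx|x [N _ xN]].
    have x0 : 0 < x 0 k - c by rewrite subr_gt0.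
    have [N xN] : exists N : nat, x 0 k - c < N.+1%:R.
      exists (Num.truncn (x 0 k - c)); exact: truncnS_gt.
    exists N => // m _ /=; rewrite uE ltrDl mulr_gt0// sin_gt0_pi// mulr_gt0//=.
    rewrite -ltr_pdivlMl// invrK; apply: lt_trans xN _.
    have p2 : 2 <= pi :> R by exact: pi_ge2.
    have : N.+1%:R <= (N + m).+1%:R :> R by rewrite ler_nat ltnS leq_addr.
    have : 0 < (N + m).+1%:R :> R by [].
    nra.
  rewrite /= ltNge; apply/negP => xc.
  have x0 : 0 <= c - x 0 k by rewrite subr_ge0.
  pose m := Num.truncn (c - x 0 k).
  have xm : c - x 0 k < m.+1%:R by exact: truncnS_gt.
  have := xN m Logic.I; rewrite /= uE ltrDl pmulr_rgt0// ltNge => /negP; apply.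
  rewrite -oppr_ge0 -sinN -mulrN opprB sin_ge0_pi// ?mulr_ge0//=.
  rewrite -ler_pdivlMl// invrK.
  have p2 : 2 <= pi :> R by exact: pi_ge2.
  have : m.+1%:R <= (N + m).+1%:R :> R by rewrite ler_nat ltnS leq_addl.
  have : 0 < (N + m).+1%:R :> R by [].
  nra.
by apply: KU => N; apply: multiplier_set_bigcap => // m; exact: mS.
Qed.

(** The phase t makes the cosines stable under products, so that no complex
    values are needed: it carries the sine as well as the cosine. *)
Lemma char_fun_determined (F : borel V -> R) :
  bounded_measurable F -> L1 F = L2 F.
Proof.
move=> bF; apply: (@integral_like_determined _ _ _ _ _ _ _ iL1 iL2 B id bB) => //.
- move=> A mA; rewrite preimage_id; move: A mA.
  apply: borel_sub_sigma_algebra; first exact: multiplier_sigma_algebra.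
  exact: multiplier_ray.
- split; first exact: bounded_measurable_cst.
  by move=> _ [theta [t ->]]; under eq_fun do rewrite mul1r; exact: L12.
Qed.
End char_fun_uniqueness.

Section laplace_uniqueness.
Context {R : realType} {n : nat}.
Notation V := 'rV[R]_n.

Definition abs_rV (x : V) : V := \row_k `|x 0 k|.

Lemma measurable_abs_rV :
  measurable_fun setT (abs_rV : borel V -> borel V).
Proof.
apply: measurable_rV => k; under eq_fun do rewrite mxE.
exact: (measurableT_comp (@normr_measurable R setT) (measurable_coord k)).
Qed.

Lemma dot_ge0 (x y : V) : (forall k, 0 <= x 0 k) -> (forall k, 0 <= y 0 k) ->
  0 <= dot x y.
Proof. by move=> x0 y0; rewrite dotE sumr_ge0// => k _; rewrite mulr_ge0. Qed.

Lemma bounded_measurable_laplace (lambda : V) : (forall k, 0 <= lambda 0 k) ->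
  bounded_measurable (fun x : borel V => expR (- dot lambda (abs_rV x))).
Proof.
move=> l0; split.
  apply: measurableT_comp => //; apply: measurable_funN.
  by apply: (@measurable_dot _ _ _ (borel V)); exact: measurable_abs_rV.
exists 1 => x; rewrite ger0_norm ?expR_ge0// -expR0 ler_expR oppr_le0.
by rewrite dot_ge0// => k; rewrite mxE.
Qed.

Variables (L1 L2 : (borel V -> R) -> R).
Hypotheses (iL1 : integral_like L1) (iL2 : integral_like L2).
Hypothesis L12 : forall lambda : V, (forall k, 0 <= lambda 0 k) ->
  L1 (fun x => expR (- dot lambda (abs_rV x))) =
  L2 (fun x => expR (- dot lambda (abs_rV x))).

Let B : set (borel V -> R) :=
  [set e | exists2 lambda : V, (forall k, 0 <= lambda 0 k) &
    e = fun x => expR (- dot lambda (abs_rV x))].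

Let bB e : B e -> bounded_measurable e.
Proof. by move=> [lambda l0 ->]; exact: bounded_measurable_laplace. Qed.

Let B1 : B (fun=> 1).
Proof.
exists 0; first by move=> k; rewrite mxE.
by apply/funext => x; rewrite /dot mul0mx mxE oppr0 expR0.
Qed.

Let multiplier_B e : B e -> multiplier L1 L2 B e.
Proof.
move=> Be; split; first exact: bB.
move=> phi [bphi aphi]; split; first exact: bounded_measurableM (bB _).
move: Be => [l l0 ->] _ [l' l'0 ->].
rewrite (_ : (fun x => _) = fun x => phi x * expR (- dot (l + l') (abs_rV x))).
  by apply: aphi; exists (l + l') => // k; rewrite mxE addr_ge0.
by apply/funext => x; rewrite dotD opprD expRD mulrA.
Qed.

Let multiplier_lt (k : 'I_n) (c : R) : 0 < c ->
  multiplier_set L1 L2 B [set x : V | `|x 0 k| < c].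
Proof.
move=> c0; pose l : V := (ln 2 / c) *: delta_mx 0 k.
have l2 : 0 < ln 2 :> R by rewrite ln_gt0// ltr1n.
have l0 i : 0 <= l 0 i.
  by rewrite !mxE; apply: mulr_ge0 => //; exact/ltW/divr_gt0.
(* The vector l is chosen so that e^(- <l, |x|>) = 1/2 at |x_k| = c. *)
have -> : [set x : V | `|x 0 k| < c] =
    [set x : V | 2^-1 < expR (- dot l (abs_rV x))].
  apply/funext => x /=; congr (is_true _).
  rewrite dot_delta mxE -[2^-1]lnK ?posrE// ltr_expR lnV ?posrE// ltrN2.
  by rewrite -mulrA gtr_pMr// mulrC ltr_pdivrMr// mul1r.
apply: (multiplier_set_gt_half iL1 iL2 bB).
  by apply: multiplier_B; exists l.
move=> x; rewrite expR_ge0 -[leRHS]expR0 ler_expR oppr_le0 dot_ge0// => i.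
by rewrite mxE.
Qed.

Let multiplier_ray (k : 'I_n) (c : R) :
  multiplier_set L1 L2 B [set x : V | c < `|x 0 k|].
Proof.
have [c0|c0] := ltP c 0.
  rewrite (_ : [set x : V | _] = setT).
    split; first exact: measurableT.
    by rewrite indicT; exact: multiplier_cst.
  by apply/seteqP; split => x //= _; exact: lt_le_trans c0 _.
rewrite -(setCK [set x : V | _]); apply: multiplier_setC => //.
rewrite (_ : ~` _ = \bigcap_m [set x : V | `|x 0 k| < c + m.+1%:R^-1]).
  by apply: multiplier_set_bigcap => // m; apply: multiplier_lt; rewrite ltr_wpDl.
apply/seteqP; split => x /=.
  by move=> /negP; rewrite -leNgt => xc m _ /=; rewrite (le_lt_trans xc)// ltrDl.
move=> h; apply/negP; rewrite -leNgt leNgt; apply/negP => xc.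
have xc0 : 0 < `|x 0 k| - c by rewrite subr_gt0.
have := h (Num.truncn (`|x 0 k| - c)^-1) Logic.I; apply/negP; rewrite -leNgt /=.
by rewrite -lerBrDl ltW// invf_plt ?posrE//; exact: truncnS_gt.
Qed.

(** The absolute values make the exponentials bounded on the whole space; on
    the orthant they are harmless. *)
Lemma laplace_determined (F : borel V -> R) :
  bounded_measurable F -> L1 (F \o abs_rV) = L2 (F \o abs_rV).
Proof.
move=> bF; have := @integral_like_determined _ _ _ _ (borel V) _ _ iL1 iL2 B abs_rV bB.
apply => //.
- have [K0 KC KU] := multiplier_sigma_algebra iL1 iL2 bB.
  apply: (borel_sub_sigma_algebra
    (K := [set A | multiplier_set L1 L2 B (abs_rV @^-1` A)])) => /=.
  + split => /=.
    * by rewrite preimage_set0.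
    * by move=> A mA; rewrite setTD preimage_setC; exact: multiplier_setC.
    * by move=> A mA; rewrite preimage_bigcup; exact: KU.
  + move=> k c; rewrite (_ : _ @^-1` _ = [set x : V | c < `|x 0 k|])//.
    by apply/funext => x /=; rewrite mxE.
- split; first exact: bounded_measurable_cst.
  by move=> _ [l l0 ->]; under eq_fun do rewrite mul1r; exact: L12.
Qed.
End laplace_uniqueness.

(** * Frullani and gamma integrals *)

Section real_integrals.
Context {R : realType}.
Notation mu := (@lebesgue_measure R).
Implicit Types (f F : R -> R) (A B a b c r x y : R).

Lemma integral_FTC f F a b : a < b ->
  (forall x, a <= x <= b -> is_derive x 1 F (f x)) ->
  (forall x, a <= x <= b -> {for x, continuous f}) ->
  (\int[mu]_(x in `[a, b]) (f x)%:E = (F b - F a)%:E)%E.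
Proof.
move=> ab dF cf.
have cF x : a <= x <= b -> {for x, continuous F}.
  by move=> xab; have [/derivable1_diffP/differentiable_continuous] := dF x xab.
rewrite EFinB; apply: continuous_FTC2 => //.
- apply: continuous_in_subspaceT => x; rewrite inE/= in_itv/=; exact: cf.
- split.
  + move=> x; rewrite in_itv/= => /andP[ax xb].
    by have [] := dF x; rewrite ?(ltW ax) ?(ltW xb).
  + by apply: cvg_at_right_filter; apply: cF; rewrite lexx ltW.
  + by apply: cvg_at_left_filter; apply: cF; rewrite lexx ltW.
- move=> x; rewrite in_itv/= => /andP[ax xb]; rewrite derive1E.
  by apply: derive_val; apply: dF; rewrite !ltW.
Qed.

Lemma integral_FTCy f F (l : R) :
  (forall x, 0 <= x -> 0 <= f x) ->
  (forall x, is_derive x 1 F (f x)) -> continuous f ->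
  F x @[x --> +oo] --> l ->
  (\int[mu]_(x in `]0%R, +oo[) (f x)%:E = (l - F 0)%:E)%E.
Proof.
move=> f0 dF cf Fl.
have cF x : {for x, continuous F}.
  by have [/derivable1_diffP/differentiable_continuous] := dF x.
rewrite integral_itv_obnd_cbnd; last first.
  by apply/measurable_EFinP; apply: measurable_funTS; exact: continuous_measurable_fun.
rewrite EFinB; apply: ge0_continuous_FTC2y => //.
- by apply: continuous_subspaceT.
- by apply: cvg_at_right_filter; exact: cF.
- by move=> x _; rewrite derive1E; apply: derive_val.
Qed.

Lemma cvgy_expR_neg c : 0 < c -> expR (- (c * x)) @[x --> +oo%R] --> 0.
Proof.
move=> c0; apply: (@cvg_comp _ _ _ (fun x : R => c * x) (fun z => expR (- z)) _ (pinfty_nbhs R)).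
  exact: gt0_cvgMry.
exact: cvgr_expR.
Qed.

Lemma continuous_expR_neg c : continuous (fun x : R => expR (- (c * x))).
Proof.
move=> x; apply: continuous_comp; last exact: continuous_expR.
by apply: continuousN; exact: mulrl_continuous.
Qed.

Lemma integral_expR_neg c : 0 < c ->
  (\int[mu]_(x in `]0%R, +oo[) (expR (- (c * x)))%:E = (c^-1)%:E)%E.
Proof.
move=> c0.
have dF x : is_derive x 1 (fun x => - (c^-1 * expR (- (c * x)))) (expR (- (c * x))).
  by apply: is_derive_eq; rewrite /GRing.scale /=; field; exact: lt0r_neq0.
rewrite (integral_FTCy (l := 0) _ dF).
- by rewrite mulr0 oppr0 expR0 mulr1 sub0r opprK.
- by move=> x _; exact: expR_ge0.
- exact: continuous_expR_neg.
- rewrite -oppr0 -(mulr0 c^-1); apply: cvgN; apply: cvgM; first exact: cvg_cst.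
  exact: cvgy_expR_neg.
Qed.

Lemma frullani_inner A B r : A < B -> r != 0 ->
  (((expR (- (A * r)) - expR (- (B * r))) / r)%:E =
   \int[mu]_(u in `[A, B]) (expR (- (u * r)))%:E)%E.
Proof.
move=> AB r0.
have dF u : A <= u <= B ->
    is_derive u 1 (fun u => - (r^-1 * expR (- (u * r)))) (expR (- (u * r))).
  by move=> _; apply: is_derive_eq; rewrite /GRing.scale /=; field.
rewrite (integral_FTC _ dF)//; first by congr EFin; field.
move=> u _; apply: continuous_comp; last exact: continuous_expR.
by apply: continuousN; exact: mulrr_continuous.
Qed.

Lemma integral_inv A B : 0 < A -> A < B ->
  (\int[mu]_(u in `[A, B]) (u^-1)%:E = (ln B - ln A)%:E)%E.
Proof.
move=> A0 AB; apply: integral_FTC => // x /andP[Ax xB].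
  by apply: is_derive1_ln; exact: lt_le_trans Ax.
by apply: inv_continuous; rewrite gt_eqF//; exact: lt_le_trans Ax.
Qed.

(** The inner integral over u in [A, B] of e^(- u r) is the integrand, and the
    integral over r of e^(- u r) is 1 / u. *)
Lemma frullani A B : 0 < A -> A <= B ->
  (\int[mu]_(r in `]0%R, +oo[) ((expR (- (A * r)) - expR (- (B * r))) / r)%:E =
   (ln (B / A))%:E)%E.
Proof.
move=> A0; rewrite le_eqVlt => /orP[/eqP <-|AB].
  under eq_integral do rewrite subrr mul0r.
  by rewrite integral0 divff ?ln1// gt_eqF.
have B0 := lt_trans A0 AB.
rewrite ln_div ?posrE// -integral_inv//.
pose g (z : R * R) : \bar R :=
  (expR (- (z.2 * z.1)) * (\1_(`]0%R, +oo[%classic : set R) z.1 * \1_(`[A, B]%classic : set R) z.2))%:E.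
transitivity (\int[mu]_r \int[mu]_u g (r, u))%E.
  rewrite integral_mkcond; apply: eq_integral => r _.
  rewrite patchE; case: ifPn => [r0|r0]; last first.
    rewrite integral0_eq// => u _; rewrite /g /= indicE (negPf r0) mul0r mulr0//.
  have {}r0' : r != 0 by move: r0; rewrite inE/= in_itv/= andbT => /gt_eqF ->.
  rewrite frullani_inner// integral_mkcond; apply: eq_integral => u _.
  by rewrite patchE /g /= !indicE r0 mul1r; case: ifPn; rewrite ?mulr1 ?mulr0.
rewrite fubini_tonelli; last 2 first.
- apply/measurable_EFinP; apply: measurable_funM.
    apply: measurableT_comp => //; apply: measurable_funN.
    exact: measurable_funM measurable_snd measurable_fst.
  apply: measurable_funM.
    apply: (measurableT_comp _ measurable_fst); exact: measurable_indic.
  by apply: (measurableT_comp _ measurable_snd); exact: measurable_indic.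
- by move=> z; rewrite lee_fin !mulr_ge0 ?expR_ge0// indicE; case: (_ \in _).
rewrite [RHS]integral_mkcond; apply: eq_integral => u _.
rewrite patchE; case: ifPn => [uAB|uAB]; last first.
  by rewrite integral0_eq// => r _; rewrite /g /= !indicE (negPf uAB) !mulr0.
have u0 : 0 < u by move: uAB; rewrite inE/= in_itv/= => /andP[+ _]; exact: lt_le_trans.
rewrite -integral_expR_neg// [RHS]integral_mkcond; apply: eq_integral => r _.
by rewrite patchE /g /= !indicE uAB mulr1; case: ifPn; rewrite ?mulr1 ?mulr0.
Qed.
Lemma integrable_frullani A B : 0 < A -> A <= B ->
  mu.-integrable `]0%R, +oo[ (EFin \o (fun r => (expR (- (A * r)) - expR (- (B * r))) / r)).
Proof.
move=> A0 AB; apply/integrableP; split.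
  apply/measurable_EFinP; apply: measurable_funM.
    apply: measurable_funTS; apply: measurable_funB;
    by apply: continuous_measurable_fun; exact: continuous_expR_neg.
  apply: open_continuous_measurable_fun; first exact: interval_open.
  move=> r; rewrite inE/= in_itv/= andbT => r0; apply: inv_continuous.
  by rewrite gt_eqF.
suff -> : (\int[mu]_(r in `]0%R, +oo[)
    `|((expR (- (A * r)) - expR (- (B * r))) / r)%:E| =
  \int[mu]_(r in `]0%R, +oo[)
    ((expR (- (A * r)) - expR (- (B * r))) / r)%:E)%E by rewrite frullani// ltry.
apply: eq_integral => r; rewrite inE/= in_itv/= andbT => r0; rewrite ger0_norm//.
apply: divr_ge0; last exact: ltW.
by rewrite subr_ge0 ler_expR lerN2; apply: ler_wpM2r => //; exact: ltW.
Qed.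

End real_integrals.

Definition image_measure {R : realType} {d d' : measure_display}
    {T : measurableType d} {T' : measurableType d'}
    (m : {measure set T -> \bar R}) (f : T -> T')
    (mf : measurable_fun setT f) : {measure set T' -> \bar R} :=
  measure_function_pushforward__canonical__measure_function_Measure m mf.

Section scaling.
Context {R : realType}.
Notation mu := (@lebesgue_measure R).
Implicit Types (k : R) (f : R -> \bar R).

(** The image of Lebesgue measure under x |-> k x, scaled by k, agrees with it on
    half-open intervals. *)
Lemma integral_lebesgue_scale k f : 0 < k -> measurable_fun setT f ->
  (forall x, 0 <= f x)%E ->
  (\int[mu]_(x in `]0%R, +oo[) f (k * x)%R =
   (k^-1)%:E * \int[mu]_(x in `]0%R, +oo[) f x)%E.
Proof.
move=> k0 mf f0.
have mphi : measurable_fun setT (fun x : measurableTypeR R => k * x : measurableTypeR R).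
  exact: mulrl_measurable.
have kN : 0 <= k by exact: ltW.
pose m := mscale (NngNum kN) (image_measure mu mphi).
have muE A : measurable A -> mu A = m A.
  apply: lebesgue_measure_unique => _ [[a b] _ <-].
  change (mu `]a, b]%classic = k%:E * mu ((fun x : R => k * x)%R @^-1` `]a, b]%classic))%E.
  rewrite (_ : _ @^-1` _ = `](a / k), (b / k)]%classic); last first.
    apply/seteqP; split => x /=; rewrite !in_itv/= ltr_pdivrMr// ler_pdivlMr//.
      by rewrite !(mulrC x).
    by rewrite !(mulrC x).
  rewrite !lebesgue_measure_itv/= !lte_fin ltr_pM2r ?invr_gt0//.
  case: ifP => _; last by rewrite mule0.
  by rewrite -!EFinB -EFinM -mulrBl mulrC divfK// gt_eqF.
have mf' : measurable_fun (`]0, +oo[%classic : set R) f by exact: measurable_funTS.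
have -> : (\int[mu]_(x in `]0%R, +oo[) f x = \int[m]_(x in `]0%R, +oo[) f x)%E.
  by apply: eq_measure_integral => A mA _; exact: muE.
rewrite ge0_integral_mscale//= muleA -EFinM mulVf ?gt_eqF// mul1e.
rewrite ge0_integral_pushforward//.
rewrite (_ : (fun x => k * x) @^-1` _ = `]0, +oo[%classic)//.
by apply/seteqP; split => x /=; rewrite !in_itv/= !andbT pmulr_rgt0.
Qed.
End scaling.

Section gamma_laplace.
Context {R : realType} {d : measure_display} {T : measurableType d}.
Notation mu := (@lebesgue_measure R).
Variables (P : probability T R) (Y : T -> R) (s rate : R).
Hypotheses (rY : random_element Y) (rate0 : 0 < rate).
Hypothesis gY : gamma_distributed P Y s rate.

Lemma measurable_borel_real (A : set R) : measurable A ->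
  measurable (A : set (borel R)).
Proof.
move=> mA; have {mA} : <<s @RGenOInfty.G R >> A.
  by have := RGenOInfty.measurableE R; rewrite /measurable/= => <-.
move: A; apply: smallest_sub; first exact: smallest_sigma_algebra.
move=> _ [x ->]; apply: sub_sigma_algebra; exact: interval_open.
Qed.

Lemma random_element_measurable : measurable_fun setT Y.
Proof. by move=> _ A mA; apply: rY => //; exact: measurable_borel_real. Qed.

Let pdf := gamma_pdf s rate.

Let pdf_ge0 x : 0 <= pdf x.
Proof.
rewrite /pdf /gamma_pdf patchE; case: ifP => // _.
rewrite !mulr_ge0 ?powR_ge0 ?expR_ge0// invr_ge0.
by apply: Rintegral_ge0 => y _; rewrite mulr_ge0 ?powR_ge0 ?expR_ge0.
Qed.

Let mexp (c : R) : measurable_fun setT (fun x : R => expR (- (c * x))).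
Proof. by apply: continuous_measurable_fun; exact: continuous_expR_neg. Qed.

Let mpdf : measurable_fun setT pdf.
Proof.
apply/measurable_restrict => //; apply: measurable_funTS.
apply: measurable_funM; last exact: mexp.
by apply: measurable_funM => //; exact: measurable_powR.
Qed.

Let K := rate `^ s / Gamma_fun s.
Let I (c : R) : \bar R :=
  (\int[mu]_(x in `]0%R, +oo[) (x `^ (s - 1) * expR (- (c * x)))%:E)%E.

Let K_ge0 : 0 <= K.
Proof.
rewrite divr_ge0 ?powR_ge0//.
by apply: Rintegral_ge0 => y _; rewrite mulr_ge0 ?powR_ge0 ?expR_ge0.
Qed.

Let mI (c : R) : measurable_fun setT (fun x : R => (x `^ (s - 1) * expR (- (c * x)))%:E).
Proof.
by apply/measurable_EFinP; apply: measurable_funM => //; exact: measurable_powR.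
Qed.

Let I_ge0 c x : (0 <= (x `^ (s - 1) * expR (- (c * x)))%:E)%E.
Proof. by rewrite lee_fin mulr_ge0 ?powR_ge0 ?expR_ge0. Qed.

Let integral_pdf_exp l : (\int[mu]_x (expR (- (l * `|x|)) * pdf x)%:E =
  K%:E * I (rate + l))%E.
Proof.
rewrite -ge0_integralZl//; last first.
  by apply: measurable_funTS; exact: mI.
rewrite [RHS]integral_mkcond; apply: eq_integral => x _.
rewrite /pdf /gamma_pdf !patchE; case: ifPn => [|_]; last by rewrite mulr0.
rewrite inE/= in_itv/= andbT => x0; rewrite gtr0_norm// -EFinM; congr EFin.
by rewrite mulrDl opprD expRD /K; ring.
Qed.

(** The normalisation of the density is read off from its being a law,
    which spares the evaluation of the gamma function. *)
Let integral_pdf1 : (K%:E * I rate = 1)%E.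
Proof.
rewrite -[rate in I rate]addr0 -integral_pdf_exp.
rewrite -[RHS](probability_setT P) -[setT in RHS](preimage_setT Y).
rewrite gY; last exact: measurableT.
by apply: eq_integral => x _; rewrite mul0r oppr0 expR0 mul1r.
Qed.

Let I_scale c : 0 < c -> (I c = ((rate / c) `^ s)%:E * I rate)%E.
Proof.
move=> c0; have k0 : 0 < rate / c by rewrite divr_gt0.
have := integral_lebesgue_scale k0 (mI c) (I_ge0 c).
move=> /(congr1 (fun z => (rate / c)%:E * z)%E).
rewrite muleA -EFinM divff ?gt_eqF// mul1e => h.
rewrite {1}/I -{}h /I.
have mI1 : measurable_fun (`]0, +oo[%classic : set R)
    (fun x : R => ((rate / c * x) `^ (s - 1) * expR (- (c * (rate / c * x))))%:E).
  by apply: measurable_funTS; apply: (measurableT_comp (mI c)); exact: mulrl_measurable.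
have mI2 : measurable_fun (`]0, +oo[%classic : set R)
    (fun x : R => (x `^ (s - 1) * expR (- (rate * x)))%:E).
  by apply: measurable_funTS; exact: mI.
rewrite -!ge0_integralZl//; try by rewrite lee_fin ?powR_ge0 ?ltW.
apply: eq_integral => x; rewrite inE/= in_itv/= andbT => x0.
rewrite -!EFinM; congr EFin.
rewrite powRM ?(ltW k0) ?(ltW x0)// (_ : c * (rate / c * x) = rate * x); last first.
  by field; rewrite gt_eqF.
rewrite !mulrA; congr (_ * _ * _).
rewrite -{1}[rate / c]powRr1 ?(ltW k0)// -powRD; last by rewrite (gt_eqF k0) implybT.
by congr (_ `^ _); ring.
Qed.

Lemma gamma_ge0 : {ae P, forall w, 0 <= Y w}.
Proof.
exists (Y @^-1` `]-oo, 0[%classic); split.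
- rewrite -[X in measurable X]setTI; apply: random_element_measurable => //.
- rewrite gY; last by apply: measurable_borel_real; exact: measurable_itv.
  rewrite integral0_eq// => x; rewrite /= in_itv/= => x0.
  rewrite /gamma_pdf patchE memNset//= in_itv/= andbT => /(lt_trans x0).
  by rewrite ltxx.
- by move=> w /=; rewrite in_itv/= ltNge => /negP.
Qed.

(** The absolute value is inserted because the law is carried by the
    positive half-line only almost surely. *)
Lemma gamma_laplace l : 0 <= l ->
  \int[P]_w expR (- (l * `|Y w|)) = expR (- (s * ln (1 + l / rate))).
Proof.
move=> l0.
pose L1 (f : R -> R) := \int[P]_(w in setT) (f (Y w) * 1).
pose L2 (f : R -> R) := \int[mu]_(x in setT) (f (idfun x) * pdf x).
have intpdf : mu.-integrable setT (EFin \o pdf).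
  apply/integrableP; split; first exact/measurable_EFinP.
  under eq_integral do rewrite /= ger0_norm//.
  have := gY measurableT; rewrite preimage_setT probability_setT => <-.
  by rewrite ltry.
have iL1 : integral_like L1.
  apply: integral_like_Rintegral => //; first exact: random_element_measurable.
  exact: finite_measure_integrable_cst.
have iL2 : integral_like L2.
  have mid : @measurable_fun _ _ (measurableTypeR R) R setT idfun by exact: measurable_id.
  exact: (@integral_like_Rintegral R _ _ _ R mu setT idfun pdf measurableT mid intpdf).
have bexp : bounded_measurable (fun x : R => expR (- (l * `|x|))).
  split.
    apply: measurableT_comp => //; apply: measurable_funN; apply: measurable_funM => //.
  exists 1 => x; rewrite ger0_norm ?expR_ge0// -[leRHS]expR0 ler_expR oppr_le0.
  by rewrite mulr_ge0.
have : L1 (fun x => expR (- (l * `|x|))) = L2 (fun x => expR (- (l * `|x|))).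
  apply: integral_like_indic => // A mA; rewrite /L1 /L2 /Rintegral.
  congr fine.
  transitivity (P (Y @^-1` A)).
    rewrite -(setIT (Y @^-1` A)) -integral_indic//; last first.
      by rewrite -[X in measurable X]setTI; exact: random_element_measurable.
    by apply: eq_integral => w _; rewrite mulr1 !indicE.
  rewrite gY; last exact: measurable_borel_real.
  rewrite [LHS]integral_mkcond; apply: eq_integral => x _.
  by rewrite patchE /= indicE; case: ifPn; rewrite ?mul1r ?mul0r.
rewrite /L1; under [in LHS]eq_Rintegral do rewrite mulr1.
move=> ->; rewrite /L2 /Rintegral integral_pdf_exp I_scale ?ltr_wpDr//.
rewrite muleCA integral_pdf1 mule1 /=.
rewrite /powR gt_eqF ?divr_gt0 ?ltr_wpDr//; congr expR.
have rl0 : 0 < rate + l by rewrite ltr_wpDr.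
have -> : 1 + l / rate = (rate / (rate + l))^-1.
  by field; rewrite !gt_eqF.
by rewrite lnV ?posrE ?divr_gt0// mulrN opprK.
Qed.
End gamma_laplace.

(** * Expectations of products of independent variables *)

Section functional_operations.
Context {R : realType} {d : measure_display} {T : measurableType d}.
Implicit Types (L : (T -> R) -> R).

Lemma integral_likeMr L c : integral_like L -> integral_like (fun f => L f * c).
Proof.
move=> iL; split.
- by move=> f g bf bg; rewrite (integral_likeD iL)// mulrDl.
- by move=> a f bf; rewrite (integral_likeZ iL)// mulrA.
- by move=> f_ f C mf bf cf; apply: cvgM; [exact: integral_like_lim cf|exact: cvg_cst].
Qed.

Lemma integral_like_sum (I : Type) (s : seq I) (L_ : I -> (T -> R) -> R) :
  (forall i, integral_like (L_ i)) ->
  integral_like (fun f => \sum_(i <- s) L_ i f).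
Proof.
move=> iL; split.
- by move=> f g bf bg; rewrite -big_split; apply: eq_bigr => i _; rewrite (integral_likeD (iL i)).
- by move=> a f bf; rewrite big_distrr; apply: eq_bigr => i _; rewrite (integral_likeZ (iL i)).
- move=> f_ f C mf bf cf; elim: s => [|i s IH].
    by under eq_fun do rewrite big_nil; rewrite big_nil; exact: cvg_cst.
  under eq_fun do rewrite big_cons; rewrite big_cons; apply: cvgD => //.
  exact: integral_like_lim cf.
Qed.
End functional_operations.

Lemma bounded_measurable_integrable {R : realType} {d : measure_display}
    {T : measurableType d} (m : {finite_measure set T -> \bar R}) (f : T -> R) :
  bounded_measurable f -> m.-integrable setT (EFin \o f).
Proof.
move=> [mf [C fC]].
apply: (@le_integrable _ _ _ m setT measurableT _ (EFin \o cst C)).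
- exact/measurable_EFinP.
- by move=> x _; rewrite lee_fin (le_trans (fC x))// ler_norm.
- exact: finite_measure_integrable_cst.
Qed.

Section independence.
Context {R : realType} {d : measure_display} {T : measurableType d}.
Variables (P : probability T R) (I : finType) (X : I -> T -> R).
Hypothesis mX : forall i, measurable_fun setT (X i).
Hypothesis indX : forall A : I -> set R, (forall i, measurable (A i)) ->
  P (\bigcap_i (X i @^-1` A i)) = (\prod_i P (X i @^-1` A i))%E.

Let mXA i (A : set R) : measurable A -> measurable (X i @^-1` A).
Proof. by move=> mA; rewrite -[X in measurable X]setTI; exact: mX. Qed.

Lemma Rintegral_indic (A : set T) : measurable A ->
  \int[P]_w \1_A w = fine (P A).
Proof. by move=> mA; rewrite /Rintegral integral_indic// setIT. Qed.

Lemma bounded_measurable_prod (J : Type) (s : seq J) (p : pred J) (f : J -> T -> R) :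
  (forall i, bounded_measurable (f i)) ->
  bounded_measurable (fun w => \prod_(i <- s | p i) f i w).
Proof.
move=> bf; elim: s => [|i s IH].
  by under eq_fun do rewrite big_nil; exact: bounded_measurable_cst.
under eq_fun do rewrite big_cons; case: (p i) => //.
exact: bounded_measurableM.
Qed.

Lemma bounded_measurable_comp d' (U : measurableType d') (Y : T -> U)
  (f : U -> R) : measurable_fun setT Y -> bounded_measurable f ->
  bounded_measurable (fun w => f (Y w)).
Proof.
by move=> mY [mf [C fC]]; split; [exact: (measurableT_comp mf mY)|exists C].
Qed.

(** Indicators are replaced by general functions one index at a time: J is
    the set of the indices that may carry a general function. *)
Lemma expectation_prod (f : I -> R -> R) : (forall i, bounded_measurable (f i)) ->
  \int[P]_w (\prod_i f i (X i w)) = \prod_i \int[P]_w f i (X i w).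
Proof.
have bfX (g : R -> R) i : bounded_measurable g -> bounded_measurable (fun w => g (X i w)).
  by move=> bg; exact: bounded_measurable_comp.
suff main (m : nat) : forall (J : {set I}) (f : I -> R -> R), (#|J| <= m)%N ->
    (forall i, bounded_measurable (f i)) ->
    (forall i, i \notin J -> exists2 A, measurable A & f i = \1_A) ->
    \int[P]_w (\prod_i f i (X i w)) = \prod_i \int[P]_w f i (X i w).
  by move=> bf; have := main _ [set: I]%SET f (max_card _) bf; apply => i; rewrite inE.
elim: m => [|m IH] J {}f Jm bf fJ.
  have /choice[A fA] i : exists A, measurable A /\ f i = \1_A.
    have [|A mA ->] := fJ i; last by exists A.
    by move: Jm; rewrite leqn0 cards_eq0 => /eqP ->; rewrite inE.
  transitivity (\int[P]_w \1_(\bigcap_i (X i @^-1` A i)) w).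
    apply: eq_Rintegral => w _.
    rewrite indicE; have [/[!inE] wA|/negP wA] := boolP (w \in _).
      apply: big1 => i _; have [_ ->] := fA i; rewrite indicE mem_set//.
      exact: wA.
    have [i wAi] : exists i, ~ A i (X i w).
      apply/not_existsP => h; apply: wA; rewrite inE => i _.
      by apply: contrapT; exact: h.
    rewrite (bigD1 i)//=; have [_ ->] := fA i.
    by rewrite indicE memNset// mul0r.
  rewrite Rintegral_indic; last first.
    by apply: fin_bigcap_measurable => // i _; apply: mXA; case: (fA i).
  rewrite indX; last by move=> i; case: (fA i).
  have -> : (\prod_i P (X i @^-1` A i) = (\prod_i fine (P (X i @^-1` A i)))%:E)%E.
    rewrite -prodEFin; apply: eq_bigr => i _; rewrite fineK// fin_num_measure//.
    by apply: mXA; case: (fA i).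
  rewrite /=; apply: eq_bigr => i _; rewrite -Rintegral_indic; last first.
    by apply: mXA; case: (fA i).
  by apply: eq_Rintegral => w _; case: (fA i) => _ ->; rewrite !indicE.
have [J0|[k kJ]] := set_0Vmem J.
  by apply: (IH J) => //; rewrite J0 cards0.
have Jk : (#|J :\ k| <= m)%N by move: Jm; rewrite (cardsD1 k) kJ.
pose h w := \prod_(i | i != k) f i (X i w).
pose C := \prod_(i | i != k) \int[P]_w f i (X i w).
have bh : bounded_measurable h.
  by apply: bounded_measurable_prod => i; exact: bfX.
pose L1 (g : R -> R) := \int[P]_(w in setT) (g (X k w) * h w).
pose L2 (g : R -> R) := \int[P]_(w in setT) (g (X k w) * 1) * C.
have iL1 : integral_like L1.
  by apply: integral_like_Rintegral => //; exact: bounded_measurable_integrable.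
have iL2 : integral_like L2.
  apply: integral_likeMr; apply: integral_like_Rintegral => //.
  exact: finite_measure_integrable_cst.
have E : L1 (f k) = L2 (f k).
  apply: integral_like_indic => // A mA.
  pose g i := if i == k then \1_A : R -> R else f i.
  have gk : g k = \1_A by rewrite /g eqxx.
  have gi i : i != k -> g i = f i by rewrite /g => /negPf ->.
  have bg i : bounded_measurable (g i).
    by rewrite /g; case: eqP => _ //; exact: bounded_measurable_indic.
  have -> : L1 \1_A = \int[P]_w (\prod_i g i (X i w)).
    apply: eq_Rintegral => w _; rewrite (bigD1 k)//= gk; congr (_ * _).
    by apply: eq_bigr => i ik; rewrite gi.
  have -> : L2 \1_A = \prod_i \int[P]_w g i (X i w).
    rewrite (bigD1 k)//= gk; congr (_ * _).
      by apply: eq_Rintegral => w _; rewrite mulr1.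
    by apply: eq_bigr => i ik; rewrite gi.
  apply: (IH (J :\ k) g Jk bg) => i; rewrite in_setD1 negb_and negbK => /orP[/eqP ->|iJ].
    by exists A.
  by rewrite gi; [exact: fJ|apply: contraNneq iJ => ->].
transitivity (L1 (f k)).
  by apply: eq_Rintegral => w _; rewrite (bigD1 k).
rewrite E (bigD1 k)//=; congr (_ * _).
by apply: eq_Rintegral => w _; rewrite mulr1.
Qed.
End independence.

(** * The Laplace transform of the alpha-gamma subordinator *)

Section alpha_gamma_laplace.
Context {R : realType} {n : nat}.
Implicit Types (alpha lambda : 'rV[R]_n).

(** Index 0 is the common gamma subordinator, index k + 1 the private one of
    coordinate k. *)
Definition ray_direction alpha (j : 'I_n.+1) : 'rV[R]_n :=
  if unlift ord0 j is Some k then alpha 0 k *: delta_mx 0 k else alpha.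

Definition ray_weight (a : R) alpha (j : 'I_n.+1) : R :=
  if unlift ord0 j is Some k then (1 - a * alpha 0 k) / alpha 0 k else a.

Lemma ray_direction_ge0 alpha j k : (forall i, 0 < alpha 0 i) ->
  0 <= ray_direction alpha j 0 k.
Proof.
move=> alpha0; rewrite /ray_direction; case: unlift => [i|]; last exact: ltW.
by rewrite !mxE; apply: mulr_ge0 => //; exact: ltW.
Qed.

Lemma ray_weight_ge0 a alpha j : 0 < a -> (forall i, 0 < alpha 0 i) ->
  (forall i, a * alpha 0 i < 1) -> 0 <= ray_weight a alpha j.
Proof.
move=> a0 alpha0 a1; rewrite /ray_weight; case: unlift => [i|]; last exact: ltW.
by apply: divr_ge0; [rewrite subr_ge0|]; exact: ltW.
Qed.

Context {d : measure_display} {T : measurableType d}.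
Variables (P : probability T R) (S : R -> T -> 'rV[R]_n) (a : R) (alpha : 'rV[R]_n).
Hypothesis (alpha_gt0 : forall k, 0 < alpha 0 k).
Hypothesis SAG : AG_subordinator P S a alpha.

Lemma same_law_expectation {d1 d2 : measure_display} {T1 : measurableType d1}
    {T2 : measurableType d2} {P1 : probability T1 R} {P2 : probability T2 R}
    {V : normedModType R} {Y1 : T1 -> V} {Y2 : T2 -> V} (F : borel V -> R) :
  random_element Y1 -> random_element Y2 -> same_law P1 Y1 P2 Y2 ->
  bounded_measurable F ->
  \int[P1]_w F (Y1 w) = \int[P2]_w F (Y2 w).
Proof.
move=> m1 m2 law bF.
pose L1 (f : borel V -> R) := \int[P1]_(w in setT) (f (Y1 w) * 1).
pose L2 (f : borel V -> R) := \int[P2]_(w in setT) (f (Y2 w) * 1).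
have iL1 : integral_like L1.
  by apply: integral_like_Rintegral => //; exact: finite_measure_integrable_cst.
have iL2 : integral_like L2.
  by apply: integral_like_Rintegral => //; exact: finite_measure_integrable_cst.
have : L1 F = L2 F.
  apply: integral_like_indic => // A mA; rewrite /L1 /L2.
  transitivity (fine (P1 (Y1 @^-1` A))).
    rewrite -Rintegral_indic; last by rewrite -[X in measurable X]setTI; exact: m1.
    by apply: eq_Rintegral => w _; rewrite mulr1 !indicE.
  rewrite law// -Rintegral_indic; last by rewrite -[X in measurable X]setTI; exact: m2.
  by apply: eq_Rintegral => w _; rewrite mulr1 !indicE.
rewrite /L1 /L2; under eq_Rintegral do rewrite mulr1.
by move=> ->; apply: eq_Rintegral => w _; rewrite mulr1.
Qed.

Lemma ae_eq_Rintegral {d1 : measure_display} {T1 : measurableType d1}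
    (m : {measure set T1 -> \bar R}) (f g : T1 -> R) :
  measurable_fun setT f -> measurable_fun setT g ->
  {ae m, forall w, f w = g w} -> \int[m]_w f w = \int[m]_w g w.
Proof.
move=> mf mg fg; rewrite /Rintegral; congr fine; apply: ae_eq_integral => //.
- exact/measurable_EFinP.
- exact/measurable_EFinP.
- by apply: filterS fg => w fg _; rewrite fg.
Qed.

(** The gamma variables enter the exponent linearly, so that independence
    factors the expectation into gamma Laplace transforms. *)
Lemma AG_laplace lambda : (forall k, 0 <= lambda 0 k) ->
  \int[P]_w expR (- dot lambda (S 1 w)) =
  expR (- \sum_j ray_weight a alpha j * ln (1 + dot lambda (ray_direction alpha j))).
Proof.
move=> l0; have [[levS monoS] [d' [T' [P' [G [gG0 gG indG lawS]]]]]] := SAG.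
pose F (s : borel 'rV[R]_n) := expR (- dot lambda (abs_rV s)).
have bF : bounded_measurable F by exact: bounded_measurable_laplace.
pose Y w : 'rV[R]_n := G ord0 1 w *: alpha + \row_k G (lift ord0 k) 1 w.
pose shape j := if unlift ord0 j is Some k then (1 - a * alpha 0 k) / alpha 0 k else a.
pose rate (j : 'I_n.+1) := if unlift ord0 j is Some k then (alpha 0 k)^-1 else 1.
pose coef (j : 'I_n.+1) := if unlift ord0 j is Some k then lambda 0 k else dot lambda alpha.
have gGj j : gamma_subordinator P' (G j) (shape j) (rate j).
  by rewrite /shape /rate; case: unliftP => [k ->|->].
have rate0 j : 0 < rate j.
  by rewrite /rate; case: unlift => [k|] //; rewrite invr_gt0.
have coef0 j : 0 <= coef j.
  rewrite /coef; case: unlift => [k|] //; apply: dot_ge0 => // k; exact: ltW.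
have rG j : random_element (G j 1) by case: (gGj j) => -[+ _ _ _ _ _] _ _; apply.
have mG j : measurable_fun setT (G j 1) by exact: random_element_measurable.
have dG j : gamma_distributed P' (G j 1) (shape j) (rate j).
  by case: (gGj j) => _ _ /(_ 1 ltr01); rewrite mulr1.
have rS : random_element (S 1) by case: levS => + _ _ _ _ _; apply.
have rY : random_element Y.
  apply: measurable_rV => k; rewrite /Y; under eq_fun do rewrite !mxE.
  by apply: measurable_funD => //; exact: measurable_funM.
have law1 : same_law P (S 1) P' Y.
  move=> A mA; have := lawS 1%N (fun=> 1) (fun=> A) (fun=> ler01) (fun=> mA).
  rewrite (_ : [set w | _] = S 1 @^-1` A); last first.
    by apply/seteqP; split => w /=; [apply; exact: ord0|].
  rewrite (_ : [set w | _] = Y @^-1` A)//.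
  by apply/seteqP; split => w /=; [apply; exact: ord0|].
transitivity (\int[P]_w F (S 1 w)).
  apply: ae_eq_Rintegral.
  - apply: measurableT_comp => //; apply: measurable_funN; exact: measurable_dot.
  - by case: bF => mF _; exact: (measurableT_comp mF rS).
  - case: levS => _ S0 _ _ _ _.
    apply: filterS2 S0 monoS => w S0 Sw; rewrite /F; congr (expR (- dot _ _)).
    apply/rowP => k; rewrite mxE ger0_norm//.
    by have := Sw 0 1 (lexx _) ler01 k; rewrite S0 mxE.
rewrite (same_law_expectation rS rY law1 bF).
pose f j (x : R) := expR (- (coef j * `|x|)).
have bf j : bounded_measurable (f j).
  split.
    apply: measurableT_comp => //; apply: measurable_funN; exact: measurable_funM.
  exists 1 => x; rewrite ger0_norm ?expR_ge0// -[leRHS]expR0 ler_expR oppr_le0.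
  by rewrite mulr_ge0.
transitivity (\int[P']_w \prod_j f j (G j 1 w)).
  apply: ae_eq_Rintegral.
  - by case: bF => mF _; exact: (measurableT_comp mF rY).
  - have bfG j : bounded_measurable (fun w => f j (G j 1 w)) by exact: bounded_measurable_comp.
    by have [] := bounded_measurable_prod (index_enum 'I_n.+1) xpredT bfG.
  - have : {ae P', forall w, forall j, 0 <= G j 1 w}.
      apply: (filter_forall (f := fun j w => 0 <= G j 1 w)) => j.
      exact: (gamma_ge0 (rG j) (dG j)).
    apply: filterS => w G0; rewrite /f -expR_sum; congr expR.
    rewrite big_ord_recl /= sumrN -opprD; congr (- _).
    rewrite {1}/coef unlift_none ger0_norm// !dotE mulrC big_distrr -big_split /=.
    apply: eq_bigr => k _; rewrite /coef liftK !mxE.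
    have GG : 0 <= G ord0 1 w * alpha 0 k + G (lift ord0 k) 1 w.
      by apply: addr_ge0 => //; apply: mulr_ge0 => //; exact: ltW.
    by rewrite (ger0_norm GG) (ger0_norm (G0 _)) mulrDr; congr (_ + _); ring.
rewrite expectation_prod//; last first.
  move=> A mA; have sA i : sigma_of_process (G i) (G i 1 @^-1` A i).
    apply: sub_gen_smallest; exists 1 => //=.
    by exists (A i); [exact: measurable_borel_real|rewrite setTI].
  have := indG [set: _]%SET (fun i => G i 1 @^-1` A i) (fun i _ => sA i).
  rewrite (_ : [set` [set: _]%SET] = setT); last by apply/seteqP; split => i //=; rewrite inE.
  by under [in RHS]eq_bigl do rewrite inE.
rewrite -sumrN expR_sum; apply: eq_bigr => j _.
rewrite /f (gamma_laplace (rG j) (rate0 j) (dG j) (coef0 j)); congr (expR (- (_ * ln (1 + _)))).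
rewrite /coef /rate /ray_direction; case: unlift => [k|]; last by rewrite divr1.
rewrite invrK dotZr dotE (bigD1 k)//= big1 ?addr0.
  by rewrite !mxE !eqxx mulr1 mulrC.
by move=> i ik; rewrite !mxE eqxx (negPf ik)/= mulr0.
Qed.
End alpha_gamma_laplace.

(** * The Levy measure is carried by rays *)

Section levy_measure.
Context {R : realType} {n : nat}.
Notation V := 'rV[R]_n.
Notation mu := (@lebesgue_measure R).

(** Both min (1, y) and 1 - e^-y are comparable to y / (1 + y). *)
Lemma expR_weight_bound (x y K : R) : 0 <= y -> 0 <= K -> x <= 2 -> x <= K * y ->
  x <= 2 * (2 + K) * (1 - expR (- y)).
Proof.
move=> y0 K0 x1 xK.
have h : y / (1 + y) <= 1 - expR (- y).
  have -> : y / (1 + y) = 1 - (1 + y)^-1 by field; rewrite gt_eqF// ltr_wpDr.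
  rewrite lerB// expRN lef_pV2 ?posrE ?expR_gt0 ?ltr_wpDr//.
  exact: expR_ge1Dx.
have y10 : 0 < 1 + y by rewrite ltr_wpDr.
have K2 : 0 <= 2 * (2 + K) by lra.
apply: le_trans (ler_wpM2l K2 h).
rewrite mulrA ler_pdivlMr//.
have [y1|y1] := leP 1 y; nra.
Qed.

Definition sum_norm (s : V) : R := \sum_k `|s 0 k|.

Lemma sum_normE s : sum_norm s = dot (const_mx 1) (abs_rV s).
Proof. by rewrite dotE; apply: eq_bigr => k _; rewrite !mxE mul1r. Qed.

Lemma sum_norm_ge0 s : 0 <= sum_norm s.
Proof. exact: sumr_ge0. Qed.

Lemma sum_norm_gt0 s : s != 0 -> 0 < sum_norm s.
Proof.
move=> s0; have [k sk] : exists k, s 0 k != 0.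
  by apply/existsP; apply: contraNT s0 => /existsPn h; apply/eqP/rowP => k; rewrite mxE; apply/eqP; rewrite -[_ == _]negbK h.
rewrite /sum_norm (bigD1 k)//= ltr_pwDl ?normr_gt0//; exact: sumr_ge0.
Qed.

Lemma ler_dot_sum_norm (x s : V) : `|dot x s| <= sum_norm x * sum_norm s.
Proof.
rewrite dotE (le_trans (ler_norm_sum _ _ _))// /sum_norm big_distrl /=.
apply: ler_sum => k _; rewrite normrM ler_wpM2l//.
by rewrite (bigD1 k)//= lerDl; exact: sumr_ge0.
Qed.

(** Multiplying a Levy measure by this weight makes it finite, while the
    Laplace transform of the product is a difference of two Laplace exponents:
    e^(- <lambda, s>) (1 - e^(- |s|)) = (1 - e^(- <lambda + 1, s>)) - (1 - e^(- <lambda, s>)). *)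
Definition levy_weight (s : V) : R := 1 - expR (- sum_norm s).

Lemma levy_weight_ge0 s : 0 <= levy_weight s.
Proof. by rewrite subr_ge0 -expR0 ler_expR oppr_le0 sum_norm_ge0. Qed.

Lemma levy_weight_gt0 s : s != 0 -> 0 < levy_weight s.
Proof. by move=> s0; rewrite subr_gt0 -expR0 ltr_expR oppr_lt0 sum_norm_gt0. Qed.

Lemma measurable_sum_norm : measurable_fun setT (sum_norm : borel V -> R).
Proof.
apply: measurable_sum => k.
exact: (measurableT_comp (@normr_measurable R setT) (measurable_coord k)).
Qed.

Lemma measurable_levy_weight : measurable_fun setT (levy_weight : borel V -> R).
Proof.
apply: measurable_funB => //; apply: measurableT_comp => //.
by apply: measurable_funN; exact: measurable_sum_norm.
Qed.

Lemma measurable_orthant : measurable (@orthant R n).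
Proof.
rewrite (_ : orthant = (\bigcap_(k in [set: 'I_n])
    [set s : borel V | 0 <= (s : V) 0 k]) `&` [set s : borel V | 0 < sum_norm s]).
  apply: measurableI.
    apply: fin_bigcap_measurable => // k _; rewrite -[X in measurable X]setTI.
    apply: (measurable_fun_ler (f := fun=> 0)) => //; exact: measurable_coord.
  rewrite -[X in measurable X]setTI.
  apply: (measurable_fun_ltr (f := fun=> 0)) => //; exact: measurable_sum_norm.
apply/seteqP; split => s /=.
  by move=> [s0 /sum_norm_gt0 ?]; split => // k _; exact: s0.
move=> [s0 sn]; split; first by move=> k; exact: s0.
apply: contraTneq sn => ->; rewrite /sum_norm big1 ?ltxx// => k _.
by rewrite mxE normr0.
Qed.

Lemma measurable_sup_norm : measurable_fun setT (fun s : borel V => `|s : V|).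
Proof.
apply: (measurability _ (RGenOInfty.measurableE R)) => _ [_ [c ->] <-].
rewrite setTI; apply: sub_sigma_algebra.
apply: (@open_comp _ _ (fun x : V => `|x|)); last exact: interval_open.
by move=> x _; exact: norm_continuous.
Qed.

Lemma sum_norm_sup (s : V) : sum_norm s <= n%:R * `|s|.
Proof.
have -> : n%:R * `|s| = \sum_(k < n) `|s| by rewrite sumr_const card_ord mulr_natl.
apply: ler_sum => k _.
rewrite [leRHS]/Num.norm/= mx_normrE.
exact: (le_bigmax _ (fun ij => `|s ij.1 ij.2|) (0, k)).
Qed.

Context {d : measure_display} {T : measurableType d}.
Variables (P : probability T R) (S : R -> T -> V).
Variables (nu : {measure set (borel V) -> \bar R}) (a : R) (alpha : V).
Hypotheses (n_gt0 : (0 < n)%N) (alpha_gt0 : forall k, 0 < alpha 0 k).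
Hypothesis SAG : AG_subordinator P S a alpha.
Hypothesis Snu : driftless_with_levy_measure P S nu.

Let D : set (borel V) := orthant.
Let mD : measurable D. Proof. exact: measurable_orthant. Qed.
Let Dge0 s k : D s -> 0 <= (s : V) 0 k. Proof. by case=> /(_ k). Qed.
Let Dabs s : D s -> abs_rV s = s.
Proof. by move=> Ds; apply/rowP => k; rewrite mxE ger0_norm ?Dge0. Qed.

Lemma integrable_levy_weight : nu.-integrable D (EFin \o levy_weight).
Proof.
have [_ int1 _] := Snu.
have mm : measurable_fun setT (fun s : borel V => (Num.min 1 `|s : V|)%:E).
  apply/measurable_EFinP; apply: measurable_minr => //; exact: measurable_sup_norm.
apply: (@le_integrable _ _ _ nu D mD _ (fun s : borel V => (2 * (2 + n%:R) * Num.min 1 `|s : V|)%:E)).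
- by apply/measurable_EFinP; apply: measurable_funTS; exact: measurable_levy_weight.
- move=> s _; rewrite lee_fin (ger0_norm (levy_weight_ge0 _)).
  apply: le_trans (ler_norm _).
  have n0 : 0 <= n%:R :> R by [].
  have w1 : levy_weight s <= 1 by rewrite gerBl expR_ge0.
  have w2 : levy_weight s <= n%:R * `|s : V|.
    apply: le_trans (sum_norm_sup s); rewrite lerBlDr addrC -lerBlDr -[- _ in leLHS]opprK.
    by have := expR_ge1Dx (- sum_norm s); rewrite /levy_weight; lra.
  rewrite /Num.min; case: ifPn => [_|]; first by nra.
  by rewrite -leNgt => s1; have : 0 <= `|s : V| by []; nra.
- under eq_fun do rewrite EFinM; apply: integrableZl => //.
  apply/integrableP; split; first exact: measurable_funTS.
  rewrite (eq_integral (fun s : borel V => (Num.min 1 `|s : V|)%:E))// => s _.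
  by rewrite gee0_abs// lee_fin le_min ler01 normr_ge0.
Qed.

Lemma integrable_levy (f : borel V -> R) C : measurable_fun setT f ->
  (forall s, D s -> `|f s| <= C * levy_weight s) ->
  nu.-integrable D (EFin \o f).
Proof.
move=> mf fC.
apply: (@le_integrable _ _ _ nu D mD _ (fun s => (C * levy_weight s)%:E)).
- by apply/measurable_EFinP; exact: measurable_funTS.
- by move=> s Ds; rewrite lee_fin (le_trans (fC s Ds))// ler_norm.
- by under eq_fun do rewrite EFinM; apply: integrableZl => //; exact: integrable_levy_weight.
Qed.

Let Phi (lambda : V) := \int[nu]_(s in D) (1 - expR (- dot lambda s)).

Let measurable_exp_dot (lambda : V) :
  measurable_fun setT (fun s : borel V => 1 - expR (- dot lambda s)).
Proof.
apply: measurable_funB => //; apply: measurableT_comp => //.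
by apply: measurable_funN; apply: (@measurable_dot _ _ _ (borel V)).
Qed.

Let integrable_exp_dot (lambda : V) : (forall k, 0 <= lambda 0 k) ->
  nu.-integrable D (EFin \o (fun s => 1 - expR (- dot lambda s))).
Proof.
move=> l0; apply: (@integrable_levy _ (2 * (2 + sum_norm lambda))) => // s Ds.
have ds : 0 <= dot lambda s by apply: dot_ge0 => // k; exact: Dge0.
rewrite ger0_norm; last by rewrite subr_ge0 -expR0 ler_expR oppr_le0.
apply: expR_weight_bound; rewrite ?sum_norm_ge0//.
  by have := expR_ge0 (- dot lambda s); lra.
have := expR_ge1Dx (- dot lambda s).
by have := ler_dot_sum_norm lambda s; rewrite ger0_norm//; lra.
Qed.

Let PhiE (lambda : V) : (forall k, 0 <= lambda 0 k) -> Phi lambda =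
  \sum_j ray_weight a alpha j * ln (1 + dot lambda (ray_direction alpha j)).
Proof.
move=> l0; have [_ _ /(_ _ 1 l0 ler01)] := Snu.
rewrite (AG_laplace alpha_gt0 SAG l0) mul1r => /expR_inj/oppr_inj E.
exact: (esym E).
Qed.

Lemma ray_direction_neq0 j : ray_direction alpha j != 0.
Proof.
have [k dk] : exists k, 0 < ray_direction alpha j 0 k.
  rewrite /ray_direction; case: unlift => [k|]; last by exists (Ordinal n_gt0).
  by exists k; rewrite !mxE !eqxx mulr1.
by apply: contraTneq dk => ->; rewrite mxE ltxx.
Qed.

Lemma orthant_ray r j : 0 < r -> D (r *: ray_direction alpha j).
Proof.
move=> r0; split; last by rewrite scaler_eq0 (gt_eqF r0)/= ray_direction_neq0.
by move=> k; rewrite mxE; apply: mulr_ge0; [exact: ltW|exact: ray_direction_ge0].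
Qed.

Let L1 (f : borel V -> R) := \int[nu]_(s in D) (f s * levy_weight s).

Let L2 (f : borel V -> R) := \sum_j \int[mu]_(r in `]0%R, +oo[)
  (f (r *: ray_direction alpha j) * (levy_weight (r *: ray_direction alpha j) *
     (expR (- r) / r))) * ray_weight a alpha j.

Let sum_norm_ray r j : 0 < r ->
  sum_norm (r *: ray_direction alpha j) = r * dot (const_mx 1) (ray_direction alpha j).
Proof.
move=> r0; rewrite sum_normE Dabs; last exact: orthant_ray.
by rewrite dotZr.
Qed.

Let one_ge0 k : 0 <= (const_mx 1 : V) 0 k. Proof. by rewrite mxE. Qed.

Let dot_ray_ge0 (lambda : V) j : (forall k, 0 <= lambda 0 k) ->
  0 <= dot lambda (ray_direction alpha j).
Proof. by move=> l0; apply: dot_ge0 => // k; exact: ray_direction_ge0. Qed.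

Let integrable_ray_weight j : mu.-integrable `]0%R, +oo[
  (EFin \o (fun r => levy_weight (r *: ray_direction alpha j) * (expR (- r) / r))).
Proof.
have B1 : 1 <= 1 + dot (const_mx 1) (ray_direction alpha j).
  by rewrite lerDl dot_ray_ge0.
apply: eq_integrable (integrable_frullani ltr01 B1) => //.
move=> r; rewrite inE/= in_itv/= andbT => r0 /=; congr EFin.
rewrite /levy_weight sum_norm_ray//; set B := dot _ _.
have -> : expR (- ((1 + B) * r)) = expR (- r) * expR (- (r * B)).
  by rewrite -expRD; congr expR; ring.
by rewrite mul1r; ring.
Qed.

Let measurable_ray j : measurable_fun (`]0, +oo[%classic : set (measurableTypeR R))
  (fun r => r *: ray_direction alpha j : borel V).
Proof.
apply: measurable_funTS; apply: (@measurable_rV _ _ _ (measurableTypeR R)) => k.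
by under eq_fun do rewrite mxE; apply: measurable_funM.
Qed.

Let iL1 : integral_like L1.
Proof.
apply: (@integral_like_Rintegral _ _ _ (borel V) (borel V) nu D id) => //.
exact: integrable_levy_weight.
Qed.

Let iL2 : integral_like L2.
Proof.
apply: integral_like_sum => j; apply: integral_likeMr.
exact: integral_like_Rintegral.
Qed.

Let L12 (lambda : V) : (forall k, 0 <= lambda 0 k) ->
  L1 (fun x => expR (- dot lambda (abs_rV x))) =
  L2 (fun x => expR (- dot lambda (abs_rV x))).
Proof.
move=> l0; have l10 k : 0 <= (lambda + const_mx 1) 0 k by rewrite !mxE addr_ge0.
transitivity (Phi (lambda + const_mx 1) - Phi lambda).
  rewrite /Phi -RintegralB//; try exact: integrable_exp_dot.
  apply: eq_Rintegral => s; rewrite inE => Ds.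
  rewrite /levy_weight sum_normE Dabs// dotD opprD expRD; ring.
rewrite !PhiE// -sumrB; apply: eq_bigr => j _; rewrite -mulrBr mulrC; congr (_ * _).
rewrite dotD.
set A := dot lambda _; set B := dot _ _.
have A0 : 0 <= A by exact: dot_ray_ge0.
have B0 : 0 <= B by exact: dot_ray_ge0.
transitivity (\int[mu]_(r in `]0%R, +oo[) ((expR (- ((1 + A) * r)) - expR (- ((1 + (A + B)) * r))) / r)).
  rewrite /Rintegral frullani ?lerD2l ?lerDl ?ltr_wpDr//= ln_div// posrE ltr_wpDr//.
  exact: addr_ge0.
apply: eq_Rintegral => r; rewrite inE/= in_itv/= andbT => r0.
rewrite Dabs; last exact: orthant_ray.
rewrite dotZr -/A /levy_weight sum_norm_ray// -/B.
have -> : expR (- ((1 + A) * r)) = expR (- r) * expR (- (r * A)).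
  by rewrite -expRD; congr expR; ring.
have -> : expR (- ((1 + (A + B)) * r)) = expR (- r) * expR (- (r * A)) * expR (- (r * B)).
  by rewrite -!expRD; congr expR; ring.
ring.
Qed.

(** After multiplication by the weight both sides are finite measures with
    the same Laplace transform, by Frullani's integral. *)
Lemma levy_measure_rays (f : borel V -> R) C : measurable_fun setT f ->
  (forall s, D s -> `|f s| <= C * levy_weight s) ->
  \int[nu]_(s in D) f s = \sum_j ray_weight a alpha j *
    \int[mu]_(r in `]0%R, +oo[) (f (r *: ray_direction alpha j) * (expR (- r) / r)).
Proof.
move=> mf fC.
(* The power - 1 is the inverse, in a form for which measurability is known. *)
pose F (s : borel V) := f s * (levy_weight s) `^ (- 1) * \1_D s.
have FE s : D s -> F (abs_rV s) * levy_weight s = f s.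
  move=> Ds; rewrite Dabs// /F indicE mem_set// mulr1 powR_inv1 ?levy_weight_ge0// mulfVK// gt_eqF//.
  by apply: levy_weight_gt0; case: Ds.
have bF : bounded_measurable F.
  split.
    apply: measurable_funM; last exact: measurable_indic.
    apply: measurable_funM => //; exact: (measurableT_comp (measurable_powR (- 1)) measurable_levy_weight).
  exists `|C| => s; rewrite /F indicE; case: (boolP (s \in D)) => [/[!inE] Ds|_]; last by rewrite mulr0 normr0.
  have w0 : 0 < levy_weight s by apply: levy_weight_gt0; case: Ds.
  rewrite mulr1 powR_inv1 ?levy_weight_ge0// normrM normfV (gtr0_norm w0) ler_pdivrMr//.
  apply: le_trans (fC s Ds) _; apply: ler_wpM2r; [exact: ltW|exact: ler_norm].
have := laplace_determined iL1 iL2 L12 bF; rewrite /L1 /L2 => E.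
transitivity (\int[nu]_(s in D) ((F \o abs_rV) s * levy_weight s)).
  by apply: eq_Rintegral => s; rewrite inE => Ds; rewrite /= FE.
rewrite E; apply: eq_bigr => j _; rewrite mulrC; congr (_ * _).
apply: eq_Rintegral => r; rewrite inE/= in_itv/= andbT => r0.
by rewrite mulrA FE//; exact: orthant_ray.
Qed.

End levy_measure.

(** * Covariance forms *)

Section nonnegative_forms.
Context {R : realType} {n : nat}.
Implicit Types (x y t theta : 'rV[R]_n) (M C Sigma : 'M[R]_n).

Definition bilinear_mx M x y : R := (x *m M *m y^T) 0 0.

Lemma bilinear_mxE M x y : bilinear_mx M x y = \sum_k \sum_l x 0 k * M k l * y 0 l.
Proof.
rewrite /bilinear_mx mxE exchange_big /=; apply: eq_bigr => l _.
by rewrite !mxE big_distrl.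
Qed.

Lemma sqnorm_mxE M x : sqnorm_mx M x = \sum_k \sum_l x 0 k * M k l * x 0 l.
Proof. exact: bilinear_mxE. Qed.

Lemma sqnorm_mx_scale M c x : sqnorm_mx M (c *: x) = c ^+ 2 * sqnorm_mx M x.
Proof.
rewrite !sqnorm_mxE big_distrr; apply: eq_bigr => k _ /=.
rewrite big_distrr; apply: eq_bigr => l _ /=; rewrite !mxE; ring.
Qed.

Lemma sqnorm_mxD M c x y : M^T = M ->
  sqnorm_mx M (x + c *: y) =
  sqnorm_mx M x + 2 * c * bilinear_mx M x y + c ^+ 2 * sqnorm_mx M y.
Proof.
move=> sM.
have -> : sqnorm_mx M (x + c *: y) = sqnorm_mx M x + c * bilinear_mx M x y
    + c * bilinear_mx M y x + c ^+ 2 * sqnorm_mx M y.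
  rewrite !sqnorm_mxE !bilinear_mxE !big_distrr -!big_split; apply: eq_bigr => k _ /=.
  rewrite !big_distrr -!big_split; apply: eq_bigr => l _ /=; rewrite !mxE; ring.
have -> : bilinear_mx M y x = bilinear_mx M x y.
  rewrite !bilinear_mxE exchange_big; apply: eq_bigr => k _; apply: eq_bigr => l _.
  by rewrite -{1}sM mxE; ring.
ring.
Qed.

Lemma bilinear_delta M k y : bilinear_mx M (delta_mx 0 k) y = \sum_l M k l * y 0 l.
Proof.
rewrite bilinear_mxE (bigD1 k)//= [X in _ + X]big1 ?addr0.
  by apply: eq_bigr => l _; rewrite mxE !eqxx mul1r.
by move=> i ik; apply: big1 => l _; rewrite mxE eqxx (negPf ik) !mul0r.
Qed.

Lemma bilinear_delta2 M k l : bilinear_mx M (delta_mx 0 k) (delta_mx 0 l) = M k l.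
Proof.
rewrite bilinear_delta (bigD1 l)//= big1 ?addr0; first by rewrite mxE !eqxx mulr1.
by move=> i il; rewrite mxE eqxx (negPf il) mulr0.
Qed.

Lemma covariance_CauchySchwarz C x y : covariance_matrix C ->
  bilinear_mx C x y ^+ 2 <= sqnorm_mx C x * sqnorm_mx C y.
Proof.
move=> [sC C0].
have h c : 0 <= sqnorm_mx C x + 2 * c * bilinear_mx C x y + c ^+ 2 * sqnorm_mx C y.
  by rewrite -sqnorm_mxD.
have := C0 x; have := C0 y; move: h.
set p := sqnorm_mx C x; set q := sqnorm_mx C y; set b := bilinear_mx C x y => h q0 p0.
have [q00|qn0] := eqVneq q 0.
  have [->|b0] := eqVneq b 0; first by rewrite expr0n mulr_ge0.
  have := h (- (p + 1) / (2 * b)); rewrite q00 mulr0 addr0.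
  have -> : p + 2 * (- (p + 1) / (2 * b)) * b = - 1 by field.
  by rewrite ler0N1.
have := h (- b / q).
have -> : p + 2 * (- b / q) * b + (- b / q) ^+ 2 * q = (p * q - b ^+ 2) / q by field.
by rewrite pmulr_lge0 ?subr_ge0// invr_gt0 lt_neqAle eq_sym qn0.
Qed.

(** Elimination of one row and column at a time: subtracting the square of
    the normalised row k leaves a form that is still nonnegative, by
    Cauchy-Schwarz, and does not involve coordinate k. J is the set of the
    coordinates that are left. *)
Lemma covariance_sum_squares C : covariance_matrix C ->
  exists vs : seq 'rV[R]_n,
    forall theta, sqnorm_mx C theta = \sum_(v <- vs) dot v theta ^+ 2.
Proof.
suff main m : forall (J : {set 'I_n}) C, (#|J| <= m)%N -> covariance_matrix C ->
    (forall k, k \notin J -> forall l, C k l = 0) ->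
    exists vs : seq 'rV[R]_n,
      forall theta, sqnorm_mx C theta = \sum_(v <- vs) dot v theta ^+ 2.
  move=> covC; apply: (main _ [set: 'I_n]%SET C (max_card _) covC) => k.
  by rewrite inE.
elim: m => [|m IH] J {}C Jm covC CJ.
  exists [::] => theta; rewrite big_nil sqnorm_mxE big1// => k _; apply: big1 => l _.
  rewrite CJ ?mulr0 ?mul0r//.
  by move: Jm; rewrite leqn0 cards_eq0 => /eqP ->; rewrite inE.
have [J0|[k kJ]] := set_0Vmem J.
  by apply: (IH J) => //; rewrite J0 cards0.
have Jk : (#|J :\ k| <= m)%N by move: Jm; rewrite (cardsD1 k) kJ.
have [sC C0] := covC.
have symC i j : C i j = C j i by rewrite -{1}sC mxE.
have Ckk0 : 0 <= C k k by have := C0 (delta_mx 0 k); rewrite -[sqnorm_mx _ _]/(bilinear_mx _ _ _) bilinear_delta2.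
have [Ckk|Ckk] := eqVneq (C k k) 0.
  apply: (IH (J :\ k)) => // i; rewrite in_setD1 negb_and negbK => /orP[/eqP ->|/CJ]// l.
  have := covariance_CauchySchwarz (delta_mx 0 k) (delta_mx 0 l) covC.
  rewrite -![sqnorm_mx _ _]/(bilinear_mx _ _ _) !bilinear_delta2 Ckk mul0r => h.
  by apply/eqP; rewrite -sqrf_eq0 eq_le h sqr_ge0.
have Ckk1 : 0 < C k k by rewrite lt_neqAle eq_sym Ckk.
pose v : 'rV[R]_n := (Num.sqrt (C k k))^-1 *: row k C.
have vE theta : dot v theta ^+ 2 = bilinear_mx C (delta_mx 0 k) theta ^+ 2 / C k k.
  rewrite dotZl exprMn exprVn sqr_sqrtr// mulrC; congr (_ ^+ 2 / _).
  by rewrite dotE bilinear_delta; apply: eq_bigr => l _; rewrite mxE.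
pose C' := C - v^T *m v.
have C'E i j : C' i j = C i j - C k i * C k j / C k k.
  rewrite !mxE big_ord1 !mxE; congr (_ - _).
  rewrite mulrACA -invfM -expr2 sqr_sqrtr//; ring.
have sq' theta : sqnorm_mx C' theta = sqnorm_mx C theta - dot v theta ^+ 2.
  rewrite /C' /sqnorm_mx mulmxBr mulmxBl mxE; congr (_ + _); rewrite mxE; congr (- _).
  rewrite mulmxA -mulmxA mxE big_ord1 expr2; congr (_ * _).
  by rewrite -/(dot theta v) !dotE; apply: eq_bigr => i _; exact: mulrC.
have cov' : covariance_matrix C'.
  split; last first.
    move=> theta; rewrite sq' vE subr_ge0 ler_pdivrMr//.
    have := covariance_CauchySchwarz (delta_mx 0 k) theta covC.
    by rewrite -[sqnorm_mx _ (delta_mx _ _)]/(bilinear_mx _ _ _) bilinear_delta2 mulrC.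
  by apply/matrixP => i j; rewrite mxE !C'E symC; ring.
have [|vs vsE] := IH (J :\ k) C' Jk cov'.
  move=> i; rewrite in_setD1 negb_and negbK => /orP[/eqP ->|iJ] l; rewrite C'E.
    by field.
  by rewrite (symC k i) !(CJ i iJ) !mul0r subrr.
exists (v :: vs) => theta; rewrite big_cons -vsE sq'; ring.
Qed.

Lemma diamond_vec_scale r t mu : diamond_vec (r *: t) mu = r *: diamond_vec t mu :> 'rV[R]_n.
Proof. by apply/rowP => k; rewrite !mxE mulrA. Qed.

Lemma sqnorm_diamond_scale r t Sigma theta : 0 <= r ->
  sqnorm_mx (diamond_mx (r *: t) Sigma) theta = r * sqnorm_mx (diamond_mx t Sigma) theta.
Proof.
move=> r0; rewrite !sqnorm_mxE big_distrr; apply: eq_bigr => k _ /=.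
rewrite big_distrr; apply: eq_bigr => l _ /=; rewrite !mxE.
have -> : Num.min (r * t 0 k) (r * t 0 l) = r * Num.min (t 0 k) (t 0 l).
  by rewrite minr_pMr.
ring.
Qed.

(** With c the least positive entry of t and J its set of positive entries,
    min (t_k, t_l) = c 1_J(k) 1_J(l) + min (t'_k, t'_l) where t' = t - c 1_J has
    fewer positive entries. This is the layer-cake form of Schur's product theorem
    for the kernel min. *)
Lemma diamond_mx_ge0 t Sigma theta : covariance_matrix Sigma ->
  (forall k, 0 <= t 0 k) -> 0 <= sqnorm_mx (diamond_mx t Sigma) theta.
Proof.
move=> [_ S0].
have zero (s : 'rV[R]_n) : (forall k, 0 <= s 0 k) ->
    [set k | 0 < s 0 k]%SET = finset.set0 ->
    0 <= sqnorm_mx (diamond_mx s Sigma) theta.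
  move=> s0 h; rewrite sqnorm_mxE big1// => k _; apply: big1 => l _; rewrite mxE.
  have sk : s 0 k = 0.
    apply/eqP; rewrite eq_le s0 andbT leNgt; apply/negP => sk.
    by move/setP/(_ k): h; rewrite !inE sk.
  by rewrite sk (min_idPl (s0 _)) mul0r mulr0 mul0r.
move: {2}#|_| (leqnn #|[set k | 0 < t 0 k]%SET|) => m.
elim: m t => [|m IH] t tm t0.
  by apply: zero => //; apply/eqP; rewrite -cards_eq0 -leqn0.
have [h|[k0 tk0]] := set_0Vmem [set k | 0 < t 0 k]%SET; first exact: zero.
move: tk0; rewrite inE => tk0.
have [k1 tk1 k1min] := @Order.TotalTheory.arg_minP _ _ _ k0 (fun k => 0 < t 0 k) (fun k => t 0 k) tk0.
pose c := t 0 k1; pose J k : R := (0 < t 0 k)%R%:R.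
pose t' : 'rV[R]_n := \row_k (t 0 k - c * J k).
have t'0 k : 0 <= t' 0 k.
  rewrite mxE /J; case: (ltP 0 (t 0 k)) => [/k1min|_]; first by rewrite mulr1 subr_ge0.
  by rewrite mulr0 subr0.
have IHt : 0 <= sqnorm_mx (diamond_mx t' Sigma) theta.
  apply: IH => //; rewrite -ltnS; apply: leq_trans tm; apply: proper_card.
  apply/properP; split.
    apply/fintype.subsetP => k; rewrite !inE mxE /J; case: (ltP 0 (t 0 k)) => // tk.
    by rewrite mulr0 subr0 => /lt_le_trans/(_ tk); rewrite ltxx.
  exists k1; rewrite !inE// mxE /J tk1 mulr1 subrr ltxx//.
pose theta' : 'rV[R]_n := \row_k (J k * theta 0 k).
have -> : sqnorm_mx (diamond_mx t Sigma) theta =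
    c * sqnorm_mx Sigma theta' + sqnorm_mx (diamond_mx t' Sigma) theta.
  rewrite !sqnorm_mxE big_distrr -big_split; apply: eq_bigr => k _ /=.
  rewrite big_distrr -big_split; apply: eq_bigr => l _ /=; rewrite !mxE.
  suff -> : Num.min (t 0 k) (t 0 l) =
    c * (J k * J l) + Num.min (t 0 k - c * J k) (t 0 l - c * J l) by ring.
  rewrite /J; case: (ltP 0 (t 0 k)) => tk; case: (ltP 0 (t 0 l)) => tl; rewrite ?mulr1 ?mulr0 ?subr0 ?add0r.
  - by rewrite -addr_minl; ring.
  - have -> : t 0 l = 0 by apply/eqP; rewrite eq_le tl t0.
    by rewrite !(min_idPr _)// subr_ge0 k1min.
  - have -> : t 0 k = 0 by apply/eqP; rewrite eq_le tk t0.
    by rewrite !(min_idPl _)// subr_ge0 k1min.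
  - by [].
by rewrite addr_ge0// mulr_ge0// ltW.
Qed.

(** The form of t minus c times the form of Sigma is the form of the
    nonnegative vector t - c. *)
Lemma diamond_mx_lower_bound t Sigma theta c : covariance_matrix Sigma -> 0 <= c ->
  (forall k, c <= t 0 k) ->
  c * sqnorm_mx Sigma theta <= sqnorm_mx (diamond_mx t Sigma) theta.
Proof.
move=> covS c0 ct; pose t' : 'rV[R]_n := \row_k (t 0 k - c).
have t'0 k : 0 <= t' 0 k by rewrite mxE subr_ge0.
rewrite -subr_ge0; have := diamond_mx_ge0 theta covS t'0; congr (0 <= _).
rewrite !sqnorm_mxE big_distrr -sumrB; apply: eq_bigr => k _ /=.
rewrite big_distrr -sumrB; apply: eq_bigr => l _ /=; rewrite !mxE -addr_minl; ring.
Qed.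

Lemma covariance_diamond t Sigma : covariance_matrix Sigma ->
  (forall k, 0 <= t 0 k) -> covariance_matrix (diamond_mx t Sigma).
Proof.
move=> covS t0; split; last by move=> theta; exact: diamond_mx_ge0.
apply/matrixP => k l; rewrite !mxE minC; congr (_ * _).
by have [sS _] := covS; rewrite -{1}sS mxE.
Qed.

Lemma ler_sqnorm_diamond t Sigma theta : (forall k, 0 <= t 0 k) ->
  `|sqnorm_mx (diamond_mx t Sigma) theta| <=
  (\sum_k \sum_l `|theta 0 k * Sigma k l * theta 0 l|) * sum_norm t.
Proof.
move=> t0; rewrite sqnorm_mxE (le_trans (ler_norm_sum _ _ _))// big_distrl /=.
apply: ler_sum => k _; rewrite (le_trans (ler_norm_sum _ _ _))// big_distrl /=.
apply: ler_sum => l _; rewrite !mxE.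
have -> : theta 0 k * (Num.min (t 0 k) (t 0 l) * Sigma k l) * theta 0 l =
  theta 0 k * Sigma k l * theta 0 l * Num.min (t 0 k) (t 0 l) by ring.
rewrite normrM ler_wpM2l// ger0_norm ?le_min ?t0// ge_min.
by apply/orP; left; rewrite /sum_norm (bigD1 k)//= ger0_norm// lerDl sumr_ge0.
Qed.

End nonnegative_forms.

(** * The exponent as a sum over rays *)

Section weak_exponent.
Context {R : realType} {n : nat}.
Notation V := 'rV[R]_n.
Notation mu := (@lebesgue_measure R).

Lemma cexp_i (x y : R) : cexp ('i * x%:C - y%:C)%C =
  ((expR (- y) * cos x) +i* (expR (- y) * sin x))%C.
Proof. by rewrite /cexp /= !(mul0r, mulr0, mul1r, subr0, sub0r, add0r, addr0, oppr0). Qed.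

(** The real and imaginary parts of - ln (1 + q - i l), kept as integrals over
    the ray. *)
Definition ray_re (q l : R) : R :=
  \int[mu]_(r in `]0%R, +oo[) ((expR (- (r * q)) * cos (r * l) - 1) * (expR (- r) / r)).

Definition ray_im (q l : R) : R :=
  \int[mu]_(r in `]0%R, +oo[) ((expR (- (r * q)) * sin (r * l)) * (expR (- r) / r)).

Lemma ler_norm_sin (x : R) : `|sin x| <= `|x|.
Proof.
wlog x0 : x / 0 <= x.
  move=> h; have [/h//|x0] := leP 0 x.
  by rewrite -normrN -sinN -[leRHS]normrN h// oppr_ge0 ltW.
move: x0; rewrite le_eqVlt => /orP[/eqP <-|x0]; first by rewrite sin0 normr0.
have dsin z : z \in `]0, x[ -> is_derive z 1 (@sin R) (cos z) by move=> _; exact: is_derive_sin.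
have cs : {within `[0, x], continuous (@sin R)}.
  by apply: continuous_subspaceT; exact: continuous_sin.
have [z _] := MVT x0 dsin cs; rewrite sin0 !subr0 => ->.
by rewrite normrM ler_piMl// ler_norml cos_geN1 cos_le1.
Qed.

Lemma ler_norm_expcos (q l : R) : 0 <= q ->
  `|expR (- q) * cos l - 1| <= q + `|l|.
Proof.
move=> q0.
have e1 : expR (- q) <= 1 by rewrite -expR0 ler_expR oppr_le0.
have e2 : 1 - expR (- q) <= q by have := expR_ge1Dx (- q); lra.
have c1 : `|1 - cos l| <= `|l|.
  have cl : 1 - cos l = 2 * sin (l / 2) ^+ 2.
    have -> : cos l = cos (l / 2 + l / 2) by congr cos; field.
    by rewrite cosD; have := cos2Dsin2 (l / 2); rewrite !expr2; lra.
  have sl := ler_norm_sin (l / 2); have s1 : `|sin (l / 2)| <= 1 by rewrite ler_norml sin_geN1 sin_le1.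
  have s2 : sin (l / 2) ^+ 2 = `|sin (l / 2)| ^+ 2 by rewrite real_normK// num_real.
  rewrite cl ger0_norm; last by apply: mulr_ge0 => //; exact: sqr_ge0.
  rewrite s2.
  move: sl; rewrite normrM normfV (ger0_norm (x := 2))// => sl.
  have := normr_ge0 (sin (l / 2)); nra.
have -> : expR (- q) * cos l - 1 = - ((1 - expR (- q)) + expR (- q) * (1 - cos l)) by ring.
rewrite normrN (le_trans (ler_normD _ _))// lerD//.
  by rewrite ger0_norm// subr_ge0.
by rewrite normrM ger0_norm ?expR_ge0// (le_trans _ c1)// ler_piMl.
Qed.

Lemma ler_norm_expcos2 (q l : R) : 0 <= q -> `|expR (- q) * cos l - 1| <= 2.
Proof.
move=> q0; rewrite (le_trans (ler_normB _ _))// normr1 -[2]/(1 + 1) lerD2r.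
rewrite normrM ger0_norm ?expR_ge0//.
have e1 : expR (- q) <= 1 by rewrite -expR0 ler_expR oppr_le0.
have c1 : `|cos l| <= 1 by rewrite ler_norml cos_geN1 cos_le1.
have := expR_ge0 (- q); have := normr_ge0 (cos l); nra.
Qed.

Lemma ler_norm_expsin (q l : R) : 0 <= q ->
  `|expR (- q) * sin l| <= 1 /\ `|expR (- q) * sin l| <= `|l|.
Proof.
move=> q0; rewrite normrM ger0_norm ?expR_ge0//.
have e1 : expR (- q) <= 1 by rewrite -expR0 ler_expR oppr_le0.
have s1 : `|sin l| <= 1 by rewrite ler_norml sin_geN1 sin_le1.
have sl := ler_norm_sin l.
have := expR_ge0 (- q); have := normr_ge0 (sin l); split; nra.
Qed.

Context {d : measure_display} {T : measurableType d}.
Variables (P : probability T R) (S : R -> T -> V).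
Variables (nu : {measure set (borel V) -> \bar R}) (a : R) (alpha : V).
Hypotheses (n_gt0 : (0 < n)%N) (alpha_gt0 : forall k, 0 < alpha 0 k).
Hypothesis SAG : AG_subordinator P S a alpha.
Hypothesis Snu : driftless_with_levy_measure P S nu.
Variables (m : V) (Sigma : 'M[R]_n).
Hypothesis covS : covariance_matrix Sigma.

Definition ray_quadratic (j : 'I_n.+1) (theta : V) : R :=
  2^-1 * sqnorm_mx (diamond_mx (ray_direction alpha j) Sigma) theta.

Definition ray_drift (j : 'I_n.+1) (theta : V) : R :=
  dot theta (diamond_vec (ray_direction alpha j) m).

Lemma ray_quadratic_ge0 j theta : 0 <= ray_quadratic j theta.
Proof.
by rewrite mulr_ge0 ?invr_ge0// diamond_mx_ge0// => k; exact: ray_direction_ge0.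
Qed.

Let q (s theta : V) : R := 2^-1 * sqnorm_mx (diamond_mx s Sigma) theta.
Let l (s theta : V) : R := dot theta (diamond_vec s m).

Let mq theta : measurable_fun setT (fun s : borel V => q s theta).
Proof.
apply: measurable_funM => //; under eq_fun do rewrite sqnorm_mxE.
apply: measurable_sum => i; apply: measurable_sum => j.
under eq_fun do rewrite mxE.
do 3 (apply: measurable_funM => //).
by apply: measurable_minr; exact: measurable_coord.
Qed.

Let ml theta : measurable_fun setT (fun s : borel V => l s theta).
Proof.
rewrite /l; under eq_fun do rewrite dotE.
apply: measurable_sum => i; under eq_fun do rewrite mxE.
by do 2 (apply: measurable_funM => //); exact: measurable_coord.
Qed.

Let mexpcos theta : measurable_fun setT
  (fun s : borel V => expR (- q s theta) * cos (l s theta) - 1).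
Proof.
apply: measurable_funB => //; apply: measurable_funM.
  by apply: measurableT_comp => //; exact: measurable_funN.
by apply: measurableT_comp => //; apply: continuous_measurable_fun; exact: continuous_cos.
Qed.

Let mexpsin theta : measurable_fun setT
  (fun s : borel V => expR (- q s theta) * sin (l s theta)).
Proof.
apply: measurable_funM.
  by apply: measurableT_comp => //; exact: measurable_funN.
by apply: measurableT_comp => //; apply: continuous_measurable_fun; exact: continuous_sin.
Qed.

Let ql_bound theta : exists2 K, 0 <= K & forall s, orthant s ->
  q s theta + `|l s theta| <= K * sum_norm s.
Proof.
pose K1 := \sum_i \sum_j `|theta 0 i * Sigma i j * theta 0 j|.
pose K2 := sum_norm (diamond_vec theta m).
have K10 : 0 <= K1 by apply: sumr_ge0 => i _; exact: sumr_ge0.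
have K20 : 0 <= K2 by exact: sum_norm_ge0.
exists (K1 + K2); first exact: addr_ge0.
move=> s [s0 _]; rewrite mulrDl; apply: lerD.
  have := ler_sqnorm_diamond Sigma theta s0; rewrite -/K1 => h.
  have := ler_norm (sqnorm_mx (diamond_mx s Sigma) theta).
  have := sum_norm_ge0 s; rewrite /q; nra.
have -> : l s theta = dot (diamond_vec theta m) s.
  rewrite /l !dotE; apply: eq_bigr => i _; rewrite !mxE; ring.
exact: ler_dot_sum_norm.
Qed.

Lemma weak_exponentE theta : weak_exponent m Sigma nu theta =
  ((\sum_j ray_weight a alpha j * ray_re (ray_quadratic j theta) (ray_drift j theta))
  +i* (\sum_j ray_weight a alpha j * ray_im (ray_quadratic j theta) (ray_drift j theta)))%C.
Proof.
have [K K0 Kb] := ql_bound theta.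
have q0 s : orthant s -> 0 <= q s theta.
  by case=> s0 _; rewrite mulr_ge0 ?invr_ge0// diamond_mx_ge0.
have rays := levy_measure_rays n_gt0 alpha_gt0 SAG Snu.
have scale r j : 0 < r -> q (r *: ray_direction alpha j) theta = r * ray_quadratic j theta
    /\ l (r *: ray_direction alpha j) theta = r * ray_drift j theta.
  move=> r0; split.
    by rewrite /q /ray_quadratic sqnorm_diamond_scale ?ltW//; ring.
  by rewrite /l diamond_vec_scale dotZr.
rewrite /weak_exponent /cintegral; congr (_ +i* _)%C.
- transitivity (\int[nu]_(s in orthant) (expR (- q s theta) * cos (l s theta) - 1)).
    by apply: eq_Rintegral => s _; rewrite cexp_i.
  rewrite (rays _ (2 * (2 + K)) (mexpcos theta)); last first.
    move=> s Ds; apply: expR_weight_bound => //; first exact: sum_norm_ge0.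
      exact/ler_norm_expcos2/q0.
    exact: le_trans (ler_norm_expcos _ (q0 s Ds)) (Kb s Ds).
  apply: eq_bigr => j _; congr (_ * _); apply: eq_Rintegral => r.
  rewrite inE/= in_itv/= andbT => r0.
  by have [-> ->] := scale r j r0.
- transitivity (\int[nu]_(s in orthant) (expR (- q s theta) * sin (l s theta))).
    by apply: eq_Rintegral => s _; rewrite cexp_i/= subr0.
  rewrite (rays _ (2 * (2 + K)) (mexpsin theta)); last first.
    move=> s Ds; have [b1 b2] := ler_norm_expsin (l s theta) (q0 s Ds).
    apply: expR_weight_bound => //; first exact: sum_norm_ge0.
      by rewrite (le_trans b1)// ler1n.
    by rewrite (le_trans b2)// (le_trans _ (Kb s Ds))// lerDr q0.
  apply: eq_bigr => j _; congr (_ * _); apply: eq_Rintegral => r.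
  rewrite inE/= in_itv/= andbT => r0.
  by have [-> ->] := scale r j r0.
Qed.
End weak_exponent.

(** * Mixtures, products and densities *)

Section probability_constructions.
Context {R : realType} {d : measure_display} {T : measurableType d}.

Lemma probability_of_measure (m : {measure set T -> \bar R}) (P0 : probability T R) :
  m setT = 1%E -> exists P : probability T R, forall A, P A = m A.
Proof.
move=> m1; exists (mnormalize m P0) => A.
by rewrite /= /mnormalize m1 onee_eq0/= invr1 mule1.
Qed.

Lemma integral_cvg_series (u : nat -> R) (s : R) :
  (forall k, 0 <= u k) -> series u @ \oo --> s ->
  (\sum_(k <oo) (u k)%:E = s%:E)%E.
Proof.
move=> u0 us; apply/cvg_lim => //.
rewrite (_ : (fun n => _) = EFin \o series u); last first.
  by apply/funext => n /=; rewrite sumEFin.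
by apply: cvg_EFin; [exact: nearW|].
Qed.

(** A mixture of countably many laws; the nonnegativity of f lets the integral
    against the sum of measures be computed termwise. *)
Lemma probability_mixture (P_ : nat -> probability T R) (w : nat -> R) :
  (forall k, 0 <= w k) -> series w @ \oo --> (1 : R) ->
  exists P : probability T R, forall f : T -> R, bounded_measurable f ->
    (forall x, 0 <= f x) -> forall s : R,
    series (fun k => w k * \int[P_ k]_x f x) @ \oo --> s -> \int[P]_x f x = s.
Proof.
move=> w0 w1; pose m_ k : {measure set T -> \bar R} := mscale (NngNum (w0 k)) (P_ k).
pose m : {measure set T -> \bar R} := mseries m_ 0.
have m1 : m setT = 1%E.
  rewrite -(integral_cvg_series w0 w1) /m /= /mseries.
  by apply: eq_eseriesr => k _; rewrite -[RHS]mule1 -(probability_setT (P_ k)).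
have [P PE] := probability_of_measure (P_ 0%N) m1.
exists P => f bf f0 s fs; rewrite /Rintegral.
have mf : measurable_fun setT (EFin \o f) by case: bf => mf _; exact/measurable_EFinP.
have -> : (\int[P]_x (f x)%:E = \int[m]_x (f x)%:E)%E.
  by apply: eq_measure_integral => A mA _; exact: PE.
rewrite ge0_integral_measure_series//.
have I0 k : 0 <= w k * \int[P_ k]_x f x by rewrite mulr_ge0// Rintegral_ge0.
rewrite -[RHS]/(fine s%:E) -(integral_cvg_series I0 fs); congr fine.
apply: eq_eseriesr => k _.
transitivity ((w k)%:E * \int[P_ k]_x (f x)%:E)%E.
  by apply: ge0_integral_mscale => // x _; rewrite lee_fin.
rewrite EFinM; congr (_ * _)%E; rewrite fineK//; apply: integrable_fin_num => //.
exact: bounded_measurable_integrable.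
by move=> x _; rewrite lee_fin.
Qed.

Context {d' : measure_display} {T' : measurableType d'}.

Definition product_law (P : probability T R) (P' : probability T' R) :
  probability (T * T')%type R := (P \x P')%E.

Lemma Rintegral_product (P : probability T R) (P' : probability T' R)
    (f : T * T' -> R) : bounded_measurable f ->
  \int[product_law P P']_z f z = \int[P]_x \int[P']_y f (x, y).
Proof.
move=> bf; have [mf [C fC]] := bf.
have if_ : (product_law P P').-integrable setT (EFin \o f).
  exact: bounded_measurable_integrable.
have := @integral12_prod_meas1 _ _ _ _ _ P P' (EFin \o f) if_.
rewrite /Rintegral => <-; congr fine.
apply: eq_integral => x _; rewrite fineK//.
apply: integrable_fin_num => //; apply: bounded_measurable_integrable.
split; last by exists C.
exact: measurableT_comp (pair1_measurable x).
Qed.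

End probability_constructions.

Section density.
Context {R : realType} {d : measure_display} {T : measurableType d}.
Variables (mu : {measure set T -> \bar R}) (h : T -> R).
Hypotheses (mh : measurable_fun setT h) (h0 : forall x, 0 <= h x).

(** The hypotheses on h are arguments, so that the measure structure can be
    attached to the set function for every h that satisfies them. *)
Definition density_measure of measurable_fun setT h & (forall x, 0 <= h x) :=
  fun A : set T => (\int[mu]_(x in A) (h x)%:E)%E.
Local Notation density := (density_measure mh h0).

Let density0 : density set0 = 0%E.
Proof. by rewrite /density_measure integral_set0. Qed.

Let density_ge0 A : (0 <= density A)%E.
Proof. by apply: integral_ge0 => x _; rewrite lee_fin. Qed.

Let density_sigma_additive : semi_sigma_additive density.
Proof.
move=> /= F mF tF mUF; rewrite /density_measure; apply: cvg_toP.
  apply: ereal_nondecreasing_is_cvgn => m n mn.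
  by apply: lee_sum_nneg_natr => // k _ _; apply: integral_ge0 => x _; rewrite lee_fin.
rewrite ge0_integral_bigcup//=.
- by apply/measurable_EFinP; exact: measurable_funTS.
- by move=> x _; rewrite lee_fin.
Qed.

HB.instance Definition _ := isMeasure.Build _ _ _
  density density0 density_ge0 density_sigma_additive.

End density.

Section density_integral.
Context {R : realType} {d : measure_display} {T : measurableType d}.
Variables (mu : {measure set T -> \bar R}) (h : T -> R).
Hypotheses (mh : measurable_fun setT h) (h0 : forall x, 0 <= h x).

Lemma Rintegral_density (P : probability T R) (f : T -> R) :
  (forall A, measurable A -> P A = \int[mu]_(x in A) (h x)%:E)%E ->
  bounded_measurable f -> \int[P]_x f x = \int[mu]_x (f x * h x).
Proof.
move=> PE bf.
have ih : mu.-integrable setT (EFin \o h).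
  apply/integrableP; split; first exact/measurable_EFinP.
  under eq_integral do rewrite /= ger0_norm//.
  by rewrite -PE// -[X in (X < _)%E]/(P setT) probability_setT ltry.
pose L1 (f : T -> R) := \int[P]_(x in setT) (f (id x) * 1).
pose L2 (f : T -> R) := \int[mu]_(x in setT) (f (id x) * h x).
have iL1 : integral_like L1.
  apply: (@integral_like_Rintegral _ _ _ T T P setT id) => //.
  exact: finite_measure_integrable_cst.
have iL2 : integral_like L2 by exact: (@integral_like_Rintegral _ _ _ T T mu setT id).
transitivity (L1 f); first by apply: eq_Rintegral => x _; rewrite mulr1.
suff : L1 f = L2 f by [].
apply: integral_like_indic => // A mA; rewrite /L1 /L2.
under eq_Rintegral do rewrite mulr1.
rewrite Rintegral_indic//; congr fine; rewrite PE//.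
rewrite integral_mkcond; apply: eq_integral => x _.
by rewrite patchE /= indicE; case: ifPn; rewrite ?mul1r ?mul0r.
Qed.

Lemma probability_density (P0 : probability T R) :
  (\int[mu]_x (h x)%:E = 1)%E ->
  exists P : probability T R, forall f : T -> R, bounded_measurable f ->
    \int[P]_x f x = \int[mu]_x (f x * h x).
Proof.
move=> h1; have [P PE] := @probability_of_measure _ _ _ (density_measure mu mh h0) P0 h1.
by exists P => f bf; apply: Rintegral_density => // A mA; exact: PE.
Qed.
End density_integral.

(** * The characteristic function of the normal law *)

Section gaussian.
Context {R : realType}.
Notation mu := (@lebesgue_measure R).
Variable c : R.
Let p : R -> R := normal_pdf 0 1.

Let one_neq0 : (1 : R) != 0. Proof. exact: oner_neq0. Qed.

Let pE x : p x = normal_peak 1 * expR (- (x ^+ 2 / 2)).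
Proof.
by rewrite /p normal_pdfE// /normal_fun subr0 expr1n mulNr.
Qed.

Let p0 x : 0 <= p x. Proof. exact: normal_pdf_ge0. Qed.

Let mp : measurable_fun setT p. Proof. exact: measurable_normal_pdf. Qed.

Let ip : mu.-integrable setT (EFin \o p).
Proof. exact: integrable_normal_pdf. Qed.

Let C : R := normal_peak 1 / normal_peak (Num.sqrt 2).
Let bound x : R := C * normal_pdf 0 (Num.sqrt 2) x.

Let sqrt2 : Num.sqrt 2 != 0 :> R.
Proof. by rewrite gt_eqF// sqrtr_gt0. Qed.

Let boundE x : bound x = normal_peak 1 * expR (- (x ^+ 2 / 4)).
Proof.
rewrite /bound /C normal_pdfE// mulrA divfK; last by rewrite gt_eqF// normal_peak_gt0.
rewrite /normal_fun subr0 sqr_sqrtr// mulNr; congr (_ * expR (- (_ / _))).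
by rewrite mulr2n -natrD.
Qed.

Let ibound : mu.-integrable setT (EFin \o bound).
Proof.
rewrite /bound /comp; under eq_fun do rewrite EFinM.
by apply: integrableZl => //; exact: integrable_normal_pdf.
Qed.

Let xp_bound x : `|x| * p x <= bound x.
Proof.
rewrite pE boundE mulrCA ler_wpM2l ?normal_peak_ge0//.
have -> : - (x ^+ 2 / 2) = - (x ^+ 2 / 4) + - (x ^+ 2 / 4) by field.
rewrite expRD mulrA ler_piMl ?expR_ge0//.
rewrite expRN ler_pdivrMr ?expR_gt0// mul1r.
apply: le_trans (expR_ge1Dx _).
have := sqr_ge0 (`|x| - 2); have : `|x| ^+ 2 = x ^+ 2 by rewrite real_normK ?num_real.
rewrite !expr2; nra.
Qed.

Let p_bound x : p x <= bound x.
Proof.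
rewrite pE boundE ler_wpM2l ?normal_peak_ge0// ler_expR lerN2.
by rewrite ler_wpM2l ?sqr_ge0// lef_pV2 ?posrE// ler_nat.
Qed.

Let dp (x : R) : is_derive x 1 p (- (x * p x)).
Proof.
have -> : p = (fun x => normal_peak 1 * expR (- (x ^+ 2 / 2))) by apply/funext => y; rewrite pE.
by apply: is_derive_eq; rewrite /GRing.scale/=; field.
Qed.

Let F (t : R) : R := \int[mu]_x (cos (t * x + c) * p x).
Let S (t : R) : R := \int[mu]_x (x * sin (t * x + c) * p x).

Let integrable_bounded (f : R -> R) k : measurable_fun setT f ->
  (forall x, `|f x| <= k * bound x) -> mu.-integrable setT (EFin \o f).
Proof.
move=> mf fb; apply: (@le_integrable _ _ _ mu setT measurableT _ (fun x => (k * bound x)%:E)).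
- exact/measurable_EFinP.
- by move=> x _; rewrite lee_fin (le_trans (fb x))// ler_norm.
- by under eq_fun do rewrite EFinM; apply: integrableZl.
Qed.

Let bound0 x : 0 <= bound x. Proof. exact: le_trans (p0 x) (p_bound x). Qed.

Let continuous_affine t : continuous (fun x : R => t * x + c).
Proof. by move=> x; apply: (@cvgD _ R^o); [exact: mulrl_continuous|exact: cvg_cst]. Qed.

Let mcos t : measurable_fun setT (fun x : R => cos (t * x + c)).
Proof.
apply: continuous_measurable_fun => x; apply: continuous_comp; first exact: continuous_affine.
exact: continuous_cos.
Qed.

Let msin t : measurable_fun setT (fun x : R => sin (t * x + c)).
Proof.
apply: continuous_measurable_fun => x; apply: continuous_comp; first exact: continuous_affine.
exact: continuous_sin.
Qed.

Let cosp_bound t x : `|cos (t * x + c) * p x| <= 1 * bound x.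
Proof.
rewrite normrM (ger0_norm (p0 x)); apply: ler_pM => //.
by rewrite ler_norml cos_geN1 cos_le1.
Qed.

Let xsinp_bound t x : `|x * sin (t * x + c) * p x| <= 1 * bound x.
Proof.
rewrite !normrM (ger0_norm (p0 x)) mul1r; apply: le_trans (xp_bound x).
apply: ler_wpM2r => //; rewrite ler_piMr//.
by rewrite ler_norml sin_geN1 sin_le1.
Qed.

Let icosp t : mu.-integrable setT (EFin \o (fun x => cos (t * x + c) * p x)).
Proof.
by apply: (integrable_bounded (k := 1)); [exact: measurable_funM|exact: cosp_bound].
Qed.

Let ixsinp t : mu.-integrable setT (EFin \o (fun x => x * sin (t * x + c) * p x)).
Proof.
apply: (integrable_bounded (k := 1)); last exact: xsinp_bound.
by apply: measurable_funM => //; exact: measurable_funM.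
Qed.

Let dF (t : R) : is_derive t 1 F (- S t).
Proof.
have dcos (x s : R) : is_derive s 1 (fun t => cos (t * x + c) * p x) (- (x * sin (s * x + c) * p x)).
  by apply: is_derive_eq; rewrite /GRing.scale/=; ring.
have d1 (s x : R) : partial1of2 (fun t x => cos (t * x + c) * p x) s x = - (x * sin (s * x + c) * p x).
  by rewrite partial1of2E; apply: derive_val; exact: dcos.
have h := @cvg_differentiation_under_integral R _ (measurableTypeR R) mu
  (fun t x => cos (t * x + c) * p x) setT measurableT t (t - 1) (t + 1) _ _ _ bound bound0 ibound _.
have {h} := h _ (fun s _ => icosp s) _ _.
have tI : `]t - 1, t + 1[%classic t by rewrite /= in_itv/=; lra.
move=> /(_ tI); have -> : \int[mu]_y partial1of2 (fun t0 x => cos (t0 * x + c) * p x) t y = - S t.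
  rewrite /S -[RHS]mulN1r -RintegralZl//; apply: eq_Rintegral => x _.
  by rewrite d1 mulN1r.
move=> h; have {}h : h0^-1 *: (F (h0 + t) - F t) @[h0 --> 0^'] --> - S t.
  apply: h.
  - by move=> s x _ _; have [] := dcos x s.
  - by move=> s x _ _; rewrite d1 normrN -[leRHS]mul1r; exact: xsinp_bound.
apply: DeriveDef.
  apply/cvg_ex; exists (- S t).
  by under eq_fun do rewrite scaler1.
rewrite /derive; apply/cvg_lim => //.
by under eq_fun do rewrite scaler1.
Qed.

(** Integration by parts: x e^(- x^2 / 2) is minus the derivative of e^(- x^2 / 2).
    Hence the transform F satisfies F' = - t F. *)
Let parts t : S t = t * F t.
Proof.
pose K x := sin (t * x + c) * p x.
pose k x := t * (cos (t * x + c) * p x) - x * sin (t * x + c) * p x.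
have dK (x : R) : is_derive x 1 K (k x).
  by have dpx := dp x; rewrite /K; apply: is_derive_eq; rewrite /k /GRing.scale/=; ring.
have dcp x : derivable p x 1 by have [] := dp x.
have cp x : {for x, continuous p} by exact/differentiable_continuous/derivable1_diffP.
have ck x : {for x, continuous k}.
  apply: (@continuousB _ _ R^o).
  - apply: continuousM; first exact: cst_continuous.
    apply: continuousM => //; apply: continuous_comp; first exact: continuous_affine.
    exact: continuous_cos.
  - apply: continuousM => //; apply: continuousM; first exact: cvg_id.
    apply: continuous_comp; first exact: continuous_affine.
    exact: continuous_sin.
have mk : measurable_fun setT k by exact: continuous_measurable_fun.
have k_bound x : `|k x| <= (`|t| + 1) * bound x.
  rewrite mulrDl (le_trans (ler_normB _ _))// lerD//.
    by rewrite normrM ler_wpM2l// -[leRHS]mul1r; exact: cosp_bound.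
have ik : mu.-integrable setT (EFin \o k) by exact: integrable_bounded k_bound.
have lim1 : \int[mu]_(x in setT) (k x * \1_(`[- n%:R, n%:R]%classic : set R) x) @[n --> \oo]
    --> \int[mu]_x k x.
  apply: fine_cvg; rewrite fineK; last exact: integrable_fin_num.
  apply: (@dominated_cvg _ _ _ mu setT measurableT
    (fun n x => (k x * \1_(`[- n%:R, n%:R]%classic : set R) x)%:E) _
    (fun x => ((`|t| + 1) * bound x)%:E)) => //.
  - move=> n; apply/measurable_EFinP; apply: measurable_funM => //.
  - move=> x _; apply: cvg_near_cst; near=> n; rewrite indicE mem_set ?mulr1//=.
    rewrite in_itv/= -ler_norml.
    by near: n; exact: nbhs_infty_ger.
  - by under eq_fun do rewrite EFinM; apply: integrableZl.
  - move=> n x _; rewrite lee_fin normrM; apply: le_trans (k_bound x).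
    by rewrite ler_piMr// indicE; case: (_ \in _); rewrite ?normr1 ?normr0.
have lim2 : \int[mu]_(x in setT) (k x * \1_(`[- n%:R, n%:R]%classic : set R) x) @[n --> \oo] --> 0.
  have E n : (0 < n)%N -> \int[mu]_(x in setT) (k x * \1_(`[- n%:R, n%:R]%classic : set R) x) = K n%:R - K (- n%:R).
    move=> n0; transitivity (\int[mu]_(x in `[- n%:R, n%:R]) k x).
      rewrite [RHS]Rintegral_mkcond; apply: eq_Rintegral => x _.
      by rewrite patchE indicE; case: ifPn; rewrite ?mulr1 ?mulr0.
    by rewrite /Rintegral (integral_FTC _ (fun x _ => dK x))//= gtrN// ltr0n.
  have pn : p n%:R @[n --> \oo] --> 0.
    apply: (@squeeze_cvgr _ _ _ _ (fun=> 0) (fun n => normal_peak 1 * n.+1%:R^-1)).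
    - near=> n; rewrite p0/= pE ler_wpM2l ?normal_peak_ge0//.
      rewrite expRN lef_pV2 ?posrE ?expR_gt0//.
      apply: le_trans (expR_ge1Dx _).
      have n2 : 2 <= n%:R :> R by rewrite ler_nat; near: n; exact: nbhs_infty_ge.
      rewrite -natr1 addrC lerD2l ler_pdivlMr// expr2; nra.
    - exact: cvg_cst.
    - rewrite -(mulr0 (normal_peak 1)); apply: cvgM; first exact: cvg_cst.
      exact: cvg_harmonic.
  apply: norm_cvg0.
  apply: (@squeeze_cvgr _ _ _ _ (fun=> 0) (fun n => 2 * p n%:R)).
  - near=> n; rewrite normr_ge0/= E; last by near: n; exact: nbhs_infty_gt.
    have Kp x : `|K x| <= p x.
      rewrite /K normrM (ger0_norm (p0 _)) ler_piMl//.
      by rewrite ler_norml sin_geN1 sin_le1.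
    rewrite (le_trans (ler_normB _ _))// mulr2n mulrDl mul1r lerD//.
    by rewrite (le_trans (Kp _))// !pE sqrrN.
  - exact: cvg_cst.
  - by rewrite -(mulr0 2); apply: cvgM; [exact: cvg_cst|].
have : \int[mu]_x k x = 0 by apply: cvg_unique lim1 lim2.
have i1 := icosp t; have i2 := ixsinp t.
have i3 : mu.-integrable setT (EFin \o (fun x => t * (cos (t * x + c) * p x))).
  by rewrite /comp; under eq_fun do rewrite EFinM; exact: integrableZl.
rewrite /k RintegralB// RintegralZl//.
by move=> /eqP; rewrite subr_eq0 => /eqP E; exact: (esym E).
Unshelve. all: end_near. Qed.

Lemma normal_cos t :
  \int[normal_prob 0 1]_x cos (t * x + c) = expR (- (t ^+ 2 / 2)) * cos c.
Proof.
have -> : \int[normal_prob 0 1]_x cos (t * x + c) = F t.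
  apply: Rintegral_density => //; split; first exact: mcos.
  by exists 1 => x; rewrite ler_norml cos_geN1 cos_le1.
pose H s := F s * expR (s ^+ 2 / 2).
have dH (s : R) : is_derive s 1 H 0.
  by have dFs := dF s; rewrite /H; apply: is_derive_eq; rewrite parts /GRing.scale/=; field.
have HE : H t = H 0 by exact: is_derive_0_is_cst.
have F0 : F 0 = cos c.
  rewrite /F; under eq_Rintegral do rewrite mul0r add0r.
  rewrite RintegralZl// [X in _ * X]/Rintegral integral_normal_pdf; exact: mulr1.
have : F t * expR (t ^+ 2 / 2) = cos c by move: HE; rewrite /H expr0n/= mul0r expR0 F0 mulr1.
by move=> <-; rewrite expRN mulrC mulfK// gt_eqF// expR_gt0.
Qed.
End gaussian.

(** * Characteristic functions of symmetric laws *)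

Section symmetric_char.
Context {R : realType} {n : nat}.
Notation V := 'rV[R]_n.
Notation mu := (@lebesgue_measure R).
Implicit Types (phi psi : V -> R) (theta : V).

(** A phase c in place of complex exponentials: the identity says at once that
    the cosine transform is phi and that the sine transform vanishes. *)
Definition symmetric_char phi := exists m : probability (borel V) R,
  forall theta c, \int[m]_x cos (dot theta x + c) = phi theta * cos c.

(** Laws on the space of row vectors are transported from any convenient
    probability space, which keeps the class below on a single type. *)
Lemma law_exists {d : measure_display} {T : measurableType d}
    (P : probability T R) (X : T -> V) : random_element X ->
  exists m : probability (borel V) R, forall f : borel V -> R,
    bounded_measurable f -> \int[m]_x f x = \int[P]_w f (X w).
Proof.
move=> rX; pose Y : {mfun T >-> borel V} := mfun_Sub (mem_set rX).
exists (distribution P Y) => f bf; have [mf _] := bf.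
rewrite /Rintegral; congr fine.
rewrite integral_distribution//; first exact/measurable_EFinP.
by apply: bounded_measurable_integrable; exact: bounded_measurable_comp.
Qed.

Lemma symmetric_char_normal (v : V) :
  symmetric_char (fun theta => expR (- (2^-1 * dot v theta ^+ 2))).
Proof.
have rX : random_element (fun x : measurableTypeR R => (x : R) *: v).
  apply: (@measurable_rV _ _ _ (measurableTypeR R)) => k.
  by under eq_fun do rewrite mxE; exact: measurable_funM.
have [m mE] := law_exists (normal_prob 0 1) rX; exists m => theta c.
rewrite mE; last exact: bounded_measurable_cos.
transitivity (\int[normal_prob 0 1]_x cos (dot theta v * x + c)).
  by apply: eq_Rintegral => x _; rewrite dotZr mulrC.
rewrite normal_cos; congr (expR (- _) * _); rewrite mulrC; congr (_ * _ ^+ 2).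
by rewrite !dotE; apply: eq_bigr => k _; rewrite mulrC.
Qed.

Lemma symmetric_char_ext phi psi : phi =1 psi -> symmetric_char phi -> symmetric_char psi.
Proof. by move=> /funext ->. Qed.

Lemma symmetric_char1 : symmetric_char (fun=> 1).
Proof.
apply: symmetric_char_ext (symmetric_char_normal 0) => theta.
by rewrite /dot mul0mx mxE expr0n/= mulr0 oppr0 expR0.
Qed.

Lemma symmetric_charM phi psi : symmetric_char phi -> symmetric_char psi ->
  symmetric_char (fun theta => phi theta * psi theta).
Proof.
move=> [m1 m1E] [m2 m2E].
have rX : random_element (fun z : borel V * borel V => (z.1 : V) + z.2).
  apply: measurable_rV => k; under eq_fun do rewrite mxE.
  apply: measurable_funD.
    exact: (measurableT_comp (measurable_coord k) measurable_fst).
  exact: (measurableT_comp (measurable_coord k) measurable_snd).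
have [m mE] := law_exists (product_law m1 m2) rX; exists m => theta c.
rewrite mE; last exact: bounded_measurable_cos.
rewrite Rintegral_product; last first.
  exact: (bounded_measurable_comp rX (bounded_measurable_cos theta c)).
transitivity (\int[m1]_x (psi theta * cos (dot theta x + c))).
  apply: eq_Rintegral => x _; rewrite -m2E; apply: eq_Rintegral => y _.
  by rewrite dotDr; congr cos; ring.
rewrite RintegralZl//.
  by rewrite m1E; ring.
by apply: bounded_measurable_integrable; exact: bounded_measurable_cos.
Qed.

Lemma symmetric_char_prod (I : Type) (s : seq I) (phi_ : I -> V -> R) :
  (forall i, symmetric_char (phi_ i)) ->
  symmetric_char (fun theta => \prod_(i <- s) phi_ i theta).
Proof.
move=> h; elim: s => [|i s IH].
  by apply: symmetric_char_ext symmetric_char1 => theta; rewrite big_nil.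
by apply: symmetric_char_ext (symmetric_charM (h i) IH) => theta; rewrite big_cons.
Qed.

Lemma symmetric_charX phi k : symmetric_char phi ->
  symmetric_char (fun theta => phi theta ^+ k).
Proof.
move=> h; elim: k => [|k IH]; first exact: symmetric_char1.
by apply: symmetric_char_ext (symmetric_charM h IH) => theta; rewrite exprS.
Qed.

(** The compound Poisson law with jump law phi. The integrand is shifted by 1 to
    make it nonnegative. *)
Lemma symmetric_char_poisson phi (lambda : R) : 0 <= lambda -> symmetric_char phi ->
  symmetric_char (fun theta => expR (lambda * (phi theta - 1))).
Proof.
move=> l0 sphi; have /choice[m_ mE] k := symmetric_charX k sphi.
pose w k := expR (- lambda) * exp_coeff lambda k.
have w0 k : 0 <= w k by rewrite mulr_ge0 ?expR_ge0// exp_coeff_ge0.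
have cw x : series (fun k => expR (- lambda) * exp_coeff x k) @ \oo --> expR (- lambda) * expR x.
  rewrite (_ : series _ = (fun k => expR (- lambda) * series (exp_coeff x) k)).
    by apply: cvgM; [exact: cvg_cst|exact: is_cvg_series_exp_coeff].
  by apply/funext => k; rewrite /series /= big_distrr.
have w1 : series w @ \oo --> (1 : R).
  by have := cw lambda; rewrite -expRD addNr expR0.
have [m mixE] := probability_mixture m_ w0 w1; exists m => theta c.
have bcos := bounded_measurable_cos theta c.
have b1cos : bounded_measurable (fun x : borel V => 1 + cos (dot theta x + c)).
  by apply: bounded_measurableD => //; exact: bounded_measurable_cst.
have int1 (P : probability (borel V) R) :
    \int[P]_x (1 + cos (dot theta x + c)) = 1 + \int[P]_x cos (dot theta x + c).
  rewrite RintegralD//; last exact: bounded_measurable_integrable.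
    by rewrite Rintegral_cst// [fine _](_ : _ = 1) ?mulr1// -[1]/(fine 1%E) -(probability_setT P).
  exact: finite_measure_integrable_cst.
have cos0 (x : borel V) : 0 <= 1 + cos (dot theta x + c).
  by have := cos_geN1 (dot theta x + c); lra.
apply: (@addrI _ 1); rewrite -int1; apply: (mixE _ b1cos cos0).
rewrite (_ : series _ = (fun k => series w k + cos c *
    series (fun k => expR (- lambda) * exp_coeff (lambda * phi theta) k) k)); last first.
  apply/funext => N; rewrite /series /= big_distrr -big_split; apply: eq_bigr => k _ /=.
  by rewrite int1 mE /w /exp_coeff /= exprMn; ring.
apply: cvgD => //.
rewrite (_ : _ * cos c = cos c * (expR (- lambda) * expR (lambda * phi theta))).
  by apply: cvgM; [exact: cvg_cst|exact: cw].
by rewrite -expRD mulrC; congr (_ * expR _); ring.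
Qed.

Lemma symmetric_char_scale_mixture (q : V -> R) (rho : probability (measurableTypeR R) R) :
  (forall s theta, q (s *: theta) = s ^+ 2 * q theta) -> (forall theta, 0 <= q theta) ->
  symmetric_char (fun theta => expR (- q theta)) ->
  symmetric_char (fun theta => \int[rho]_v expR (- (Num.sqrt v ^+ 2 * q theta))).
Proof.
move=> qZ q0 [m mE].
have msqrt : measurable_fun setT (fun v : measurableTypeR R => Num.sqrt v).
  by apply: continuous_measurable_fun; exact: sqrt_continuous.
have rX : random_element (fun z : measurableTypeR R * borel V => Num.sqrt z.1 *: (z.2 : V)).
  apply: measurable_rV => k; under eq_fun do rewrite mxE.
  apply: measurable_funM.
    exact: (measurableT_comp msqrt measurable_fst).
  exact: (measurableT_comp (measurable_coord k) measurable_snd).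
have [m' m'E] := law_exists (product_law rho m) rX; exists m' => theta c.
rewrite m'E; last exact: bounded_measurable_cos.
rewrite Rintegral_product; last first.
  exact: (bounded_measurable_comp rX (bounded_measurable_cos theta c)).
rewrite -RintegralZr//; last first.
  apply: bounded_measurable_integrable; split.
    apply: measurableT_comp => //; apply: measurable_funN; apply: measurable_funM => //.
    exact: measurable_funX.
  exists 1 => v; rewrite ger0_norm ?expR_ge0// -[leRHS]expR0 ler_expR oppr_le0.
  by rewrite mulr_ge0 ?sqr_ge0.
apply: eq_Rintegral => v _; rewrite -qZ -mE; apply: eq_Rintegral => x _.
by rewrite dotZr dotZl.
Qed.

(** A covariance form is a sum of squares, so the law is that of a sum of
    independent one-dimensional Gaussians along fixed vectors. *)
Lemma symmetric_char_gaussian (C : 'M[R]_n) : covariance_matrix C ->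
  symmetric_char (fun theta => expR (- (2^-1 * sqnorm_mx C theta))).
Proof.
move=> /covariance_sum_squares[vs vsE].
apply: symmetric_char_ext (symmetric_char_prod vs symmetric_char_normal) => theta.
by rewrite vsE -expR_sum sumrN big_distrr.
Qed.

(** For A >= 0 and B = b^-2, Frullani's integral gives the
    integral of e^(- v A) (e^-v - e^(- B v)) / v as ln ((B + A) / (1 + A)). Its value
    kappa = ln B at A = 0 normalises the density, and
    ln ((1 + b^2 q) / (1 + q)) = kappa (E e^(- v q) - 1). *)
Lemma symmetric_char_gamma_ratio (C : 'M[R]_n) (b c : R) : covariance_matrix C ->
  0 < b -> b < 1 -> 0 <= c ->
  let q theta := 2^-1 * sqnorm_mx C theta in
  symmetric_char (fun theta => expR (c * (ln (1 + b ^+ 2 * q theta) - ln (1 + q theta)))).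
Proof.
move=> covC b0 b1 c0 q.
have q0 theta : 0 <= q theta by rewrite mulr_ge0 ?invr_ge0//; case: covC => _; apply.
have qZ s theta : q (s *: theta) = s ^+ 2 * q theta by rewrite /q sqnorm_mx_scale; ring.
have bb0 : 0 < b ^+ 2 by rewrite exprn_gt0.
have bb1 : b ^+ 2 < 1 by rewrite exprn_ilt1// ltW.
pose B := (b ^+ 2)^-1; have B1 : 1 < B by rewrite invf_gt1.
have B0 : 0 < B by rewrite invr_gt0.
pose kappa := ln B; have kappa0 : 0 < kappa by rewrite ln_gt0.
pose h : measurableTypeR R -> R := (fun v : R => (expR (- (1 * v)) - expR (- (B * v))) / v / kappa) \_ `]0, +oo[.
have hE (v : R) : 0 < v -> h v = (expR (- (1 * v)) - expR (- (B * v))) / v / kappa.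
  by move=> v0; rewrite /h patchE mem_set//= in_itv/= v0.
have h0 v : 0 <= h v.
  rewrite /h patchE; case: ifPn => //; rewrite inE/= in_itv/= andbT => v0.
  apply: divr_ge0; last exact: ltW.
  apply: divr_ge0; last exact: ltW.
  rewrite subr_ge0 ler_expR lerN2; apply: ler_wpM2r; exact: ltW.
have mh : measurable_fun setT h.
  apply/measurable_restrict => //; rewrite setTI.
  apply: measurable_funM => //; apply: measurable_funM.
    by apply: measurable_funTS; apply: measurable_funB;
      apply: continuous_measurable_fun; exact: continuous_expR_neg.
  apply: open_continuous_measurable_fun; first exact: interval_open.
  move=> r; rewrite inE/= in_itv/= andbT => r0; apply: inv_continuous.
  by rewrite gt_eqF.
have inth A : 0 <= A -> (\int[mu]_v (expR (- (Num.sqrt v ^+ 2 * A)) * h v)%:E =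
    (ln ((B + A) / (1 + A)) / kappa)%:E)%E.
  move=> A0.
  have A1 : 0 < 1 + A by rewrite ltr_wpDr.
  have A2 : 1 + A <= B + A by rewrite lerD2r ltW.
  rewrite EFinM -(frullani A1 A2) -ge0_integralZr//; last 3 first.
  - apply/measurable_EFinP; apply: measurable_funM.
      by apply: measurable_funTS; apply: measurable_funB;
        apply: continuous_measurable_fun; exact: continuous_expR_neg.
    apply: open_continuous_measurable_fun; first exact: interval_open.
    move=> r; rewrite inE/= in_itv/= andbT => r0; apply: inv_continuous.
    by rewrite gt_eqF.
  - move=> v; rewrite /= in_itv/= andbT => v0; rewrite lee_fin.
    apply: divr_ge0; last exact: ltW.
    by rewrite subr_ge0 ler_expR lerN2; apply: ler_wpM2r => //; exact: ltW.
  - by rewrite lee_fin invr_ge0 ltW.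
  rewrite [RHS]integral_mkcond; apply: eq_integral => v _.
  rewrite patchE; case: ifPn => [|v0]; last by rewrite /h patchE (negPf v0) mulr0.
  rewrite inE/= in_itv/= andbT => v0; rewrite hE// -EFinM; congr EFin.
  rewrite sqr_sqrtr ?ltW// mul1r.
  have -> : expR (- ((1 + A) * v)) = expR (- (v * A)) * expR (- v).
    by rewrite -expRD; congr expR; ring.
  have -> : expR (- ((B + A) * v)) = expR (- (v * A)) * expR (- (B * v)).
    by rewrite -expRD; congr expR; ring.
  ring.
have int1 : (\int[mu]_v (h v)%:E = 1)%E.
  transitivity (\int[mu]_v (expR (- (Num.sqrt v ^+ 2 * 0)) * h v)%:E)%E.
    by apply: eq_integral => v _; rewrite mulr0 oppr0 expR0 mul1r.
  by rewrite inth// !addr0 divr1 divff// gt_eqF.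
have [rho rhoE] := probability_density mh h0 (normal_prob 0 1) int1.
have ck : 0 <= c * kappa by rewrite mulr_ge0// ltW.
have := symmetric_char_poisson ck
  (symmetric_char_scale_mixture rho qZ q0 (symmetric_char_gaussian covC)).
apply: symmetric_char_ext => theta; congr expR.
rewrite rhoE; last first.
  split.
    apply: measurableT_comp => //; apply: measurable_funN; apply: measurable_funM => //.
    by apply: measurable_funX; apply: continuous_measurable_fun; exact: sqrt_continuous.
  exists 1 => v; rewrite ger0_norm ?expR_ge0// -[leRHS]expR0 ler_expR oppr_le0.
  by rewrite mulr_ge0 ?sqr_ge0.
rewrite /Rintegral inth//= -mulrA; congr (_ * _).
rewrite mulrBr mulr1 mulrCA divff ?gt_eqF// mulr1 /kappa.
have Q0 := q0 theta.
have Q1 : 0 < 1 + q theta by rewrite ltr_wpDr.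
have Q2 : 0 < 1 + b ^+ 2 * q theta by rewrite ltr_wpDr// mulr_ge0// sqr_ge0.
have -> : (B + q theta) / (1 + q theta) = B * ((1 + b ^+ 2 * q theta) / (1 + q theta)).
  by rewrite /B; field; rewrite !gt_eqF.
by rewrite lnM ?posrE ?divr_gt0// ln_div ?posrE//; ring.
Qed.
End symmetric_char.

(** * Self-decomposability without drift *)

Section self_decomposable_criterion.
Context {R : realType} {n : nat}.
Notation V := 'rV[R]_n.
Context {d : measure_display} {T : measurableType d}.
Variables (P : probability T R) (X : T -> V) (phi : V -> R).
Hypotheses (rX : random_element X)
  (XE : forall theta c, \int[P]_w cos (dot theta (X w) + c) = phi theta * cos c).

(** X' and Z are the two coordinates of a product space. *)
Lemma self_decomposable_symmetric_char :
  (forall b, 0 < b -> b < 1 -> exists2 psi, symmetric_char psi &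
    forall theta, phi theta = phi (b *: theta) * psi theta) ->
  self_decomposable P X.
Proof.
move=> fact b b0 b1; have [psi [m mE] phiE] := fact b b0 b1.
pose P' := product_law P m.
have r1 : random_element (fun z : T * borel V => X z.1).
  exact: (measurableT_comp rX measurable_fst).
have r2 : random_element (fun z : T * borel V => (z.2 : V)).
  exact: measurable_snd.
have r3 : random_element (fun z : T * borel V => b *: X z.1 + (z.2 : V)).
  apply: measurable_rV => k; under eq_fun do rewrite !mxE.
  apply: measurable_funD; last exact: (measurable_rV_coord k r2).
  by apply: measurable_funM => //; exact: (measurable_rV_coord k r1).
have pX A : measurable (A : set (borel V)) -> measurable (X @^-1` A).
  by move=> mA; rewrite -[X in measurable X]setTI; exact: rX.
have rect (A B : set (borel V)) : measurable A -> measurable B ->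
    P' ((fun z => X z.1) @^-1` A `&` (fun z => z.2) @^-1` B) = (P (X @^-1` A) * m B)%E.
  move=> mA mB; rewrite -(product_measure1E P m (pX _ mA) mB); congr (P' _).
have fst_law A : measurable (A : set (borel V)) ->
    P' ((fun z => X z.1) @^-1` A) = P (X @^-1` A).
  move=> mA; have := rect A setT mA measurableT.
  by rewrite preimage_setT setIT probability_setT mule1.
have snd_law B : measurable (B : set (borel V)) -> P' ((fun z => z.2) @^-1` B) = m B.
  move=> mB; have := rect setT B measurableT mB.
  by rewrite !preimage_setT setTI probability_setT mul1e.
exists _, _, P', (fun z => X z.1), (fun z => z.2); split => //.
- by move=> A mA; rewrite fst_law.
- by move=> A B mA mB; rewrite rect// fst_law// snd_law.
move=> A mA.
pose L1 (f : borel V -> R) := \int[P]_(w in setT) (f (X w) * 1).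
pose L2 (f : borel V -> R) := \int[P']_(z in setT) (f (b *: X z.1 + z.2) * 1).
have iL1 : integral_like L1.
  by apply: integral_like_Rintegral => //; exact: finite_measure_integrable_cst.
have iL2 : integral_like L2.
  by apply: integral_like_Rintegral => //; exact: finite_measure_integrable_cst.
have L12 (theta : V) (c : R) :
    L1 (fun x => cos (dot theta x + c)) = L2 (fun x => cos (dot theta x + c)).
  rewrite /L1 /L2; under eq_Rintegral do rewrite mulr1.
  under [in RHS]eq_Rintegral do rewrite mulr1.
  rewrite XE Rintegral_product; last first.
    exact: (bounded_measurable_comp r3 (bounded_measurable_cos theta c)).
  transitivity (\int[P]_w (psi theta * cos (dot (b *: theta) (X w) + c))).
    rewrite RintegralZl//; first by rewrite XE phiE; ring.
    apply: bounded_measurable_integrable.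
    exact: (bounded_measurable_comp rX (bounded_measurable_cos _ c)).
  apply: eq_Rintegral => w _; rewrite -mE; apply: eq_Rintegral => y _.
  by rewrite dotDr dotZr dotZl; congr cos; ring.
have E := char_fun_determined iL1 iL2 L12 (bounded_measurable_indic mA).
have m1 : measurable (X @^-1` A) by exact: pX.
have m2 : measurable ((fun z : T * borel V => b *: X z.1 + (z.2 : V)) @^-1` A).
  by rewrite -[X in measurable X]setTI; exact: r3.
have F1 : fine (P (X @^-1` A)) = L1 \1_A.
  by rewrite -Rintegral_indic//; apply: eq_Rintegral => w _; rewrite mulr1 !indicE.
have F2 : fine (P' ((fun z : T * borel V => b *: X z.1 + (z.2 : V)) @^-1` A)) = L2 \1_A.
  by rewrite -Rintegral_indic//; apply: eq_Rintegral => w _; rewrite mulr1 !indicE.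
rewrite -[LHS]fineK ?fin_num_measure// -[RHS]fineK ?fin_num_measure//.
by congr EFin; rewrite F1 E -F2.
Qed.
End self_decomposable_criterion.

Section driftless.
Context {R : realType} {n : nat}.
Notation V := 'rV[R]_n.
Notation mu := (@lebesgue_measure R).

Lemma cexp_imaginary (x : R) : cexp ('i * x%:C)%C = (cos x +i* sin x)%C.
Proof. by rewrite /cexp /= !(mul0r, mulr0, mul1r, subr0, sub0r, add0r, addr0, oppr0) expR0 !mul1r. Qed.

Lemma char_funE {d : measure_display} {T : measurableType d} (P : probability T R)
    (X : T -> V) (theta : V) : char_fun P X theta =
  ((\int[P]_w cos (dot theta (X w))) +i* (\int[P]_w sin (dot theta (X w))))%C.
Proof.
by rewrite /char_fun /cintegral; congr (_ +i* _)%C;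
  apply: eq_Rintegral => w _; rewrite cexp_imaginary.
Qed.

Lemma bounded_measurable_cos_comp {d : measure_display} {T : measurableType d}
    (X : T -> V) (theta : V) c : random_element X ->
  bounded_measurable (fun w => cos (dot theta (X w) + c)).
Proof. by move=> rX; exact: (bounded_measurable_comp rX (bounded_measurable_cos theta c)). Qed.

Lemma bounded_measurable_sin_comp {d : measure_display} {T : measurableType d}
    (X : T -> V) (theta : V) : random_element X ->
  bounded_measurable (fun w => sin (dot theta (X w))).
Proof.
move=> rX; under eq_fun do rewrite -cosBpihalf; exact: bounded_measurable_cos_comp.
Qed.

Lemma Rintegral_cos_phase {d : measure_display} {T : measurableType d}
    (P : probability T R) (X : T -> V) (theta : V) c : random_element X ->
  \int[P]_w cos (dot theta (X w) + c) =
  (\int[P]_w cos (dot theta (X w))) * cos c - (\int[P]_w sin (dot theta (X w))) * sin c.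
Proof.
move=> rX.
have bc : bounded_measurable (fun w => cos (dot theta (X w))).
  have := bounded_measurable_cos_comp theta 0 rX.
  by under eq_fun do rewrite addr0.
have bs := bounded_measurable_sin_comp theta rX.
have ic := @bounded_measurable_integrable _ _ _ P _ bc.
have isn := @bounded_measurable_integrable _ _ _ P _ bs.
rewrite -!RintegralZr// -RintegralB//.
- by apply: eq_Rintegral => w _; rewrite cosD.
- apply: bounded_measurable_integrable; apply: bounded_measurableM => //.
  exact: bounded_measurable_cst.
- apply: bounded_measurable_integrable; apply: bounded_measurableM => //.
  exact: bounded_measurable_cst.
Qed.

Lemma ray_im0 (q : R) : ray_im q 0 = 0.
Proof.
rewrite /ray_im /Rintegral integral0_eq// => r _.
by rewrite mulr0 sin0 mulr0 mul0r.
Qed.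

Lemma ray_re0 (q : R) : 0 <= q -> ray_re q 0 = - ln (1 + q).
Proof.
move=> q0; have q1 : 1 <= 1 + q by rewrite lerDl.
have fr := frullani ltr01 q1; rewrite divr1 in fr.
rewrite -[RHS]mulN1r -[ln _]/(fine (ln (1 + q))%:E) -fr -[fine _]/(Rintegral _ _ _).
rewrite /ray_re -RintegralZl//; last exact: integrable_frullani.
apply: eq_Rintegral => r; rewrite inE/= in_itv/= andbT => r0.
rewrite mulr0 cos0 mulr1 mul1r.
have -> : expR (- ((1 + q) * r)) = expR (- (r * q)) * expR (- r).
  by rewrite -expRD; congr expR; ring.
ring.
Qed.

Lemma WVAG_driftless_self_decomposable {d : measure_display} {T : measurableType d}
    (P : probability T R) (X : R -> T -> V) (a : R) (alpha : V) (Sigma : 'M[R]_n) :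
  (0 < n)%N -> 0 < a -> (forall k, 0 < alpha 0 k) ->
  (forall k, a * alpha 0 k < 1) -> covariance_matrix Sigma ->
  WVAG P X a alpha 0 Sigma -> self_decomposable_process P X.
Proof.
move=> n0 a0 alpha0 a1 covS [d' [T' [P' [S [nu [SAG Snu [levX XE]]]]]]].
have rX : random_element (X 1) by case: levX => + _ _ _ _ _; apply.
pose q j theta := ray_quadratic alpha Sigma j theta.
pose c j := ray_weight a alpha j.
have c0 j : 0 <= c j by exact: ray_weight_ge0.
have q0 j theta : 0 <= q j theta by exact: ray_quadratic_ge0.
pose phi theta := expR (- \sum_j c j * ln (1 + q j theta)).
have drift0 j theta : ray_drift alpha 0 j theta = 0.
  by rewrite /ray_drift dotE big1// => k _; rewrite !mxE !mulr0.
have charE theta : char_fun P (X 1) theta = (phi theta +i* 0)%C.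
  rewrite XE// (weak_exponentE n0 alpha0 SAG Snu 0 covS).
  under eq_bigr do rewrite drift0 ray_re0//.
  under [X in (_ +i* X)%C]eq_bigr do rewrite drift0 ray_im0 mulr0.
  rewrite [X in (_ +i* X)%C]big1// [1%:C%C](_ : _ = 1)// mul1r /cexp /=.
  rewrite cos0 sin0 mulr1 mulr0.
  rewrite /phi; congr (expR _ +i* _)%C.
  by rewrite -sumrN; apply: eq_bigr => j _; rewrite mulrN.
have phase theta t : \int[P]_w cos (dot theta (X 1 w) + t) = phi theta * cos t.
  rewrite Rintegral_cos_phase//; have := charE theta; rewrite char_funE => -[-> ->].
  by rewrite mul0r subr0.
apply: (self_decomposable_symmetric_char rX phase) => b b0 b1.
have covj j : covariance_matrix (diamond_mx (ray_direction alpha j) Sigma).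
  by apply: covariance_diamond => // k; exact: ray_direction_ge0.
exists (fun theta => \prod_j expR (c j * (ln (1 + b ^+ 2 * q j theta) - ln (1 + q j theta)))).
  apply: symmetric_char_prod => j.
  exact: (symmetric_char_gamma_ratio (covj j) b0 b1 (c0 j)).
move=> theta; rewrite -expR_sum /phi -expRD; congr expR.
rewrite -!sumrN -big_split; apply: eq_bigr => j _ /=.
have -> : q j (b *: theta) = b ^+ 2 * q j theta.
  by rewrite /q /ray_quadratic sqnorm_mx_scale; ring.
ring.
Qed.
End driftless.

(** * Differences and averages in the plane *)

Section difference_operators.
Context {R : realType}.
Implicit Types (G H : R -> R -> R) (L x y : R) (M : nat).

Definition swap G x y := G y x.
Definition diff1 L G x y := 2 * G x y - G (x + L) y - G (x - L) y.
Definition diff2 L G := swap (diff1 L (swap G)).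
Definition fejer1 M G x y := \sum_(k < M) \sum_(l < M) G (x + (k%:R - l%:R)) y.
Definition fejer2 M G := swap (fejer1 M (swap G)).
(** The opposite of a second difference of step L in each variable, applied to
    Fejer sums of G over a square of side M. Each of the four factors multiplies
    a plane wave by a nonnegative number. *)
Definition probe L M G := diff1 L (diff2 L (fejer1 M (fejer2 M G))).

Let blur M G := fejer1 M (fejer2 M G).

Let blurE M G x y : blur M G x y = \sum_(k < M) \sum_(l < M)
  \sum_(k' < M) \sum_(l' < M) G (x + (k%:R - l%:R)) (y + (k'%:R - l'%:R)).
Proof. by []. Qed.

Let diff12E L (F : R -> R -> R) x y : diff1 L (diff2 L F) x y =
  4 * F x y - 2 * F x (y + L) - 2 * F x (y - L) - 2 * F (x + L) y - 2 * F (x - L) y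
  + F (x + L) (y + L) + F (x + L) (y - L) + F (x - L) (y + L) + F (x - L) (y - L).
Proof. rewrite /diff2 /swap /diff1; ring. Qed.

Let probeE L M G x y : probe L M G x y =
  4 * blur M G x y - 2 * blur M G x (y + L) - 2 * blur M G x (y - L)
  - 2 * blur M G (x + L) y - 2 * blur M G (x - L) y
  + blur M G (x + L) (y + L) + blur M G (x + L) (y - L)
  + blur M G (x - L) (y + L) + blur M G (x - L) (y - L).
Proof. exact: diff12E. Qed.

Let ord_dist M (k l : 'I_M) : `|k%:R - l%:R : R| <= M%:R.
Proof.
have k0 : 0 <= k%:R :> R by []. have l0 : 0 <= l%:R :> R by [].
have kM : k%:R <= M%:R :> R by rewrite ler_nat ltnW.
have lM : l%:R <= M%:R :> R by rewrite ler_nat ltnW.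
by rewrite ler_norml; apply/andP; split; lra.
Qed.

Let sum4_cst M (c : R) : \sum_(k < M) \sum_(l < M) \sum_(k' < M) \sum_(l' < M) c = M%:R ^+ 4 * c.
Proof. by rewrite !sumr_const !card_ord -!mulrnA -[LHS]mulr_natl !natrM; ring. Qed.

Let blur_ub M G x y b : (forall u v, `|u| <= M%:R -> `|v| <= M%:R -> G (x + u) (y + v) <= b) ->
  blur M G x y <= M%:R ^+ 4 * b.
Proof.
move=> h; rewrite blurE -sum4_cst.
by do 4 (apply: ler_sum => ? _); apply: h; exact: ord_dist.
Qed.

Let blur_lb M G x y b : (forall u v, `|u| <= M%:R -> `|v| <= M%:R -> b <= G (x + u) (y + v)) ->
  M%:R ^+ 4 * b <= blur M G x y.
Proof.
move=> h; rewrite blurE -sum4_cst.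
by do 4 (apply: ler_sum => ? _); apply: h; exact: ord_dist.
Qed.

Definition harmonic_sum M : R := \sum_(k < M) k.+1%:R^-1.

Lemma harmonic_sum_le M M' : (M <= M')%N -> harmonic_sum M <= harmonic_sum M'.
Proof.
move=> /subnK <-; elim: (M' - M)%N => [|p IH]; first by rewrite add0n.
by rewrite addSn (le_trans IH)// /harmonic_sum big_ord_recr/= lerDl.
Qed.

(** Dyadic blocks: the terms between 2 ^ m and 2 ^ m.+1 add up to at most 1. *)
Lemma harmonic_sum_pow2 m : harmonic_sum (2 ^ m) <= m.+1%:R.
Proof.
elim: m => [|m IH]; first by rewrite /harmonic_sum expn0 big_ord1 invr1.
rewrite expnS mul2n -addnn /harmonic_sum big_split_ord /= -natr1 lerD//.
apply: (@le_trans _ _ (\sum_(k < 2 ^ m) (2 ^ m)%:R^-1)).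
  apply: ler_sum => k _; rewrite lef_pV2 ?posrE ?ltr0n ?expn_gt0// ler_nat.
  by rewrite -addnS leq_addr.
by rewrite sumr_const card_ord -[leLHS]mulr_natl divff// pnatr_eq0 -lt0n expn_gt0.
Qed.

Let dist_sum M := \sum_(k < M) \sum_(l < M) (1 + `|k%:R - l%:R : R|)^-1.

Let dist_sum_le M : dist_sum M <= 2 * M%:R * harmonic_sum M.
Proof.
elim: M => [|M IH]; first by rewrite /dist_sum big_ord0 mulr0 mul0r.
have last_row : \sum_(k < M) (1 + `|k%:R - M%:R : R|)^-1 <= harmonic_sum M.+1 - 1.
  rewrite /harmonic_sum big_ord_recl invr1 [X in X - _]addrC addrK.
  rewrite [leRHS](reindex_inj rev_ord_inj) /=; apply: ler_sum => k _.
  rewrite le_eqVlt; apply/orP; left; apply/eqP; congr _^-1.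
  rewrite distrC ger0_norm ?subr_ge0 ?ler_nat 1?ltnW// -natrB 1?ltnW//.
  by rewrite -natr1 addrC /bump /= add1n subnSK.
rewrite /dist_sum big_ord_recr /=.
under eq_bigr do rewrite big_ord_recr /=.
rewrite big_split /= -/(dist_sum M) big_ord_recr /= subrr normr0 addr0 invr1.
have sym : \sum_(l < M) (1 + `|M%:R - l%:R : R|)^-1 = \sum_(k < M) (1 + `|k%:R - M%:R : R|)^-1.
  by apply: eq_bigr => l _; rewrite distrC.
rewrite sym -natr1.
have hM := harmonic_sum_le (leqnSn M).
have M0 : 0 <= M%:R :> R by [].
have := ler_wpM2l (mulr_ge0 (ler0n R 2) M0) hM.
lra.
Qed.

(** At integer points the decay 1 / (1 + u^2 + v^2) is at most
    2 / ((1 + |u|) (1 + |v|)), whose sum is the square of a one-dimensional sum that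
    grows like M ln M. *)
Let blur_center (Cr : R) m G : 0 <= Cr ->
  (forall x y, G x y <= Cr / (1 + x ^+ 2 + y ^+ 2)) ->
  blur (2 ^ m) G 0 0 <= 8 * Cr * (2 ^ m)%:R ^+ 2 * m.+1%:R ^+ 2.
Proof.
move=> Cr0 GC; set M := (2 ^ m)%N.
apply: (@le_trans _ _ (2 * Cr * dist_sum M ^+ 2)).
  rewrite blurE expr2 /dist_sum big_distrl big_distrr; apply: ler_sum => k _ /=.
  rewrite big_distrl big_distrr; apply: ler_sum => l _ /=.
  rewrite !big_distrr; apply: ler_sum => k' _ /=.
  rewrite !big_distrr; apply: ler_sum => l' _ /=.
  rewrite !add0r; apply: le_trans (GC _ _) _.
  have sq (i j : 'I_M) : `|i%:R - j%:R : R| <= (i%:R - j%:R) ^+ 2.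
    rewrite -real_normK ?num_real//.
    have [->|ij] := eqVneq i j; first by rewrite subrr normr0 expr0n.
    suff : 1 <= `|i%:R - j%:R : R| by rewrite expr2; nra.
    wlog ij' : i j {ij} / (i < j)%N.
      move=> h; move: ij; rewrite neq_ltn => /orP[/h//|/h]; by rewrite distrC.
    by rewrite distrC ger0_norm ?subr_ge0 ?ler_nat 1?ltnW// lerBrDr nat1r ler_nat.
  have key (u v : R) : `|u| <= u ^+ 2 -> `|v| <= v ^+ 2 ->
      Cr / (1 + u ^+ 2 + v ^+ 2) <= 2 * Cr * ((1 + `|u|)^-1 * (1 + `|v|)^-1).
    move=> hu hv; have u0 := normr_ge0 u; have v0 := normr_ge0 v.
    have u2 : u ^+ 2 = `|u| ^+ 2 by rewrite real_normK ?num_real.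
    have v2 : v ^+ 2 = `|v| ^+ 2 by rewrite real_normK ?num_real.
    rewrite -invfM (_ : 2 * Cr * _ = Cr * (2 / ((1 + `|u|) * (1 + `|v|)))); last by ring.
    apply: ler_wpM2l => //.
    rewrite ler_pdivlMr; last by apply: mulr_gt0; apply: ltr_wpDr.
    rewrite mulrC ler_pdivrMr; last by rewrite -addrA ltr_wpDr// addr_ge0 ?sqr_ge0.
    have : 0 <= (`|u| - `|v|) ^+ 2 by exact: sqr_ge0.
    by rewrite u2 v2 in hu hv *; rewrite !expr2 in hu hv *; nra.
  apply: le_trans (key _ _ (sq k l) (sq k' l')) _.
  by rewrite le_eqVlt; apply/orP; left; apply/eqP; ring.
have d0 : 0 <= dist_sum M.
  by apply: sumr_ge0 => k _; apply: sumr_ge0 => l _; rewrite invr_ge0 addr_ge0.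
have dle : dist_sum M <= 2 * M%:R * m.+1%:R.
  apply: le_trans (dist_sum_le M) _; apply: ler_wpM2l; first by rewrite mulr_ge0.
  exact: harmonic_sum_pow2.
have -> : 8 * Cr * M%:R ^+ 2 * m.+1%:R ^+ 2 = 2 * Cr * (2 * M%:R * m.+1%:R) ^+ 2 by ring.
apply: ler_wpM2l; first by rewrite mulr_ge0.
by rewrite ler_sqr ?nnegrE// (le_trans d0).
Qed.

Let cube_le_pow8 p : (p.+1 ^ 3 <= 2 ^ (3 * p))%N.
Proof.
elim: p => // p IH; rewrite mulnS expnD (leq_trans _ (leq_mul (leqnn 8) IH))//.
by rewrite -[8%N]/(2 ^ 3)%N -expnMn leq_exp2r// mulSn mul1n addSn ltnS addnS ltnS leq_addr.
Qed.

(** At the point (L + tau L, L) one of the nine translates of the square of side M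
    sits at (tau L, 0), inside the cone and close to the origin when tau is
    small; there IG is at least of order 1 / (tau L). The eight others lie at distance L or more,
    where |IG| <= 2 Ci / L, and cannot compensate it. At the origin the average of
    RG is of order M^2 ln(M)^2 and the corners contribute M^4 / L^2. *)
Lemma no_dominance (RG IG : R -> R -> R) (Cr Ci c1 r rho : R) :
  (forall x y, 0 <= RG x y) -> (forall x y, RG x y <= Cr / (1 + x ^+ 2 + y ^+ 2)) ->
  (forall x y, `|IG x y| * `|x| <= Ci) -> (forall x y, `|IG x y| * `|y| <= Ci) ->
  0 < c1 -> 0 < r -> 0 < rho ->
  (forall x y, r <= x -> `|y| <= rho * x -> c1 <= IG x y * x) ->
  ~ (forall L M x y, probe L M IG x y <= probe L M RG 0 0).
Proof.
move=> RG0 RGC IGx IGy c10 r0 rho0 cone dom.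
have Cr0 : 0 <= Cr.
  by have := le_trans (RG0 0 0) (RGC 0 0); rewrite expr0n /= !addr0 divr1.
have Ci0 : 0 <= Ci by have := IGx 0 0; rewrite normr0 mulr0.
(* With this tau the translate in the cone contributes 30 Ci + 1 over L, and the
eight others, with total coefficient 15, at most 30 Ci over L. *)
pose tau := c1 / (2 * (30 * Ci + 1)).
have D0 : 0 < 30 * Ci + 1 by rewrite ltr_wpDl// mulr_ge0.
have tau0 : 0 < tau by rewrite divr_gt0// mulr_gt0.
have tauE : c1 = (30 * Ci + 1) * (2 * tau).
  by rewrite /tau; field; exact: lt0r_neq0.
(* The bounds by tau keep the square of side M = eps L around (tau L, 0) inside
the cone. *)
pose eps := Num.min (2^-1) (Num.min (tau / 2) (rho * tau / 2)).
have eps0 : 0 < eps.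
  by rewrite !lt_min invr_gt0 ltr0n /=; apply/andP; split; apply: divr_gt0 => //; exact: mulr_gt0.
have e1 : eps <= 2^-1 by rewrite ge_min lexx.
have e2 : eps <= tau / 2 by rewrite !ge_min lexx orbT.
have e3 : eps <= rho * tau / 2 by rewrite !ge_min lexx !orbT.
(* The first term of K makes p + 1 exceed the constant in the final comparison,
the second puts the square beyond the radius r. *)
pose K := 9 * (48 * Cr) / eps + 2 * r * eps / tau.
have [p hp] : exists p, K < p.+1%:R.
  by exists (Num.truncn K); exact: truncnS_gt.
(* M = 8^p >= (p + 1)^3 dominates the square of the logarithm m + 1 <= 3 (p + 1). *)
pose m := (3 * p)%N; pose M := (2 ^ m)%N; pose L := M%:R / eps.
have K1 : 9 * (48 * Cr) < p.+1%:R * eps.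
  rewrite -ltr_pdivrMr//; apply: le_lt_trans hp; rewrite lerDl.
  by apply: divr_ge0; [apply: mulr_ge0; [apply: mulr_ge0 => //|]|]; exact: ltW.
have pM : p.+1%:R ^+ 3 <= M%:R :> R by rewrite -natrX ler_nat cube_le_pow8.
have p1 : 1 <= p.+1%:R :> R by rewrite ler1n.
have pM1 : p.+1%:R <= M%:R :> R.
  by apply: le_trans pM; rewrite ler_eXnr.
have M0 : 0 < M%:R :> R by apply: lt_le_trans pM1; apply: lt_le_trans p1.
have ML : M%:R = eps * L by rewrite /L mulrC divfK// lt0r_neq0.
have L0 : 0 < L by rewrite divr_gt0.
have Lr : r <= tau * L / 2.
  have K2 : 2 * r * eps / tau <= M%:R.
    apply: le_trans pM1; apply: le_trans (ltW hp); rewrite lerDr.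
    by apply: divr_ge0; [apply: mulr_ge0 => //; exact: mulr_ge0|exact: ltW].
  move: K2; rewrite ler_pdivrMr// ML.
  have -> : eps * L * tau = eps * (tau * L) by ring.
  have -> : 2 * r * eps = eps * (2 * r) by ring.
  by rewrite ler_pM2l// => ?; lra.
have ML2 : M%:R <= L / 2 by rewrite ML; nra.
have MtL : M%:R <= tau * L / 2 by rewrite ML; nra.
have far_norm (x u : R) : L <= `|x| -> `|u| <= M%:R -> L / 2 <= `|x + u|.
  by move=> hx hu; have := lerB_normD x u; lra.
pose b := 2 * Ci / L.
have bL : b * (L / 2) = Ci by rewrite /b; field; exact: lt0r_neq0.
have b0 : 0 <= b by apply: divr_ge0; [exact: mulr_ge0|exact: ltW].
have IGfar (x y u v : R) : L <= `|x| \/ L <= `|y| -> `|u| <= M%:R -> `|v| <= M%:R ->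
    `|IG (x + u) (y + v)| <= b.
  move=> h hu hv; have i0 := normr_ge0 (IG (x + u) (y + v)).
  have L20 : 0 < L / 2 by rewrite divr_gt0.
  rewrite -(ler_pM2r L20) bL.
  case: h => [/far_norm/(_ hu)|/far_norm/(_ hv)] h.
    by apply: le_trans (IGx (x + u) (y + v)); exact: ler_wpM2l.
  by apply: le_trans (IGy (x + u) (y + v)); exact: ler_wpM2l.
have far_ub (x y : R) : L <= `|x| \/ L <= `|y| -> blur M IG x y <= M%:R ^+ 4 * b.
  move=> h; apply: blur_ub => u v hu hv.
  exact: le_trans (ler_norm _) (IGfar _ _ _ _ h hu hv).
have far_lb (x y : R) : L <= `|x| \/ L <= `|y| -> - (M%:R ^+ 4 * b) <= blur M IG x y.
  move=> h; rewrite -mulrN; apply: blur_lb => u v hu hv.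
  by have := IGfar _ _ _ _ h hu hv; rewrite ler_norml => /andP[].
have near_lb : M%:R ^+ 4 * (c1 / (2 * (tau * L))) <= blur M IG (tau * L) 0.
  have tL0 : 0 < tau * L by rewrite mulr_gt0.
  apply: blur_lb => u v hu hv; rewrite add0r.
  move: hu; rewrite ler_norml => /andP[hu1 hu2].
  have x1 : tau * L / 2 <= tau * L + u by lra.
  have x2 : tau * L + u <= 2 * (tau * L) by lra.
  have x0 : 0 < tau * L + u by lra.
  have vx : `|v| <= rho * (tau * L + u).
    apply: le_trans hv _; rewrite ML.
    by apply: (@le_trans _ _ (rho * (tau * L / 2))); [nra|rewrite ler_pM2l].
  have := cone _ _ (le_trans Lr x1) vx; rewrite -ler_pdivrMr//; apply: le_trans.
  by rewrite ler_pM2l// lef_pV2 ?posrE// mulr_gt0.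
have absL : L <= `|L| by exact: ler_norm.
have lower : M%:R ^+ 4 / L <= probe L M IG (tau * L + L) L.
  rewrite probeE addrK subrr.
  have xx : L <= `|tau * L + L| by apply: le_trans (ler_norm _); rewrite lerDr mulr_ge0 ?ltW.
  have xxx : L <= `|tau * L + L + L|.
    by apply: le_trans (ler_norm _); rewrite lerDr; have := mulr_gt0 tau0 L0; lra.
  have yy : L <= `|L + L| by apply: le_trans (ler_norm _); rewrite lerDr ltW.
  have h1 := far_lb (tau * L + L) L (or_introl xx).
  have h2 := far_ub (tau * L + L) (L + L) (or_introl xx).
  have h3 := far_ub (tau * L + L) 0 (or_introl xx).
  have h4 := far_ub (tau * L + L + L) L (or_introl xxx).
  have h5 := far_ub (tau * L) L (or_intror absL).
  have h6 := far_lb (tau * L + L + L) (L + L) (or_introl xxx).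
  have h7 := far_lb (tau * L + L + L) 0 (or_introl xxx).
  have h8 := far_lb (tau * L) (L + L) (or_intror yy).
  have -> : M%:R ^+ 4 / L = M%:R ^+ 4 * (c1 / (2 * (tau * L))) - 15 * (M%:R ^+ 4 * b).
    by rewrite tauE /b; field; rewrite !lt0r_neq0.
  lra.
have upper : probe L M RG 0 0 <= M%:R ^+ 2 * (48 * Cr * m.+1%:R ^+ 2).
  rewrite probeE add0r sub0r.
  have pos x y : 0 <= blur M RG x y.
    by have := @blur_lb M RG x y 0 (fun u v _ _ => RG0 _ _); rewrite mulr0.
  have c := blur_center m Cr0 RGC; rewrite -/M in c.
  have corner x y : `|x| = L -> `|y| = L -> blur M RG x y <= M%:R ^+ 4 * (2 * Cr / L ^+ 2).
    move=> hx hy; apply: blur_ub => u v hu hv.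
    have x2 : (L / 2) ^+ 2 <= (x + u) ^+ 2.
      have Lx : L <= `|x| by rewrite hx.
      have L20 : 0 <= L / 2 by apply: divr_ge0 => //; exact: ltW.
      by rewrite -[leRHS]real_normK ?num_real// ler_sqr ?nnegrE//; exact: far_norm.
    have y2 : (L / 2) ^+ 2 <= (y + v) ^+ 2.
      have Ly : L <= `|y| by rewrite hy.
      have L20 : 0 <= L / 2 by apply: divr_ge0 => //; exact: ltW.
      by rewrite -[leRHS]real_normK ?num_real// ler_sqr ?nnegrE//; exact: far_norm.
    apply: le_trans (RGC _ _) _; rewrite [2 * Cr]mulrC -mulrA; apply: ler_wpM2l => //.
    have LL : 0 < L ^+ 2 by rewrite exprn_gt0.
    have -> : 2 / L ^+ 2 = (L ^+ 2 / 2)^-1 by rewrite invf_div.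
    rewrite lef_pV2 ?posrE ?divr_gt0//; last by rewrite -addrA ltr_wpDr// addr_ge0 ?sqr_ge0.
    have LE : (L / 2) ^+ 2 = L ^+ 2 / 4 by field.
    by rewrite LE in x2 y2; lra.
  have nL : `|- L| = L by rewrite normrN gtr0_norm.
  have pL : `|L| = L by rewrite gtr0_norm.
  have k1 := corner L L pL pL; have k2 := corner L (- L) pL nL.
  have k3 := corner (- L) L nL pL; have k4 := corner (- L) (- L) nL nL.
  have m1 : 1 <= m.+1%:R ^+ 2 :> R by rewrite exprn_ege1// ler1n.
  have kk : M%:R ^+ 4 * (2 * Cr / L ^+ 2) <= 2 * Cr * M%:R ^+ 2 * m.+1%:R ^+ 2.
    have -> : M%:R ^+ 4 * (2 * Cr / L ^+ 2) = 2 * Cr * M%:R ^+ 2 * eps ^+ 2.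
      by rewrite ML; field; exact: lt0r_neq0.
    apply: ler_wpM2l; first by rewrite !mulr_ge0// sqr_ge0.
    have e1' : eps <= 1 by lra.
    by apply: le_trans m1; rewrite expr2; apply: mulr_ile1 => //; exact: ltW.
  have h1 := pos 0 L; have h2 := pos 0 (- L); have h3 := pos L 0; have h4 := pos (- L) 0.
  have w0 : 0 <= Cr * M%:R ^+ 2 * m.+1%:R ^+ 2 by rewrite !mulr_ge0// sqr_ge0.
  have -> : M%:R ^+ 2 * (48 * Cr * m.+1%:R ^+ 2) = 48 * (Cr * M%:R ^+ 2 * m.+1%:R ^+ 2) by ring.
  have E1 : 8 * Cr * M%:R ^+ 2 * m.+1%:R ^+ 2 = 8 * (Cr * M%:R ^+ 2 * m.+1%:R ^+ 2) by ring.
  have E2 : 2 * Cr * M%:R ^+ 2 * m.+1%:R ^+ 2 = 2 * (Cr * M%:R ^+ 2 * m.+1%:R ^+ 2) by ring.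
  rewrite E1 in c; rewrite E2 in kk; lra.
have := le_trans lower (le_trans (dom L M (tau * L + L) L) upper).
have -> : M%:R ^+ 4 / L = M%:R ^+ 2 * (M%:R * eps).
  by rewrite /L; field; rewrite !lt0r_neq0.
rewrite ler_pM2l ?exprn_gt0//; apply/negP; rewrite -ltNge.
have m3 : m.+1%:R <= 3 * p.+1%:R :> R.
  by rewrite -natrM ler_nat /m mulnS; exact: (@leq_add 1 _ 3).
have m3' : m.+1%:R ^+ 2 <= 9 * p.+1%:R ^+ 2 :> R.
  have -> : 9 * p.+1%:R ^+ 2 = (3 * p.+1%:R) ^+ 2 :> R by ring.
  by rewrite ler_sqr ?nnegrE ?mulr_ge0.
apply: (@le_lt_trans _ _ (9 * (48 * Cr) * p.+1%:R ^+ 2)).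
  have := ler_wpM2l (mulr_ge0 (ler0n R 48) Cr0) m3'; lra.
apply: (@lt_le_trans _ _ (p.+1%:R * eps * p.+1%:R ^+ 2)).
  by rewrite ltr_pM2r// exprn_gt0// (lt_le_trans _ p1).
have -> : p.+1%:R * eps * p.+1%:R ^+ 2 = p.+1%:R ^+ 3 * eps by ring.
by rewrite ler_pM2r.
Qed.
End difference_operators.

(** * The radial derivative of a ray term *)

Section ray_derivative.
Context {R : realType}.
Notation mu := (@lebesgue_measure R).
Implicit Types (A b c q l r x y : R).
Let D : set R := `]0, +oo[%classic.

Lemma continuous_affine l c : continuous (fun x => x * l + c).
Proof. by move=> x; apply: (@cvgD _ R^o); [exact: mulrr_continuous|exact: cvg_cst]. Qed.

Lemma continuous_cos_affine l c : continuous (fun x => cos (x * l + c)).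
Proof.
move=> x; apply: continuous_comp; first exact: continuous_affine.
exact: continuous_cos.
Qed.

Let iexp : mu.-integrable D (EFin \o (fun r => expR (- r))).
Proof.
apply/integrableP; split.
  apply/measurable_EFinP; apply: measurable_funTS; apply: continuous_measurable_fun => x.
  by apply: continuous_comp; [exact: opp_continuous|exact: continuous_expR].
under eq_integral do rewrite /= ger0_norm ?expR_ge0// -[X in - X]mul1r.
by rewrite integral_expR_neg// ltry.
Qed.

Lemma integrable_expR_bound (f : R -> R) K : measurable_fun D f ->
  (forall r, 0 < r -> `|f r| <= K * expR (- r)) -> mu.-integrable D (EFin \o f).
Proof.
move=> mf fb; apply: (@le_integrable _ _ _ mu D _ _ (fun r => (K * expR (- r))%:E)).
- exact: measurable_itv.
- exact/measurable_EFinP.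
- move=> r; rewrite /D /= in_itv/= andbT => r0; rewrite lee_fin.
  exact: le_trans (fb r r0) (ler_norm _).
- by under eq_fun do rewrite EFinM; apply: integrableZl => //; exact: measurable_itv.
Qed.

(** The fundamental theorem of calculus is applied to the nonnegative function
    e^(- A r) (1 + cos (r l + c)). *)
Lemma laplace_cos A l c : 1 <= A ->
  \int[mu]_(r in D) (expR (- (A * r)) * cos (r * l + c)) =
  (A * cos c - l * sin c) / (A ^+ 2 + l ^+ 2).
Proof.
move=> A1; have A0 : 0 < A by exact: lt_le_trans A1.
have den : A ^+ 2 + l ^+ 2 != 0 by rewrite gt_eqF// ltr_wpDr ?sqr_ge0// exprn_gt0.
pose k := (A ^+ 2 + l ^+ 2)^-1.
(* The 1 makes the integrand nonnegative and is subtracted at the end. *)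
pose h r := expR (- (A * r)) * (1 + cos (r * l + c)).
pose F r := expR (- (A * r)) * (- A^-1 + k * (l * sin (r * l + c) - A * cos (r * l + c))).
have dF r : is_derive r 1 F (h r).
  rewrite /F; apply: is_derive_eq; rewrite /h /k /GRing.scale/=; field.
  by rewrite den lt0r_neq0.
have h0 r : 0 <= r -> 0 <= h r.
  by move=> _; rewrite mulr_ge0 ?expR_ge0//; have := cos_geN1 (r * l + c); lra.
have ch : continuous h.
  move=> x; rewrite /h; apply: cvgM; first exact: continuous_expR_neg.
  by apply: (@cvgD _ R^o); [exact: cvg_cst|exact: continuous_cos_affine].
have AV : 0 <= A^-1 by rewrite invr_ge0 ltW.
have Fy : F x @[x --> +oo%R] --> 0.
  apply: norm_cvg0.
  apply: (@squeeze_cvgr _ _ _ _ (fun=> 0) (fun x => expR (- (A * x)) * (A^-1 + `|k| * (`|l| + A)))).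
  - near=> x; rewrite normr_ge0/= /F normrM ger0_norm ?expR_ge0// ler_wpM2l ?expR_ge0//.
    rewrite (le_trans (ler_normD _ _))// normrN (ger0_norm AV) lerD2l normrM ler_wpM2l//.
    rewrite (le_trans (ler_normB _ _))// !normrM (ger0_norm (ltW A0)) lerD//.
      by rewrite ler_piMr// ler_norml sin_geN1 sin_le1.
    by apply: ler_piMr; [exact: ltW|rewrite ler_norml cos_geN1 cos_le1].
  - exact: cvg_cst.
  - rewrite -(mul0r (A^-1 + `|k| * (`|l| + A))); apply: cvgM; last exact: cvg_cst.
    exact: cvgy_expR_neg.
have Ih : \int[mu]_(r in D) h r = A^-1 - k * (l * sin c - A * cos c).
  rewrite /Rintegral (integral_FTCy h0 dF ch Fy) /= /F.
  by rewrite mulr0 mul0r oppr0 expR0 !add0r; ring.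
have eA r : 0 < r -> expR (- (A * r)) <= expR (- r) by move=> r0; rewrite ler_expR lerN2 ler_peMl// ltW.
have i1 : mu.-integrable D (EFin \o (fun r => expR (- (A * r)))).
  apply: (integrable_expR_bound (K := 1)).
    by apply: measurable_funTS; apply: continuous_measurable_fun; exact: continuous_expR_neg.
  by move=> r r0; rewrite ger0_norm ?expR_ge0// mul1r eA.
have i2 : mu.-integrable D (EFin \o (fun r => expR (- (A * r)) * cos (r * l + c))).
  apply: (integrable_expR_bound (K := 1)).
    apply: measurable_funTS; apply: continuous_measurable_fun => x.
    by apply: cvgM; [exact: continuous_expR_neg|exact: continuous_cos_affine].
  move=> r r0; rewrite normrM ger0_norm ?expR_ge0// mul1r; apply: le_trans (eA r r0).
  by rewrite ler_piMr ?expR_ge0// ler_norml cos_geN1 cos_le1.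
have : \int[mu]_(r in D) h r = A^-1 + \int[mu]_(r in D) (expR (- (A * r)) * cos (r * l + c)).
  rewrite /h; under eq_Rintegral do rewrite mulrDr mulr1.
  rewrite RintegralD//; last exact: measurable_itv.
  by congr (_ + _); rewrite /Rintegral integral_expR_neg.
rewrite Ih => /addrI E; rewrite -E /k; field; exact: den.
Unshelve. all: end_near. Qed.

(** The phases 0 and - pi / 2 give the real and the imaginary part of a ray
    term. *)
Definition ray_phase c q l := \int[mu]_(r in D)
  ((expR (- (r * q)) * cos (r * l + c) - cos c) * (expR (- r) / r)).

Lemma ray_phase_re q l : ray_re q l = ray_phase 0 q l.
Proof. by apply: eq_Rintegral => r _; rewrite addr0 cos0. Qed.

Lemma ray_phase_im q l : ray_im q l = ray_phase (- (pi / 2)) q l.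
Proof.
by apply: eq_Rintegral => r _; rewrite cosBpihalf cosN cos_pihalf subr0.
Qed.

Let phase_lip x y c : 0 <= x -> `|expR (- x) * cos (y + c) - cos c| <= x + 2 * `|y|.
Proof.
move=> x0.
have -> : expR (- x) * cos (y + c) - cos c =
    cos c * (expR (- x) * cos y - 1) - sin c * (expR (- x) * sin y).
  by rewrite cosD; ring.
rewrite (le_trans (ler_normB _ _))// !normrM.
have h1 := ler_norm_expcos y x0; have [_ h2] := ler_norm_expsin y x0.
have c1 : `|cos c| <= 1 by rewrite ler_norml cos_geN1 cos_le1.
have s1 : `|sin c| <= 1 by rewrite ler_norml sin_geN1 sin_le1.
rewrite normrM in h2.
rewrite (_ : x + 2 * `|y| = (x + `|y|) + `|y|); last by ring.
rewrite -[x + _]mul1r -[X in _ <= _ + X]mul1r.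
by apply: lerD; apply: ler_pM.
Qed.

(** Differentiation in b cancels the singular factor 1 / r, so that the
    derivative is a sum of two Laplace transforms of waves. *)
Lemma is_derive_ray_phase c q l : 0 <= q ->
  is_derive (1 : R) 1 (fun b => ray_phase c (b ^+ 2 * q) (b * l))
   ((- 2 * q * ((1 + q) * cos c - l * sin c) - l * ((1 + q) * sin c + l * cos c))
     / ((1 + q) ^+ 2 + l ^+ 2)).
Proof.
move=> q0; have A1 : 1 <= 1 + q by rewrite lerDl.
pose f b r := (expR (- (r * (b ^+ 2 * q))) * cos (r * (b * l) + c) - cos c) * (expR (- r) / r).
pose g b r := (- 2 * b * q * (expR (- (r * (b ^+ 2 * q))) * cos (r * (b * l) + c))
  - l * (expR (- (r * (b ^+ 2 * q))) * sin (r * (b * l) + c))) * expR (- r).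
have df b r : 0 < r -> is_derive b 1 (f ^~ r) (g b r).
  by move=> r0; rewrite /f; apply: is_derive_eq; rewrite /g /GRing.scale/=; field; exact: lt0r_neq0.
have D1 r : D r -> 0 < r by rewrite /D /= in_itv/= andbT.
have K0 : 0 <= 4 * q + 4 * `|l| by rewrite addr_ge0// mulr_ge0.
pose K := 4 * q + 4 * `|l|.
have mf b : measurable_fun D (f b).
  apply: measurable_funM.
    apply: measurable_funTS; apply: continuous_measurable_fun => r.
    apply: (@cvgB _ R^o); last exact: cvg_cst.
    apply: cvgM; last exact: continuous_cos_affine.
    apply: continuous_comp; last exact: continuous_expR.
    by apply: (@cvgN _ R^o); exact: mulrr_continuous.
  apply: measurable_funM.
    apply: measurable_funTS; apply: continuous_measurable_fun => r.
    by apply: continuous_comp; [exact: opp_continuous|exact: continuous_expR].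
  apply: open_continuous_measurable_fun; first exact: interval_open.
  move=> r; rewrite inE => /D1 r0; apply: inv_continuous.
  by rewrite gt_eqF.
have tI : `]0, 2[%classic (1 : R) by rewrite /= in_itv/= ltr01 ltr1n.
have bI b : `]0, 2[%classic b -> 0 < b /\ b < 2 by rewrite /= in_itv/= => /andP.
have fb b r : `]0, 2[%classic b -> 0 < r -> `|f b r| <= K * expR (- r).
  move=> /bI[b0 b2] r0; rewrite /f normrM.
  have w0 : 0 <= expR (- r) / r by rewrite divr_ge0 ?expR_ge0// ltW.
  have -> : K * expR (- r) = K * r * (expR (- r) / r) by field; exact: lt0r_neq0.
  rewrite (ger0_norm w0); apply: ler_wpM2r => //.
  apply: le_trans (phase_lip _ _ _) _.
    by rewrite mulr_ge0 ?(ltW r0)// mulr_ge0// sqr_ge0.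
  rewrite !normrM (gtr0_norm r0) (gtr0_norm b0).
  have b4 : b ^+ 2 <= 4 by rewrite expr2; nra.
  have h1 := ler_wpM2l (ltW r0) (ler_wpM2r q0 b4).
  have h2 := ler_wpM2l (ltW r0) (ler_wpM2r (normr_ge0 l) (ltW b2)).
  rewrite /K; lra.
have gb b r : `]0, 2[%classic b -> 0 < r -> `|g b r| <= K * expR (- r).
  move=> /bI[b0 b2] r0; rewrite /g normrM [X in _ * X]ger0_norm ?expR_ge0//.
  rewrite ler_wpM2r ?expR_ge0// (le_trans (ler_normB _ _))//.
  have e1 : expR (- (r * (b ^+ 2 * q))) <= 1.
    by rewrite -expR0 ler_expR oppr_le0 mulr_ge0 ?(ltW r0)// mulr_ge0// sqr_ge0.
  have unit (x : R) : `|x| <= 1 -> `|expR (- (r * (b ^+ 2 * q))) * x| <= 1.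
    by move=> x1; rewrite normrM ger0_norm ?expR_ge0// mulr_ile1// expR_ge0.
  have cb := unit _ (_ : `|cos (r * (b * l) + c)| <= 1).
  have sb := unit _ (_ : `|sin (r * (b * l) + c)| <= 1).
  rewrite /K; apply: lerD.
    rewrite normrM -[leRHS]mulr1; apply: ler_pM => //; last first.
      by apply: cb; rewrite ler_norml cos_geN1 cos_le1.
    rewrite -mulrA mulNr normrN !normrM (gtr0_norm b0) (ger0_norm q0) ger0_norm//.
    have := ler_wpM2r q0 (ltW b2); lra.
  rewrite normrM; apply: (@le_trans _ _ (`|l| * 1)); last by have := normr_ge0 l; lra.
  by apply: ler_wpM2l => //; apply: sb; rewrite ler_norml sin_geN1 sin_le1.
have mD : measurable (D : set (measurableTypeR R)) by exact: measurable_itv.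
have inf b : `]0, 2[%classic b -> mu.-integrable D (EFin \o f b).
  by move=> bJ; apply: integrable_expR_bound (mf b) _ => r r0; exact: fb.
have d1 b r : D r -> partial1of2 f b r = g b r.
  by move=> /D1 r0; rewrite partial1of2E; apply: derive_val; exact: df.
have iG : mu.-integrable D (EFin \o (fun r => K * expR (- r))).
  by rewrite /comp; under eq_fun do rewrite EFinM; exact: integrableZl.
have h := @cvg_differentiation_under_integral R _ (measurableTypeR R) mu f D mD
  1 0 2 tI inf _ (fun r => K * expR (- r)) _ iG _.
have {}h : h0^-1 *: ((\int[mu]_(r in D) f (h0 + 1) r) - \int[mu]_(r in D) f 1 r) @[h0 --> 0^'] -->
    \int[mu]_(r in D) partial1of2 f 1 r.
  apply: h.
  - by move=> b r _ /D1 r0; have [] := df b r r0.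
  - by move=> r; rewrite mulr_ge0 ?expR_ge0.
  - by move=> b r bJ Dr; rewrite d1//; apply: gb => //; exact: D1.
have J s : \int[mu]_(r in D) (expR (- ((1 + q) * r)) * cos (r * l + s)) =
    ((1 + q) * cos s - l * sin s) / ((1 + q) ^+ 2 + l ^+ 2) by exact: laplace_cos.
have int s : mu.-integrable D (EFin \o (fun r => expR (- ((1 + q) * r)) * cos (r * l + s))).
  apply: (integrable_expR_bound (K := 1)).
    apply: measurable_funTS; apply: continuous_measurable_fun => x.
    by apply: cvgM; [exact: continuous_expR_neg|exact: continuous_cos_affine].
  move=> r r0; rewrite normrM ger0_norm ?expR_ge0// mul1r.
  apply: (@le_trans _ _ (expR (- ((1 + q) * r)))).
    by rewrite ler_piMr ?expR_ge0// ler_norml cos_geN1 cos_le1.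
  by rewrite ler_expR lerN2 ler_peMl// ltW.
(* The sine is a cosine with phase c - pi / 2. *)
have gE : \int[mu]_(r in D) partial1of2 f 1 r =
    - 2 * q * (\int[mu]_(r in D) (expR (- ((1 + q) * r)) * cos (r * l + c)))
    - l * \int[mu]_(r in D) (expR (- ((1 + q) * r)) * cos (r * l + (c - pi / 2))).
  have iZ k s : mu.-integrable D (EFin \o (fun r => k * (expR (- ((1 + q) * r)) * cos (r * l + s)))).
    by rewrite /comp; under eq_fun do rewrite EFinM; apply: integrableZl => //; exact: int.
  have Z k s : k * (\int[mu]_(r in D) (expR (- ((1 + q) * r)) * cos (r * l + s))) =
      \int[mu]_(r in D) (k * (expR (- ((1 + q) * r)) * cos (r * l + s))).
    by rewrite RintegralZl//; exact: int.
  rewrite !Z -RintegralB; [|exact: mD|exact: iZ|exact: iZ].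
  apply: eq_Rintegral => r; rewrite inE => Dr; rewrite d1// /g addrA cosBpihalf.
  have -> : expR (- ((1 + q) * r)) = expR (- (r * (1 ^+ 2 * q))) * expR (- r).
    by rewrite -expRD; congr expR; ring.
  by rewrite [1 * l]mul1r; ring.
have -> : (- 2 * q * ((1 + q) * cos c - l * sin c) - l * ((1 + q) * sin c + l * cos c))
     / ((1 + q) ^+ 2 + l ^+ 2) = \int[mu]_(r in D) partial1of2 f 1 r.
  rewrite gE !J cosBpihalf.
  have -> : sin (c - pi / 2) = - cos c by rewrite sinB cos_pihalf sin_pihalf; ring.
  ring.
apply: DeriveDef.
  apply/cvg_ex; exists (\int[mu]_(r in D) partial1of2 f 1 r).
  by under eq_fun do rewrite scaler1.
rewrite /derive; apply/cvg_lim => //.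
by under eq_fun do rewrite scaler1.
Qed.
End ray_derivative.

(** * Domination of the imaginary part by the real part *)

Section probe_algebra.
Context {R : realType}.
Implicit Types (G : R -> R -> R) (L x y a : R) (M : nat).

(** Averages send functions of x alone to functions of x alone; the difference
    in y kills these, and the difference in x kills the functions of y. *)
Lemma probe_affine L M a G (h k : R -> R) x y :
  probe L M (fun x y => a * G x y + (h x + k y)) x y = a * probe L M G x y.
Proof.
have f2 : fejer2 M (fun x y => a * G x y + (h x + k y)) = fun x y =>
    a * fejer2 M G x y + ((\sum_(i < M) \sum_(j < M) h x) +
      \sum_(i < M) \sum_(j < M) k (y + (i%:R - j%:R))).
  apply/funext => u; apply/funext => v; rewrite /fejer2 /swap /fejer1.
  rewrite big_distrr -!big_split; apply: eq_bigr => i _ /=.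
  by rewrite big_distrr -!big_split; apply: eq_bigr.
have f1 (h' k' : R -> R) G' : fejer1 M (fun x y => a * G' x y + (h' x + k' y)) = fun x y =>
    a * fejer1 M G' x y + ((\sum_(i < M) \sum_(j < M) h' (x + (i%:R - j%:R))) +
      \sum_(i < M) \sum_(j < M) k' y).
  apply/funext => u; apply/funext => v; rewrite /fejer1.
  rewrite big_distrr -!big_split; apply: eq_bigr => i _ /=.
  by rewrite big_distrr -!big_split; apply: eq_bigr.
rewrite /probe f2.
rewrite (f1 (fun x => \sum_(i < M) \sum_(j < M) h x)
  (fun y => \sum_(i < M) \sum_(j < M) k (y + (i%:R - j%:R)))).
rewrite /diff2 /swap /diff1; ring.
Qed.

Lemma cvg_probe {I : Type} {F : set_system I} {FF : Filter F} L M (G_ : I -> R -> R -> R) G :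
  (forall x y, G_ i x y @[i --> F] --> G x y) ->
  forall x y, probe L M (G_ i) x y @[i --> F] --> probe L M G x y.
Proof.
move=> cG; rewrite /probe.
have d1 (H_ : I -> R -> R -> R) H : (forall x y, H_ i x y @[i --> F] --> H x y) ->
    forall x y, diff1 L (H_ i) x y @[i --> F] --> diff1 L H x y.
  move=> cH x y; apply: (@cvgB _ R^o); last exact: cH.
  by apply: (@cvgB _ R^o); last exact: cH; apply: cvgM; [exact: cvg_cst|exact: cH].
have f1 (H_ : I -> R -> R -> R) H : (forall x y, H_ i x y @[i --> F] --> H x y) ->
    forall x y, fejer1 M (H_ i) x y @[i --> F] --> fejer1 M H x y.
  move=> cH x y; apply: cvg_big => [|k _]; first exact: add_continuous.
  by apply: cvg_big => [|l _]; [exact: add_continuous|exact: cH].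
apply: (d1) => x y; rewrite /diff2 /swap.
move: y x; apply: (d1 (fun i x y => fejer1 M (fejer2 M (G_ i)) y x) (fun x y => fejer1 M (fejer2 M G) y x)).
move=> x y; move: y x; apply: (f1) => x y; move: y x; rewrite /fejer2 /swap.
by apply: (f1 (fun i x y => G_ i y x) (fun x y => G y x)) => x y; exact: cG.
Qed.
End probe_algebra.

Section positivity.
Context {R : realType} {d : measure_display} {T : measurableType d}.
Variable P : probability T R.
Implicit Types (U V f : T -> R) (L c x y u : R) (M : nat).

(** The phase c covers the real part (c = 0) and the imaginary part
    (c = - pi / 2) of E f e^(i (x U + y V)). *)
Definition wave U V f c x y := \int[P]_w (f w * cos (x * U w + y * V w + c)).

Let swap_wave U V f c : swap (wave U V f c) = wave V U f c.
Proof.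
apply/funext => x; apply/funext => y; rewrite /swap /wave.
by apply: eq_Rintegral => w _; rewrite [y * _ + _]addrC.
Qed.

Let bounded_cos U V c x y : measurable_fun setT U -> measurable_fun setT V ->
  bounded_measurable (fun w => cos (x * U w + y * V w + c)).
Proof.
move=> mU mV; split; last by exists 1 => w; rewrite ler_norml cos_geN1 cos_le1.
apply: (measurableT_comp (f := cos)).
  by apply: continuous_measurable_fun; exact: continuous_cos.
by apply: measurable_funD => //; apply: measurable_funD; exact: measurable_funM.
Qed.

Let iwave U V f c x y : measurable_fun setT U -> measurable_fun setT V -> bounded_measurable f ->
  P.-integrable setT (EFin \o (fun w => f w * cos (x * U w + y * V w + c))).
Proof.
move=> mU mV bf; apply: bounded_measurable_integrable.
by apply: bounded_measurableM => //; exact: bounded_cos.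
Qed.

Let Rintegral_sum_bounded (I : Type) (s : seq I) (g : I -> T -> R) :
  (forall i, bounded_measurable (g i)) ->
  bounded_measurable (fun w => \sum_(i <- s) g i w) /\
  \int[P]_w (\sum_(i <- s) g i w) = \sum_(i <- s) \int[P]_w g i w.
Proof.
move=> bg; elim: s => [|i s [bs IH]].
  split; first by under eq_fun do rewrite big_nil; exact: bounded_measurable_cst.
  by under eq_Rintegral do rewrite big_nil; rewrite big_nil /Rintegral integral0.
split.
  by under eq_fun do rewrite big_cons; exact: bounded_measurableD.
under eq_Rintegral do rewrite big_cons.
by rewrite RintegralD//; [rewrite IH big_cons|exact: bounded_measurable_integrable..].
Qed.

Definition fejer_kernel M u := \sum_(k < M) \sum_(l < M) cos ((k%:R - l%:R) * u).

Lemma fejer_kernel_ge0 M u : 0 <= fejer_kernel M u.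
Proof.
suff -> : fejer_kernel M u =
    (\sum_(k < M) cos (k%:R * u)) ^+ 2 + (\sum_(k < M) sin (k%:R * u)) ^+ 2.
  by rewrite addr_ge0 ?sqr_ge0.
rewrite /fejer_kernel !expr2 !big_distrl -big_split; apply: eq_bigr => k _ /=.
rewrite !big_distrr -big_split; apply: eq_bigr => l _ /=.
by rewrite mulrBl cosB.
Qed.

(** The sine part of the sum vanishes because it is antisymmetric in k and l. *)
Lemma fejer_cos M u c : \sum_(k < M) \sum_(l < M) cos ((k%:R - l%:R) * u + c) =
  fejer_kernel M u * cos c.
Proof.
have odd0 : \sum_(k < M) \sum_(l < M) sin ((k%:R - l%:R) * u) = 0.
  set s := LHS; suff : s = - s by lra.
  rewrite {1}/s exchange_big -sumrN; apply: eq_bigr => k _ /=.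
  by rewrite -sumrN; apply: eq_bigr => l _; rewrite -sinN -mulNr opprB.
transitivity (fejer_kernel M u * cos c - (\sum_(k < M) \sum_(l < M) sin ((k%:R - l%:R) * u)) * sin c).
  rewrite /fejer_kernel !big_distrl -sumrB; apply: eq_bigr => k _ /=.
  by rewrite !big_distrl -sumrB; apply: eq_bigr => l _; rewrite cosD.
by rewrite odd0 mul0r subr0.
Qed.

Lemma fejer1_wave U V f c M : measurable_fun setT U -> measurable_fun setT V ->
  bounded_measurable f ->
  fejer1 M (wave U V f c) = wave U V (fun w => f w * fejer_kernel M (U w)) c.
Proof.
move=> mU mV bf; apply/funext => x; apply/funext => y; rewrite /fejer1 /wave.
pose g k l w := f w * cos ((x + (k%:R - l%:R)) * U w + y * V w + c).
have bg k l : bounded_measurable (g k l).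
  by apply: bounded_measurableM => //; exact: bounded_cos.
transitivity (\int[P]_w (\sum_(k < M) \sum_(l < M) g (nat_of_ord k) (nat_of_ord l) w)).
  have bk (k : 'I_M) := Rintegral_sum_bounded (index_enum 'I_M) (fun l : 'I_M => bg k l).
  have [_ ->] := Rintegral_sum_bounded (index_enum 'I_M) (fun k => (bk k).1).
  by apply: eq_bigr => k _; have [_ ->] := bk k.
apply: eq_Rintegral => w _; rewrite -mulrA -fejer_cos !big_distrr; apply: eq_bigr => k _ /=.
rewrite !big_distrr; apply: eq_bigr => l _ /=; rewrite /g; congr (_ * cos _); ring.
Qed.

Lemma diff1_wave U V f c L : measurable_fun setT U -> measurable_fun setT V ->
  bounded_measurable f ->
  diff1 L (wave U V f c) = wave U V (fun w => f w * (2 - 2 * cos (L * U w))) c.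
Proof.
move=> mU mV bf; apply/funext => x; apply/funext => y; rewrite /diff1 /wave.
have i1 z := iwave c z y mU mV bf.
rewrite -RintegralZl// -!RintegralB//.
- apply: eq_Rintegral => w _.
  have -> : (x + L) * U w + y * V w + c = (x * U w + y * V w + c) + L * U w by ring.
  have -> : (x - L) * U w + y * V w + c = (x * U w + y * V w + c) - L * U w by ring.
  move: (x * U w + y * V w + c) => t.
  by rewrite cosD cosB; ring.
- apply: bounded_measurable_integrable; apply: bounded_measurableD.
    apply: (@bounded_measurableM _ _ _ (fun=> 2)); first exact: bounded_measurable_cst.
    by apply: bounded_measurableM => //; exact: bounded_cos.
  under eq_fun do rewrite -mulN1r.
  apply: (@bounded_measurableM _ _ _ (fun=> -1)); first exact: bounded_measurable_cst.
  by apply: bounded_measurableM => //; exact: bounded_cos.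
- apply: bounded_measurable_integrable.
  apply: (@bounded_measurableM _ _ _ (fun=> 2)); first exact: bounded_measurable_cst.
  by apply: bounded_measurableM => //; exact: bounded_cos.
Qed.

Let bounded_fejer U M : measurable_fun setT U ->
  bounded_measurable (fun w => fejer_kernel M (U w)).
Proof.
move=> mU; have bkl (k l : nat) : bounded_measurable (fun w => cos ((k%:R - l%:R) * U w)).
  have := bounded_cos 0 (k%:R - l%:R) 0 mU mU.
  by under eq_fun do rewrite mul0r !addr0.
have bk (k : 'I_M) := Rintegral_sum_bounded (index_enum 'I_M) (fun l : 'I_M => bkl k l).
by have [] := Rintegral_sum_bounded (index_enum 'I_M) (fun k => (bk k).1).
Qed.

Let bounded_diff U L : measurable_fun setT U ->
  bounded_measurable (fun w => 2 - 2 * cos (L * U w)).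
Proof.
move=> mU; apply: bounded_measurableD; first exact: bounded_measurable_cst.
under eq_fun do rewrite -mulNr.
apply: bounded_measurableM; first exact: bounded_measurable_cst.
by have := bounded_cos 0 L 0 mU mU; under eq_fun do rewrite mul0r !addr0.
Qed.

(** The weight is the product of 2 - 2 cos (L U), 2 - 2 cos (L V) and the two
    Fejer kernels at U and V. *)
Lemma probe_wave U V L M : measurable_fun setT U -> measurable_fun setT V ->
  exists f, [/\ bounded_measurable f, forall w, 0 <= f w &
    forall c, probe L M (wave U V (fun=> 1) c) = wave U V f c].
Proof.
move=> mU mV.
pose f1 w := 1 * fejer_kernel M (V w).
pose f2 w := f1 w * fejer_kernel M (U w).
pose f3 w := f2 w * (2 - 2 * cos (L * V w)).
pose f4 w := f3 w * (2 - 2 * cos (L * U w)).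
have b1 : bounded_measurable f1.
  by apply: bounded_measurableM; [exact: bounded_measurable_cst|exact: bounded_fejer].
have b2 : bounded_measurable f2 by apply: bounded_measurableM => //; exact: bounded_fejer.
have b3 : bounded_measurable f3 by apply: bounded_measurableM => //; exact: bounded_diff.
have b4 : bounded_measurable f4 by apply: bounded_measurableM => //; exact: bounded_diff.
exists f4; split=> //.
- have pos x : 0 <= 2 - 2 * cos x :> R by have := cos_le1 x; lra.
  by move=> w; rewrite /f4 /f3 /f2 /f1 !mulr_ge0// fejer_kernel_ge0.
- move=> c; rewrite /probe /diff2 /fejer2 swap_wave fejer1_wave//; last exact: bounded_measurable_cst.
  by rewrite swap_wave fejer1_wave// swap_wave diff1_wave// swap_wave diff1_wave.
Qed.

Lemma probe_dominated U V L M x y c : measurable_fun setT U -> measurable_fun setT V ->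
  probe L M (wave U V (fun=> 1) c) x y <= probe L M (wave U V (fun=> 1) 0) 0 0.
Proof.
move=> mU mV; have [f [bf f0 E]] := probe_wave L M mU mV; rewrite !E.
have := iwave c x y mU mV bf; have := iwave 0 0 0 mU mV bf.
move=> i0 ixy; rewrite /wave; apply: (le_Rintegral measurableT ixy i0) => w _; apply: ler_wpM2l => //.
by rewrite !mul0r !addr0 cos0 cos_le1.
Qed.
End positivity.

Section self_decomposable_domination.
Context {R : realType} {n : nat}.
Notation V := 'rV[R]_n.

Lemma independent_expectation {d : measure_display} {T : measurableType d}
    (P : probability T R) (X Z : T -> V) (f g : borel V -> R) :
  random_element X -> random_element Z -> independent_pair P X Z ->
  bounded_measurable f -> bounded_measurable g ->
  \int[P]_w (f (X w) * g (Z w)) = (\int[P]_w f (X w)) * \int[P]_w g (Z w).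
Proof.
move=> rX rZ ind bf bg.
have mX A : measurable (A : set (borel V)) -> measurable (X @^-1` A).
  by move=> mA; rewrite -[X in measurable X]setTI; exact: rX.
have mZ A : measurable (A : set (borel V)) -> measurable (Z @^-1` A).
  by move=> mA; rewrite -[X in measurable X]setTI; exact: rZ.
have bX (h : borel V -> R) : bounded_measurable h -> bounded_measurable (fun w => h (X w)).
  exact: (bounded_measurable_comp rX).
have bZ (h : borel V -> R) : bounded_measurable h -> bounded_measurable (fun w => h (Z w)).
  exact: (bounded_measurable_comp rZ).
have iXY (h : T -> R) (Y : T -> V) : random_element Y -> bounded_measurable h ->
    integral_like (fun k : borel V -> R => \int[P]_(w in setT) (k (Y w) * h w)).
  move=> rY bh; apply: integral_like_Rintegral => //.
  exact: bounded_measurable_integrable.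
have iY (Y : T -> V) C : random_element Y ->
    integral_like (fun k : borel V -> R => (\int[P]_(w in setT) (k (Y w) * 1)) * C).
  move=> rY; apply: integral_likeMr; apply: iXY => //; exact: bounded_measurable_cst.
have one (h : T -> R) : \int[P]_w (h w * 1) = \int[P]_w h w.
  by under eq_Rintegral do rewrite mulr1.
have rectangle A : measurable (A : set (borel V)) ->
    \int[P]_w (\1_A (X w) * g (Z w)) = (\int[P]_w \1_A (X w)) * \int[P]_w g (Z w).
  move=> mA; rewrite [RHS]mulrC -(one (fun w => g (Z w))).
  under eq_Rintegral do rewrite mulrC.
  have bA : bounded_measurable (fun w => \1_A (X w) : R).
    by apply: bX; exact: bounded_measurable_indic.
  apply: (integral_like_indic (iXY _ _ rZ bA) (iY Z (\int[P]_w \1_A (X w)) rZ) _ bg) => B mB.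
  rewrite one.
  transitivity (\int[P]_w \1_(X @^-1` A `&` Z @^-1` B) w).
    by apply: eq_Rintegral => w _; rewrite indicI mulrC.
  rewrite Rintegral_indic; last by apply: measurableI; [exact: mX|exact: mZ].
  rewrite ind// fineM ?fin_num_measure//; [|exact: mX|exact: mZ].
  rewrite -(Rintegral_indic P (mX _ mA)) -(Rintegral_indic P (mZ _ mB)) mulrC.
  by congr (_ * _); apply: eq_Rintegral => w _; rewrite ?indicE.
rewrite -(one (fun w => f (X w))).
apply: (integral_like_indic (iXY _ _ rX (bZ _ bg)) (iY X (\int[P]_w g (Z w)) rX) _ bf) => A mA.
by rewrite rectangle// one.
Qed.

Context {d : measure_display} {T : measurableType d}.
Variables (P : probability T R) (X : T -> V) (A B : V -> R).
Hypothesis rX : random_element X.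
Hypothesis XE : forall theta c,
  \int[P]_w cos (dot theta (X w) + c) = expR (A theta) * cos (B theta + c).
Hypothesis sdX : self_decomposable P X.

(** The characteristic function of X' does not vanish, so the one of Z is a
    quotient. With phases, the quotient is the solution of two linear equations
    in the transforms of Z at the phases c and c + pi / 2, whose determinant is
    cos^2 + sin^2 = 1. *)
Lemma innovation_char b : 0 < b -> b < 1 ->
  exists (d' : measure_display) (T' : measurableType d') (P' : probability T' R) (Z : T' -> V),
  random_element Z /\ forall theta c, \int[P']_w cos (dot theta (Z w) + c) =
    expR (A theta - A (b *: theta)) * cos (B theta - B (b *: theta) + c).
Proof.
move=> b0 b1; have [d' [T' [P' [X' [Z [rX' rZ lawX' ind law]]]]]] := sdX b0 b1.
exists d', T', P', Z; split=> // theta c.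
have rbXZ : random_element (fun w => b *: X' w + Z w).
  apply: measurable_rV => k; under eq_fun do rewrite !mxE.
  apply: measurable_funD; last exact: (measurable_rV_coord k rZ).
  by apply: measurable_funM => //; exact: (measurable_rV_coord k rX').
have X'E t s : \int[P']_w cos (dot t (X' w) + s) = expR (A t) * cos (B t + s).
  rewrite -XE; apply: esym.
  exact: (same_law_expectation rX rX' lawX' (bounded_measurable_cos t s)).
have factor s : expR (A theta) * cos (B theta + s) =
    expR (A (b *: theta)) * (cos (B (b *: theta)) * (\int[P']_w cos (dot theta (Z w) + s))
      + cos (B (b *: theta) - pi / 2) * (\int[P']_w cos (dot theta (Z w) + (s + pi / 2)))).
  rewrite -XE (same_law_expectation rX rbXZ law (bounded_measurable_cos theta s)).
  have cX t : bounded_measurable (fun w => cos (dot (b *: theta) (X' w) + t)).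
    exact: bounded_measurable_cos_comp.
  have cZ t : bounded_measurable (fun w => cos (dot theta (Z w) + t)).
    exact: bounded_measurable_cos_comp.
  have split_cos : \int[P']_w cos (dot theta (b *: X' w + Z w) + s) =
     \int[P']_w (cos (dot (b *: theta) (X' w) + 0) * cos (dot theta (Z w) + s)
     + cos (dot (b *: theta) (X' w) - pi / 2) * cos (dot theta (Z w) + (s + pi / 2))).
    apply: eq_Rintegral => w _.
    rewrite dotDr dotZr dotZl addr0 cosBpihalf.
    set p := b * _; set r := dot theta (Z w); rewrite -addrA [r + (s + _)]addrA.
    by rewrite cosDpihalf [cos (p + _)]cosD; ring.
  rewrite split_cos RintegralD//; [|exact/bounded_measurable_integrable/bounded_measurableM..].
  rewrite !(independent_expectation rX' rZ ind (bounded_measurable_cos _ _) (bounded_measurable_cos _ _)).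
  by rewrite !X'E addr0; ring.
have f1 := factor c; have f2 := factor (c + pi / 2).
rewrite cosBpihalf in f1 f2.
have shift : \int[P']_w cos (dot theta (Z w) + (c + pi / 2 + pi / 2)) =
    - \int[P']_w cos (dot theta (Z w) + c).
  rewrite -mulN1r -RintegralZl//; last exact/bounded_measurable_integrable/bounded_measurable_cos_comp.
  by apply: eq_Rintegral => w _; rewrite addrA !addrA cosDpihalf sinDpihalf mulN1r.
rewrite shift [B theta + (_ + _)]addrA cosDpihalf in f2.
rewrite addrAC cosB expRD expRN.
have e0 : expR (A (b *: theta)) != 0 by rewrite gt_eqF// expR_gt0.
apply: (mulfI e0).
have -> (u v w : R) : u * (v * u^-1 * w) = (u * u^-1) * (v * w) by ring.
rewrite divff// mul1r mulrDr [expR (A theta) * (_ * _)]mulrA f1.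
have -> : expR (A theta) * (sin (B theta + c) * sin (B (b *: theta))) =
  - (expR (A theta) * - sin (B theta + c)) * sin (B (b *: theta)) by ring.
rewrite f2.
set Cc := \int[P']_w _; set Sc := \int[P']_w _.
have := cos2Dsin2 (B (b *: theta)).
set x := cos _; set y := sin _ => xy.
transitivity (expR (A (b *: theta)) * ((x ^+ 2 + y ^+ 2) * Cc)); first by rewrite xy mul1r.
ring.
Qed.

Definition innovation_wave b (e f : V) c (x y : R) :=
  let theta := x *: e + y *: f in
  expR (A theta - A (b *: theta)) * cos (B theta - B (b *: theta) + c).

Lemma innovation_dominated b e f L M x y c : 0 < b -> b < 1 ->
  probe L M (innovation_wave b e f c) x y <= probe L M (innovation_wave b e f 0) 0 0.
Proof.
move=> b0 b1; have [d' [T' [P' [Z [rZ ZE]]]]] := innovation_char b0 b1.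
have mdot t : measurable_fun setT (fun w => dot t (Z w)).
  under eq_fun do rewrite dotE; apply: measurable_sum => i.
  by apply: measurable_funM => //; exact: (measurable_rV_coord i rZ).
have waveE s : innovation_wave b e f s = wave P' (fun w => dot e (Z w)) (fun w => dot f (Z w)) (fun=> 1) s.
  apply/funext => u; apply/funext => v; rewrite /innovation_wave /= -ZE /wave.
  by apply: eq_Rintegral => w _; rewrite mul1r dotD !dotZl.
by rewrite !waveE; exact: probe_dominated.
Qed.

Variables (A' B' : V -> R).
Hypothesis dA : forall theta, is_derive (1 : R) 1 (fun b => A (b *: theta)) (A' theta).
Hypothesis dB : forall theta, is_derive (1 : R) 1 (fun b => B (b *: theta)) (B' theta).

(** The wave of Z_b minus its value at b = 1, divided by b - 1 < 0, converges to
    the radial derivative as b tends to 1 from below; the division reverses the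
    domination of [innovation_dominated], and the operator does not see the
    subtracted constant. *)
Lemma self_decomposable_dominated e f L M x y :
  probe L M (fun x y => B' (x *: e + y *: f)) x y <=
  probe L M (fun x y => A' (x *: e + y *: f)) 0 0.
Proof.
(* D c is the derivative at b = 1 of the wave of Z_b. *)
pose D c x y := - (A' (x *: e + y *: f) * cos c) + B' (x *: e + y *: f) * sin c.
pose slope c h u v := h^-1 * innovation_wave (h + 1) e f c u v + (- (h^-1 * cos c) + 0).
have slope_cvg c u v : slope c h u v @[h --> 0^'] --> D c u v.
  pose theta := u *: e + v *: f.
  pose F b := innovation_wave b e f c u v.
  have dF : is_derive (1 : R) 1 F (D c u v).
    have dAt := dA theta; have dBt := dB theta.
    rewrite /F /innovation_wave -/theta.
    apply: is_derive_eq; rewrite ?scale1r ?subrr ?expR0 ?add0r /D -/theta.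
    by rewrite /GRing.scale/=; ring.
  have [dF1 dF2] := dF.
  have : h^-1 *: (F (h *: 1 + 1) - F 1) @[h --> 0^'] --> D c u v.
    by rewrite -dF2; exact: dF1.
  apply: cvg_trans; apply: near_eq_cvg; near=> h.
  rewrite /slope addr0 scaler1 -[LHS]/(h^-1 * _) mulrBr; congr (_ - _ * _).
  by rewrite /F /innovation_wave scale1r !subrr expR0 mul1r add0r.
have slope_dom h : -1 < h -> h < 0 -> probe L M (slope 0 h) 0 0 <= probe L M (slope (- (pi / 2)) h) x y.
  move=> h1 h0; rewrite /slope !(probe_affine L M h^-1 _ (fun=> _) (fun=> 0)).
  apply: ler_wnM2l; first by rewrite invr_le0 ltW.
  by apply: innovation_dominated; lra.
have lim c u v : probe L M (slope c h) u v @[h --> 0^'-] --> probe L M (D c) u v.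
  apply: cvg_probe => s t; apply: cvg_trans (slope_cvg c s t).
  by apply: cvg_app; apply: within_subset => h /=; rewrite lt_neqAle => /andP[].
have : probe L M (D 0) 0 0 <= probe L M (D (- (pi / 2))) x y.
  apply: (ler_cvg_to (lim _ _ _) (lim _ _ _)); near=> h; apply: slope_dom; near: h.
    by apply: nbhs_left_gt; lra.
  exact: nbhs_left_lt.
have D0 : D 0 = fun x y => -1 * A' (x *: e + y *: f) + (0 + 0).
  by apply/funext => u; apply/funext => v; rewrite /D cos0 sin0; ring.
have Dpi : D (- (pi / 2)) = fun x y => -1 * B' (x *: e + y *: f) + (0 + 0).
  by apply/funext => u; apply/funext => v; rewrite /D cosN sinN cos_pihalf sin_pihalf; ring.
rewrite D0 Dpi (probe_affine L M (-1) (fun x y => A' (x *: e + y *: f)) (fun=> 0) (fun=> 0)).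
rewrite (probe_affine L M (-1) (fun x y => B' (x *: e + y *: f)) (fun=> 0) (fun=> 0)).
by rewrite !mulN1r lerN2.
Unshelve. all: end_near. Qed.
End self_decomposable_domination.

(** * A plane with nonzero drift violates the domination *)

Section slopes.
Context {R : realType}.
Implicit Types (q l x y : R).

(** The radial derivative of a ray term is re_slope - 2 + i im_slope; the
    constant - 2 is split off to leave a nonnegative function that decays. *)
Definition re_slope q l := (2 * (1 + q) + l ^+ 2) / ((1 + q) ^+ 2 + l ^+ 2).
Definition im_slope q l := l * (1 - q) / ((1 + q) ^+ 2 + l ^+ 2).

Let den_gt0 q l : 0 <= q -> 0 < (1 + q) ^+ 2 + l ^+ 2.
Proof. by move=> q0; rewrite ltr_wpDr ?sqr_ge0// exprn_gt0// ltr_wpDr. Qed.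

Lemma re_slope_ge0 q l : 0 <= q -> 0 <= re_slope q l.
Proof.
move=> q0; apply: divr_ge0; last exact: ltW (den_gt0 l q0).
by rewrite addr_ge0 ?sqr_ge0// mulr_ge0// addr_ge0.
Qed.

Lemma re_slope_le q l C : 0 <= q -> 0 <= C -> l ^+ 2 <= C * q ->
  re_slope q l <= (2 + C) / (1 + q).
Proof.
move=> q0 C0 lq; rewrite /re_slope ler_pdivrMr ?den_gt0// mulrAC ler_pdivlMr ?ltr_wpDr//.
have l0 := sqr_ge0 l.
apply: (@le_trans _ _ ((2 + C) * (1 + q) ^+ 2)); last first.
  by apply: ler_wpM2l; [rewrite addr_ge0|rewrite lerDl].
have := mulr_ge0 C0 q0; rewrite !expr2 in lq l0 *; nra.
Qed.

Lemma im_slope_norm_le q l : 0 <= q -> `|im_slope q l| <= `|l| / (1 + q).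
Proof.
move=> q0; have q1 : 0 < 1 + q by rewrite ltr_wpDr.
rewrite /im_slope !normrM normfV (gtr0_norm (den_gt0 l q0)) -mulrA.
apply: ler_wpM2l => //; rewrite ler_pdivrMr ?den_gt0// ler_pdivlMl//.
apply: (@le_trans _ _ ((1 + q) ^+ 2)); last by rewrite lerDl sqr_ge0.
rewrite expr2 ler_wpM2l ?(ltW q1)// ler_norml; apply/andP; split; lra.
Qed.

(** For q >= 2 the numerator l (1 - q) has the sign of - l and is of order
    |l| q, against a denominator of order q^2. *)
Lemma im_slope_lower q l C : 2 <= q -> 0 <= C -> l ^+ 2 <= C * q -> l <= 0 ->
  - l / (2 * (3 + C) * q) <= im_slope q l.
Proof.
move=> q2 C0 lq l0; have q0 : 0 < q by lra.
have D0 : 0 < 2 * (3 + C) * q by rewrite !mulr_gt0// ltr_wpDr.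
have -> : im_slope q l = - l * ((q - 1) / ((1 + q) ^+ 2 + l ^+ 2)).
  by rewrite /im_slope; field; rewrite gt_eqF// den_gt0 ?ltW.
apply: ler_wpM2l; first by rewrite oppr_ge0.
rewrite ler_pdivlMr ?den_gt0 ?(ltW q0)// mulrC ler_pdivrMr//.
have h1 : (1 + q) ^+ 2 + l ^+ 2 <= (3 + C) * q ^+ 2.
  have Cq := mulr_ge0 C0 (ltW q0).
  have : C * q <= C * q ^+ 2 by apply: ler_wpM2l => //; rewrite expr2; nra.
  rewrite !expr2 in lq *; nra.
apply: le_trans h1 _.
have -> : (q - 1) * (2 * (3 + C) * q) = (3 + C) * (2 * (q - 1) * q) by ring.
by apply: ler_wpM2l; [rewrite addr_ge0|rewrite expr2; nra].
Qed.

(** The coordinates are oriented so that l is negative, hence im_slope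
    positive, around the positive x axis. *)
Lemma quadratic_no_dominance (q l : R -> R -> R) (kappa K m m2 : R) :
  0 < kappa -> 0 < m ->
  (forall x y, kappa * (x ^+ 2 + y ^+ 2) <= q x y) ->
  (forall x y, q x y <= K * (x ^+ 2 + y ^+ 2)) ->
  (forall x y, l x y = - m * x + m2 * y) ->
  ~ (forall L M x y, probe L M (fun x y => im_slope (q x y) (l x y)) x y <=
                     probe L M (fun x y => re_slope (q x y) (l x y)) 0 0).
Proof.
move=> kappa0 m0 qlo qhi lE.
have kK : kappa <= K.
  by have := le_trans (qlo 1 0) (qhi 1 0); rewrite expr1n expr0n/= addr0 !mulr1.
have K0 : 0 < K by exact: lt_le_trans kK.
have ss x y : 0 <= x ^+ 2 + y ^+ 2 by rewrite addr_ge0 ?sqr_ge0.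
have q0 x y : 0 <= q x y by apply: le_trans (qlo x y); apply: mulr_ge0 => //; exact: ltW.
(* l^2 is at most C q because q dominates x^2 + y^2. *)
pose C := 2 * (m ^+ 2 + m2 ^+ 2) / kappa.
have C0 : 0 <= C by apply: divr_ge0; [rewrite mulr_ge0|exact: ltW].
have lq x y : l x y ^+ 2 <= C * q x y.
  apply: (@le_trans _ _ (C * (kappa * (x ^+ 2 + y ^+ 2)))); last exact: ler_wpM2l.
  have -> : C * (kappa * (x ^+ 2 + y ^+ 2)) = 2 * (m ^+ 2 + m2 ^+ 2) * (x ^+ 2 + y ^+ 2).
    by rewrite /C; field; exact: lt0r_neq0.
  rewrite lE; have := sqr_ge0 (m * y - m2 * x); have := sqr_ge0 (m * x + m2 * y).
  have := sqr_ge0 (m * x); have := sqr_ge0 (m * y); have := sqr_ge0 (m2 * x); have := sqr_ge0 (m2 * y).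
  have := sqr_ge0 (m * x - m2 * y).
  rewrite !expr2; lra.
pose k1 := Num.min 1 kappa.
have k10 : 0 < k1 by rewrite lt_min ltr01.
have k1q x y : k1 * (1 + x ^+ 2 + y ^+ 2) <= 1 + q x y.
  have h1 : k1 <= 1 by rewrite ge_min lexx.
  have h2 : k1 <= kappa by rewrite ge_min lexx orbT.
  have := qlo x y; have := ler_wpM2r (ss x y) h2.
  have -> : k1 * (1 + x ^+ 2 + y ^+ 2) = k1 + k1 * (x ^+ 2 + y ^+ 2) by ring.
  lra.
have norm_bound x y z : z ^+ 2 <= x ^+ 2 + y ^+ 2 ->
    `|im_slope (q x y) (l x y)| * `|z| <= (C + kappa^-1) / 2.
  move=> zxy; have q1 : 0 < 1 + q x y by rewrite ltr_wpDr.
  apply: (@le_trans _ _ (`|l x y| / (1 + q x y) * `|z|)).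
    by apply: ler_wpM2r => //; exact: im_slope_norm_le.
  rewrite mulrAC ler_pdivrMr//.
  have zq : z ^+ 2 <= kappa^-1 * q x y.
    by rewrite ler_pdivlMl//; apply: le_trans (qlo x y); rewrite ler_pM2l.
  have := sqr_ge0 (`|l x y| - `|z|).
  have -> : (`|l x y| - `|z|) ^+ 2 = `|l x y| ^+ 2 + `|z| ^+ 2 - 2 * (`|l x y| * `|z|) by ring.
  rewrite !real_normK ?num_real//; have := lq x y.
  have : 0 <= kappa^-1 by rewrite invr_ge0 ltW.
  lra.
pose rho := m / (2 * (`|m2| + 1)).
have m21 : 0 < `|m2| + 1 by rewrite ltr_wpDl.
have rho0 : 0 < rho by rewrite divr_gt0// mulr_gt0.
have rhoE : rho * (`|m2| + 1) = m / 2 by rewrite /rho; field; exact: lt0r_neq0.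
pose r := 1 + 2 / kappa.
have r1 : 1 <= r by rewrite lerDl divr_ge0// ltW.
have r0 : 0 < r by exact: lt_le_trans r1.
have kr : 2 <= kappa * r.
  rewrite /r mulrDr mulr1 mulrCA divff ?lt0r_neq0// mulr1; lra.
pose K2 := K * (1 + rho ^+ 2).
have K20 : 0 < K2 by rewrite mulr_gt0// ltr_wpDr ?sqr_ge0.
pose c1 := m / (4 * (3 + C) * K2).
have c3 : 0 < 3 + C by rewrite ltr_wpDr.
have c10 : 0 < c1 by apply: divr_gt0 => //; apply: mulr_gt0 => //; exact: mulr_gt0.
apply: (@no_dominance R _ _ ((2 + C) / k1) ((C + kappa^-1) / 2) c1 r rho) => //.
- by move=> x y; exact: re_slope_ge0.
- move=> x y; apply: le_trans (re_slope_le (q0 x y) C0 (lq x y)) _.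
  rewrite -mulrA -invfM ler_wpM2l ?addr_ge0// lef_pV2 ?posrE//.
    by rewrite ltr_wpDr.
  by rewrite mulr_gt0// -addrA ltr_wpDr.
- by move=> x y; apply: norm_bound; rewrite lerDl sqr_ge0.
- by move=> x y; apply: norm_bound; rewrite lerDr sqr_ge0.
move=> x y rx yx; have x0 : 0 < x by exact: lt_le_trans rx.
have lx : l x y <= - (m / 2 * x).
  rewrite lE.
  have h1 : m2 * y <= `|m2| * `|y| by rewrite -normrM ler_norm.
  have h2 := ler_wpM2l (normr_ge0 m2) yx.
  have h3 : `|m2| * (rho * x) <= m / 2 * x.
    rewrite -rhoE mulrA ler_pM2r// mulrC ler_pM2l// lerDl//.
  lra.
have q2 : 2 <= q x y.
  apply: le_trans (qlo x y); apply: (le_trans kr); rewrite ler_pM2l//.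
  apply: (le_trans rx); have := sqr_ge0 y; have : 1 <= x by exact: le_trans rx.
  rewrite !expr2; nra.
have qx : q x y <= K2 * x ^+ 2.
  apply: le_trans (qhi x y) _; rewrite /K2 -mulrA ler_pM2l//.
  rewrite mulrDl mul1r lerD2l -exprMn -[leLHS]real_normK ?num_real//.
  by rewrite ler_sqr ?nnegrE// mulr_ge0// ltW.
have lx0 : l x y <= 0.
  apply: le_trans lx _; rewrite oppr_le0; apply: mulr_ge0; last exact: ltW.
  by apply: divr_ge0 => //; exact: ltW.
have qxy0 : 0 < q x y by apply: lt_le_trans q2.
have := im_slope_lower q2 C0 (lq x y) lx0.
move=> /(ler_wpM2r (ltW x0)); apply: le_trans.
rewrite mulrAC ler_pdivlMr; last by apply: mulr_gt0 => //; exact: mulr_gt0.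
apply: (@le_trans _ _ (c1 * (2 * (3 + C) * (K2 * x ^+ 2)))).
  by rewrite ler_pM2l// ler_pM2l// mulr_gt0.
have -> : c1 * (2 * (3 + C) * (K2 * x ^+ 2)) = m / 2 * x * x.
  by rewrite /c1; field; rewrite !lt0r_neq0.
by rewrite ler_pM2r//; lra.
Qed.
End slopes.

(** * The ray terms on a coordinate plane *)

Section components.
Context {R : realType} {n : nat}.
Notation V := 'rV[R]_n.
Implicit Types (alpha mu theta : V) (Sigma : 'M[R]_n) (i j k : 'I_n).

Lemma ray_quadratic_scale alpha Sigma (j : 'I_n.+1) b theta :
  ray_quadratic alpha Sigma j (b *: theta) = b ^+ 2 * ray_quadratic alpha Sigma j theta.
Proof. by rewrite /ray_quadratic sqnorm_mx_scale; ring. Qed.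

Lemma ray_drift_scale alpha mu (j : 'I_n.+1) b theta :
  ray_drift alpha mu j (b *: theta) = b * ray_drift alpha mu j theta.
Proof. by rewrite /ray_drift dotZl. Qed.

Lemma ray_quadratic_axis alpha Sigma k theta : 0 <= alpha 0 k ->
  ray_quadratic alpha Sigma (lift ord0 k) theta =
  2^-1 * (alpha 0 k * Sigma k k * theta 0 k ^+ 2).
Proof.
move=> a0; rewrite /ray_quadratic /ray_direction liftK; congr (_ * _).
rewrite sqnorm_diamond_scale// sqnorm_mxE (bigD1 k)//= (bigD1 k)//=.
rewrite !mxE !eqxx minxx big1 ?addr0; last first.
  by move=> l lk; rewrite !mxE !eqxx (negPf lk)/= minEle ler10 mul0r mulr0 mul0r.
rewrite big1 ?addr0; first by rewrite /=; ring.
move=> p pk; apply: big1 => l _; rewrite !mxE eqxx (negPf pk)/= minEle.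
by rewrite ler0n mul0r mulr0 mul0r.
Qed.

Lemma ray_drift_axis alpha mu k theta :
  ray_drift alpha mu (lift ord0 k) theta = alpha 0 k * mu 0 k * theta 0 k.
Proof.
rewrite /ray_drift /ray_direction liftK diamond_vec_scale dotZr dotE (bigD1 k)//= big1 ?addr0.
  by rewrite !mxE !eqxx mul1r; ring.
by move=> l lk; rewrite !mxE eqxx (negPf lk)/= mul0r mulr0.
Qed.

(** Cauchy-Schwarz for the vector e_k Sigma^-1, whose Sigma-product with theta
    is theta_k. *)
Lemma coordinate_le_sqnorm Sigma k : covariance_matrix Sigma -> \det Sigma != 0 ->
  exists2 C, 0 <= C & forall theta, theta 0 k ^+ 2 <= C * sqnorm_mx Sigma theta.
Proof.
move=> covS dS; have uS : Sigma \in unitmx by rewrite unitmxE unitfE.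
pose v : V := delta_mx 0 k *m invmx Sigma.
exists (sqnorm_mx Sigma v) => [|theta]; first by case: covS.
suff <- : bilinear_mx Sigma v theta = theta 0 k by exact: covariance_CauchySchwarz.
rewrite /bilinear_mx /v mulmxKV// mxE (bigD1 k)//= big1 ?addr0.
  by rewrite !mxE !eqxx mul1r.
by move=> l lk; rewrite !mxE eqxx (negPf lk)/= mul0r.
Qed.

Lemma positive_lower_bound alpha : (forall k, 0 < alpha 0 k) ->
  exists2 c, 0 < c & forall k, c <= alpha 0 k.
Proof.
move=> alpha0; pose s := 1 + \sum_k (alpha 0 k)^-1.
have s0 k : 0 <= (alpha 0 k)^-1 by rewrite invr_ge0 ltW.
have s1 : 0 < s by rewrite ltr_wpDr// sumr_ge0.
exists s^-1 => [|k]; first by rewrite invr_gt0.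
rewrite -[leRHS]invrK lef_pV2 ?posrE ?invr_gt0// /s (bigD1 k)//= addrCA lerDl.
by rewrite addr_ge0// sumr_ge0.
Qed.

(** Only the summand k = j sees y, and none sees both x and y. *)
Lemma sum_two_axes (g : 'I_n -> R -> R) i j (s x y : R) : i != j ->
  \sum_k g k ((x *: (s *: delta_mx 0 i) + y *: delta_mx 0 j : V) 0 k) =
  \sum_(k | k != j) g k (x * (s * (k == i)%:R)) + g j y.
Proof.
move=> ij; rewrite (bigD1 j)//= addrC; congr (_ + _).
  by apply: eq_bigr => k kj; rewrite !mxE eqxx (negPf kj)/= mulr0 addr0.
by rewrite !mxE !eqxx eq_sym (negPf ij)/= !mulr0 add0r mulr1.
Qed.

(** The lower bound is where the invertibility of Sigma enters. *)
Lemma plane_form_bounds alpha Sigma i j (s : R) : i != j -> s ^+ 2 = 1 ->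
  (forall k, 0 < alpha 0 k) -> covariance_matrix Sigma -> \det Sigma != 0 ->
  exists kappa K, 0 < kappa /\ forall x y,
    let q := ray_quadratic alpha Sigma ord0 (x *: (s *: delta_mx 0 i) + y *: delta_mx 0 j) in
    kappa * (x ^+ 2 + y ^+ 2) <= q /\ q <= K * (x ^+ 2 + y ^+ 2).
Proof.
move=> ij s2 alpha0 covS dS.
have [c c0 calpha] := positive_lower_bound alpha0.
have [Ci Ci0 hi] := coordinate_le_sqnorm i covS dS.
have [Cj Cj0 hj] := coordinate_le_sqnorm j covS dS.
have CC : 0 < Ci + Cj + 1 by rewrite ltr_wpDl// addr_ge0.
pose D := diamond_mx alpha Sigma.
have dir0 : ray_direction alpha ord0 = alpha by rewrite /ray_direction unlift_none.
have sD : D^T = D.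
  by have [] := covariance_diamond covS (fun k => ltW (alpha0 k)).
pose e : V := s *: delta_mx 0 i; pose f : V := delta_mx 0 j.
exists (c / (2 * (Ci + Cj + 1))), (`|sqnorm_mx D e| + `|bilinear_mx D e f| + `|sqnorm_mx D f|).
split; first by rewrite divr_gt0// mulr_gt0.
move=> x y /=; rewrite /ray_quadratic dir0 -/D -/e -/f; split.
  set theta := x *: e + y *: f.
  have ti : theta 0 i = s * x.
    by rewrite !mxE !eqxx (negPf ij)/= mulr0 addr0 mulr1 mulrC.
  have tj : theta 0 j = y.
    by rewrite !mxE !eqxx eq_sym (negPf ij)/= !mulr0 add0r mulr1.
  have := hi theta; have := hj theta; rewrite ti tj exprMn s2 mul1r => hy hx.
  have lo := diamond_mx_lower_bound theta covS (ltW c0) calpha.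
  have S0 : 0 <= sqnorm_mx Sigma theta by case: covS.
  rewrite mulrAC ler_pdivrMr ?mulr_gt0//.
  have : c * (x ^+ 2 + y ^+ 2) <= c * ((Ci + Cj + 1) * sqnorm_mx Sigma theta).
    by apply: ler_wpM2l; [exact: ltW|lra].
  have := ler_wpM2l (ltW CC) lo; rewrite -/D; lra.
have -> : sqnorm_mx D (x *: e + y *: f) =
    x ^+ 2 * sqnorm_mx D e + 2 * (x * y) * bilinear_mx D e f + y ^+ 2 * sqnorm_mx D f.
  rewrite sqnorm_mxD// sqnorm_mx_scale; congr (_ + _ + _).
  suff -> : bilinear_mx D (x *: e) f = x * bilinear_mx D e f by ring.
  by rewrite /bilinear_mx -!scalemxAl mxE.
have n1 := ler_norm (sqnorm_mx D e); have n3 := ler_norm (sqnorm_mx D f).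
have x2 := sqr_ge0 x; have y2 := sqr_ge0 y.
have n2 : 2 * (x * y) * bilinear_mx D e f <= (x ^+ 2 + y ^+ 2) * `|bilinear_mx D e f|.
  apply: (le_trans (ler_norm _)); rewrite normrM; apply: ler_wpM2r => //.
  by rewrite ler_norml; apply/andP; split; [have := sqr_ge0 (x + y)|have := sqr_ge0 (x - y)]; rewrite !expr2; lra.
have m1 := ler_wpM2l x2 n1; have m3 := ler_wpM2l y2 n3.
have k1 := mulr_ge0 y2 (normr_ge0 (sqnorm_mx D e)); have k3 := mulr_ge0 x2 (normr_ge0 (sqnorm_mx D f)).
have k2 := mulr_ge0 (addr_ge0 x2 y2) (normr_ge0 (bilinear_mx D e f)).
have k4 := mulr_ge0 x2 (normr_ge0 (sqnorm_mx D e)); have k5 := mulr_ge0 y2 (normr_ge0 (sqnorm_mx D f)).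
lra.
Qed.
End components.

Section drift.
Context {R : realType} {n : nat}.
Notation V := 'rV[R]_n.

Lemma is_derive_weighted_phase (m : nat) (w q l : 'I_m -> R) (c : R) (G : R -> R -> R) :
  (forall j, 0 <= q j) ->
  (forall q l, 0 <= q -> is_derive (1 : R) 1 (fun b => ray_phase c (b ^+ 2 * q) (b * l)) (G q l)) ->
  is_derive (1 : R) 1 (fun b => \sum_j w j * ray_phase c (b ^+ 2 * q j) (b * l j))
    (\sum_j w j * G (q j) (l j)).
Proof.
move=> q0 dG.
have -> : (fun b => \sum_j w j * ray_phase c (b ^+ 2 * q j) (b * l j)) =
    \sum_j (fun b => w j * ray_phase c (b ^+ 2 * q j) (b * l j)).
  by apply/funext => b; rewrite fct_sumE.
apply: is_derive_sum => j.
have dj := dG _ (l j) (q0 j).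
by apply: is_derive_eq; rewrite /GRing.scale/=; ring.
Qed.

(** The sign s is opposite to that of mu_i, so that the drift of the common
    ray is negative for x > 0. *)
Lemma WVAG_drift_not_self_decomposable {d : measure_display} {T : measurableType d}
    (P : probability T R) (X : R -> T -> V) (a : R) (alpha mu : V) (Sigma : 'M[R]_n) :
  (2 <= n)%N -> 0 < a -> (forall k, 0 < alpha 0 k) -> covariance_matrix Sigma ->
  WVAG P X a alpha mu Sigma -> \det Sigma != 0 -> mu != 0 ->
  ~ self_decomposable_process P X.
Proof.
move=> n2 a0 alpha0 covS [d' [T' [P' [S [nu [SAG Snu [levX XE]]]]]]] dS mu0 sdX.
have n0 : (0 < n)%N by exact: ltn_trans n2.
have rX : random_element (X 1) by case: levX => + _ _ _ _ _; apply.
have [i mui] : exists i, mu 0 i != 0.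
  apply/existsP; apply: contraNT mu0 => /existsPn h; apply/eqP/rowP => k.
  by rewrite mxE; apply/eqP; rewrite -[_ == _]negbK h.
have [j ij] : exists j : 'I_n, i != j.
  have : (0 < #|[set~ i]%SET|)%N by rewrite cardsC1 card_ord -subn1 subn_gt0.
  by move=> /card_gt0P[j]; rewrite !inE eq_sym => ij; exists j.
pose q k theta := ray_quadratic alpha Sigma k theta.
pose l k theta := ray_drift alpha mu k theta.
pose w k := ray_weight a alpha k.
have q0 k theta : 0 <= q k theta by exact: ray_quadratic_ge0.
pose A theta := \sum_k w k * ray_re (q k theta) (l k theta).
pose B theta := \sum_k w k * ray_im (q k theta) (l k theta).
pose A' theta := \sum_k w k * (re_slope (q k theta) (l k theta) - 2).
pose B' theta := \sum_k w k * im_slope (q k theta) (l k theta).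
have phase theta c : \int[P]_w cos (dot theta (X 1 w) + c) = expR (A theta) * cos (B theta + c).
  rewrite Rintegral_cos_phase//.
  have := char_funE P (X 1) theta; rewrite XE// (weak_exponentE n0 alpha0 SAG Snu mu covS).
  rewrite [1%:C%C](_ : _ = 1)// mul1r /cexp /= => -[<- <-].
  by rewrite cosD; ring.
have dA theta : is_derive (1 : R) 1 (fun b => A (b *: theta)) (A' theta).
  have -> : (fun b => A (b *: theta)) =
      fun b => \sum_k w k * ray_phase 0 (b ^+ 2 * q k theta) (b * l k theta).
    apply/funext => b; apply: eq_bigr => k _.
    by rewrite /q /l ray_quadratic_scale ray_drift_scale ray_phase_re.
  apply: (@is_derive_weighted_phase _ w (q^~ theta) (l^~ theta) 0 (fun q l => re_slope q l - 2)) => // r t r0.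
  apply: (is_derive_eq (is_derive_ray_phase 0 t r0)).
  have den : (1 + r) ^+ 2 + t ^+ 2 != 0.
    by rewrite gt_eqF// ltr_wpDr ?sqr_ge0// exprn_gt0// ltr_wpDr.
  by rewrite cos0 sin0 /re_slope; field; exact: den.
have dB theta : is_derive (1 : R) 1 (fun b => B (b *: theta)) (B' theta).
  have -> : (fun b => B (b *: theta)) =
      fun b => \sum_k w k * ray_phase (- (pi / 2)) (b ^+ 2 * q k theta) (b * l k theta).
    apply/funext => b; apply: eq_bigr => k _.
    by rewrite /q /l ray_quadratic_scale ray_drift_scale ray_phase_im.
  apply: (@is_derive_weighted_phase _ w (q^~ theta) (l^~ theta) (- (pi / 2)) im_slope) => // r t r0.
  apply: (is_derive_eq (is_derive_ray_phase (- (pi / 2)) t r0)).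
  by rewrite cosN sinN cos_pihalf sin_pihalf /im_slope; congr (_ / _); ring.
pose s : R := - Num.sg (mu 0 i).
have s2 : s ^+ 2 = 1 by rewrite sqrrN sqr_sg mui.
pose theta x y : V := x *: (s *: delta_mx 0 i) + y *: delta_mx 0 j.
have [kappa [K [kappa0 bounds]]] := plane_form_bounds ij s2 alpha0 covS dS.
pose m := alpha 0 i * `|mu 0 i|.
have m0 : 0 < m by rewrite mulr_gt0// normr_gt0.
have lE x y : l ord0 (theta x y) = - m * x + (alpha 0 j * mu 0 j) * y.
  rewrite /l /ray_drift /theta dotD dotZl !dot_delta /m /s.
  by rewrite /ray_direction unlift_none !mxE normrEsg; ring.
pose gre k t := w (lift ord0 k) *
  (re_slope (2^-1 * (alpha 0 k * Sigma k k * t ^+ 2)) (alpha 0 k * mu 0 k * t) - 2).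
pose gim k t := w (lift ord0 k) *
  im_slope (2^-1 * (alpha 0 k * Sigma k k * t ^+ 2)) (alpha 0 k * mu 0 k * t).
have w0 : w ord0 = a by rewrite /w /ray_weight unlift_none.
have axis k x y : w (lift ord0 k) * (re_slope (q (lift ord0 k) (theta x y)) (l (lift ord0 k) (theta x y)) - 2)
      = gre k (theta x y 0 k) /\
    w (lift ord0 k) * im_slope (q (lift ord0 k) (theta x y)) (l (lift ord0 k) (theta x y))
      = gim k (theta x y 0 k).
  by rewrite /q /l ray_quadratic_axis ?ray_drift_axis// ltW.
have A'E : (fun x y => A' (theta x y)) = fun x y =>
    a * re_slope (q ord0 (theta x y)) (l ord0 (theta x y)) +
    ((\sum_(k | k != j) gre k (x * (s * (k == i)%:R)) - a * 2) + gre j y).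
  apply/funext => x; apply/funext => y; rewrite /A' big_ord_recl w0.
  under eq_bigr => k _ do rewrite (axis k x y).1.
  by rewrite sum_two_axes//; ring.
have B'E : (fun x y => B' (theta x y)) = fun x y =>
    a * im_slope (q ord0 (theta x y)) (l ord0 (theta x y)) +
    (\sum_(k | k != j) gim k (x * (s * (k == i)%:R)) + gim j y).
  apply/funext => x; apply/funext => y; rewrite /B' big_ord_recl w0.
  under eq_bigr => k _ do rewrite (axis k x y).2.
  by rewrite sum_two_axes.
apply: (@quadratic_no_dominance R (fun x y => q ord0 (theta x y)) (fun x y => l ord0 (theta x y))
  kappa K m (alpha 0 j * mu 0 j)) => //.
- by move=> x y; have [] := bounds x y.
- by move=> x y; have [] := bounds x y.
move=> L M x y.
have := self_decomposable_dominated rX phase sdX dA dB (s *: delta_mx 0 i) (delta_mx 0 j) L M x y.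
rewrite -!/(theta _ _) A'E B'E.
rewrite (probe_affine L M a _ (fun x => \sum_(k | k != j) gre k (x * (s * (k == i)%:R)) - a * 2) (gre j)).
rewrite (probe_affine L M a _ (fun x => \sum_(k | k != j) gim k (x * (s * (k == i)%:R))) (gim j)).
by rewrite ler_pM2l.
Qed.
End drift.

Theorem corollary4p1 (R : realType) (n : nat) (a : R)
    (alpha mu : 'rV[R]_n) (Sigma : 'M[R]_n)
    (d : measure_display) (T : measurableType d) (P : probability T R)
    (X : R -> T -> 'rV[R]_n)
    (n_ge2 : (2 <= n)%N)
    (a_gt0 : 0 < a)
    (alpha_gt0 : forall k, 0 < alpha 0 k)
    (a_alpha_lt1 : forall k, a * alpha 0 k < 1)
    (Sigma_cov : covariance_matrix Sigma)
    (X_WVAG : WVAG P X a alpha mu Sigma) :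
  (mu = 0 -> self_decomposable_process P X) /\
  (\det Sigma <> 0 -> mu <> 0 -> ~ self_decomposable_process P X).
Proof.
split=> [mu0|/eqP dS /eqP mu0].
  rewrite mu0 in X_WVAG.
  exact: (WVAG_driftless_self_decomposable (ltnW n_ge2) a_gt0 alpha_gt0 a_alpha_lt1 Sigma_cov X_WVAG).
exact: (WVAG_drift_not_self_decomposable n_ge2 a_gt0 alpha_gt0 Sigma_cov X_WVAG).
Qed.
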